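(* Let $(G,H)$ be a reduced discrete Hecke pair and let $(\bar G,\bar H)$ be its Schlichting completion. The following are equivalent: (i) the Hecke pair $(G,H)$ has property (RD); (ii) the Hecke pair $(\bar G,\bar H)$ has property (RD); (iii) the totally disconnected locally compact group $\bar G$ has property (RD).
   Context: A discrete Hecke pair is a group $G$ with a subgroup $H$ such that $[H:H\cap xHx^{-1}]<\infty$ for all $x\in G$; it is reduced if $\bigcap_{x\in G}xHx^{-1}=\{e\}$. Schlichting completion: $G$ acts faithfully (by reducedness) on the set $G/H$ by left multiplication, so $G$ embeds in the group of permutations of $G/H$; endow that group with the topology of pointwise convergence ($G/H$ discrete), let $\bar G$ be the closure of $G$ and $\bar H$ the closure of $H$. Then $\bar G$ is a totally disconnected locally compact group in which $G$ is dense and $\bar H$ is a compact open subgroup. For a locally compact group $G$ with closed subgroup $H$ and $H\backslash G$ discrete or $H$ compact, equip $H\backslash G$ with a right $G$-invariant measure $\nu$ (counting measure in the discrete case) and let $\mathcal H(G,H)$ be the compactly supported continuous right $H$-invariant functions on $H\backslash G$ with product $f*g(Hx)=\int_{H\backslash G}f(Hxy^{-1})g(Hy)\,d\nu(Hy)$ and left regular representation $\lambda(f)\xi=f*\xi$ on $L^2(H\backslash G,\nu)$. A length function on $(G,H)$ is a Borel $l:G\to[0,\infty)$ with $l(e)=0$, $l(g)=l(g^{-1})$, $l(gh)\le l(g)+l(h)$, $l|_H=0$; locally bounded means the induced function on $H\backslash G$ is bounded on compact sets. $(G,H)$ has property (RD) if there exist a locally bounded length function $l$ on $(G,H)$ and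 $s,c>0$ with $\|\lambda(f)\|\le c\big(\int_{H\backslash G}|f(Hx)|^2(1+l(x))^{2s}d\nu(Hx)\big)^{1/2}$ for all $f\in\mathcal H(G,H)$; a locally compact group $G$ has property (RD) if $(G,\{e\})$ does (with right Haar measure). *)

(* Defs.v *)
From HB Require Import structures.
From mathcomp Require Import all_boot all_order all_algebra.
From mathcomp Require Import all_classical all_reals all_analysis.
From mathcomp Require Import complex.
Set Implicit Arguments.
Unset Strict Implicit.
Unset Printing Implicit Defensive.
Import Order.TTheory GRing.Theory Num.Theory.
Local Open Scope classical_set_scope.
Local Open Scope ring_scope.

Definition cre {R : rcfType} (z : R[i]) : R := complex.Re z.
Definition cim {R : rcfType} (z : R[i]) : R := complex.Im z.
Definition cabs2 {R : rcfType} (z : R[i]) : R := cre z ^+ 2 + cim z ^+ 2.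

Section GroupDefs.
Context {T : Type} (mul : T -> T -> T) (inv : T -> T) (e : T).

Definition is_group : Prop :=
  [/\ forall x y z, mul x (mul y z) = mul (mul x y) z,
      forall x, mul e x = x /\ mul x e = x
    & forall x, mul (inv x) x = e /\ mul x (inv x) = e].

Definition is_subgroup (G H : set T) : Prop :=
  [/\ H `<=` G, H e, forall x y, H x -> H y -> H (mul x y)
    & forall x, H x -> H (inv x)].

Definition lcoset (H : set T) (x : T) : set T := [set mul x h | h in H].
Definition rcoset (H : set T) (x : T) : set T := [set mul h x | h in H].
Definition conjset (H : set T) (x : T) : set T :=
  [set mul (mul x h) (inv x) | h in H].

Definition hecke_pair (G H : set T) : Prop :=
  is_subgroup G H /\
  forall x, G x -> finite_set [set lcoset (H `&` conjset H x) h | h in H].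

Definition reduced_pair (G H : set T) : Prop :=
  \bigcap_(x in G) conjset H x = [set e].
End GroupDefs.

(* Property (RD) for a pair (G,K) inside a topological group whose          *)
(* homogeneous space K\G is discrete (counting measure on K\G).             *)
(* Functions on K\G are represented by left K-invariant functions on G;     *)
(* a right coset C is evaluated at an (arbitrary) representative rep C.     *)
Section RDDiscreteQuotient.
Context {R : realType} {X : topologicalType}
  (mul : X -> X -> X) (inv : X -> X) (e : X) (G K : set X).

Definition borel_on (l : X -> R) : Prop :=
  forall Y : set R, measurable Y -> <<s @open X >> (G `&` l @^-1` Y).

Definition length_fun (l : X -> R) : Prop :=
  borel_on l /\ l e = 0 /\ (forall g, G g -> 0 <= l g) /\
  (forall g, G g -> l g = l (inv g)) /\
  (forall g h, G g -> G h -> l (mul g h) <= l g + l h) /\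
  (forall h, K h -> l h = 0).

Definition rcosets : set (set X) := [set C | exists2 x, G x & C = rcoset mul K x].
Definition rep (C : set X) : X := xget e C.

Definition left_K_inv (f : X -> R[i]) : Prop :=
  forall k x, K k -> G x -> f (mul k x) = f x.
Definition right_K_inv (f : X -> R[i]) : Prop :=
  forall k x, K k -> G x -> f (mul x k) = f x.

(* the induced function on K\G is bounded on compact (= finite, K\G being
   discrete) sets of cosets *)
Definition loc_bounded_disc (l : X -> R) : Prop :=
  forall F : set (set X), F `<=` rcosets -> finite_set F ->
    exists M : R, forall C, F C -> forall x, C x -> l x <= M.

(* H(G,K): finitely supported (= compactly supported and continuous on the
   discrete space K\G), right K-invariant functions on K\G *)
Definition hecke_fun (f : X -> R[i]) : Prop :=
  [/\ left_K_inv f, right_K_inv f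
    & finite_set [set C | rcosets C /\ f (rep C) != 0]].

Definition l2norm2 (xi : X -> R[i]) : \bar R :=
  \esum_(C in rcosets) (cabs2 (xi (rep C)))%:E.

Definition conv_disc (f xi : X -> R[i]) (x : X) : R[i] :=
  \sum_(C \in rcosets) (f (mul x (inv (rep C))) * xi (rep C)).

Definition weighted_norm2 (l : X -> R) (s : R) (f : X -> R[i]) : \bar R :=
  \esum_(C in rcosets) (cabs2 (f (rep C)) * (1 + l (rep C)) `^ (2 * s))%:E.

(* Property (RD): ||lambda(f)|| <= c (weighted norm of f); the operator norm
   bound is written as ||f * xi||_2^2 <= (c * W(f))^2 ||xi||_2^2 for all xi in
   l^2(K\G). *)
Definition RD_disc : Prop :=
  exists l : X -> R, length_fun l /\ loc_bounded_disc l /\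
  exists s c : R, 0 < s /\ 0 < c /\
    forall f, hecke_fun f ->
    forall xi, left_K_inv xi -> (l2norm2 xi < +oo)%E ->
      (l2norm2 (conv_disc f xi) <=
         (c ^+ 2)%:E * weighted_norm2 l s f * l2norm2 xi)%E.
End RDDiscreteQuotient.

(* The Schlichting completion of (G,H), G = the whole carrier gT.           *)
(* Sym(G/H) is encoded as the maps sigma : set gT -> set gT that permute    *)
(* the left cosets xH and fix every other subset of gT; the ambient space   *)
(* carries the topology of pointwise convergence (set gT discrete), which   *)
(* on Sym(G/H) is the topology of pointwise convergence on G/H.             *)
Section Schlichting.
Context {gT : pointedType} (mul : gT -> gT -> gT) (inv : gT -> gT) (e : gT)
  (H : set gT).

Definition Cos := discrete_topology (set gT).
Definition Ambient := {ptws Cos -> Cos}.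

Definition is_lcos (C : set gT) : Prop := exists x, C = lcoset mul H x.
Definition transl (g : gT) (C : set gT) : set gT := [set mul g c | c in C].

Definition iota (g : gT) : Ambient :=
  fun C => if `[< is_lcos C >] then transl g C else C.

Definition SymGH : set Ambient :=
  [set sigma | [/\ forall C, ~ is_lcos C -> sigma C = C,
                   forall C, is_lcos C -> is_lcos (sigma C),
                   forall C D, is_lcos C -> is_lcos D -> sigma C = sigma D -> C = D
                 & forall D, is_lcos D -> exists2 C, is_lcos C & sigma C = D]].

Definition Gbar : set Ambient := closure (range iota) `&` SymGH.
Definition Hbar : set Ambient := closure (iota @` H) `&` SymGH.

Definition GbarT := subspace Gbar.

Definition smul (s t : GbarT) : GbarT := fun C => s (t C).
Definition sinv (s : GbarT) : GbarT :=
  fun C => if `[< is_lcos C >] then xget C [set D | is_lcos D /\ s D = C]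
           else C.
Definition sone : GbarT := fun C => C.

Definition GbarB := g_sigma_algebraType (@open GbarT).
End Schlichting.

Section HaarRD.
Context {R : realType} {gT : pointedType} (mul : gT -> gT -> gT)
  (H : set gT).

Local Notation X := (GbarT mul H).
Local Notation B := (GbarB mul H).
Local Notation G := (Gbar mul H).
Local Notation gm := (@smul gT mul H).
Local Notation gi := (@sinv gT mul H).
Local Notation g1 := (@sone gT mul H).

Definition right_haar (mu : {measure set B -> \bar R}) : Prop :=
  [/\ forall A : set B, measurable A -> A `<=` G ->
        forall g, G g -> mu [set gm a g | a in A] = mu A,
      forall A : set X, compact A -> A `<=` G -> (mu A < +oo)%E,
      forall U : set X, open U -> U `<=` G -> U !=set0 -> (0 < mu U)%E,
      forall A : set B, measurable A -> A `<=` G ->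
        mu A = ereal_inf [set mu U | U in [set U : set X | [/\ open U, A `<=` U & U `<=` G]]]
    & forall U : set X, open U -> U `<=` G ->
        mu U = ereal_sup [set mu C | C in [set C : set X | compact C /\ C `<=` U]]].

Definition cintegral (mu : {measure set B -> \bar R}) (F : X -> R[i]) : R[i] :=
  Complex (Rintegral mu G (fun x => cre (F x))) (Rintegral mu G (fun x => cim (F x))).

Definition conv_haar (mu : {measure set B -> \bar R}) (f xi : X -> R[i]) (x : X) : R[i] :=
  cintegral mu (fun y => f (gm x (gi y)) * xi y).

Definition L2norm2 (mu : {measure set B -> \bar R}) (xi : X -> R[i]) : \bar R :=
  \int[mu]_(x in G) (cabs2 (xi x))%:E.

Definition L2_fun (mu : {measure set B -> \bar R}) (xi : X -> R[i]) : Prop :=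
  [/\ measurable_fun (G : set B) (fun x => cre (xi x)),
      measurable_fun (G : set B) (fun x => cim (xi x))
    & (L2norm2 mu xi < +oo)%E].

Definition Cc_fun (f : X -> R[i]) : Prop :=
  [/\ continuous (fun x : X => (cre (f x) : R^o)), continuous (fun x : X => (cim (f x) : R^o))
    & exists2 C : set X, compact C /\ C `<=` G & forall x, G x -> ~ C x -> f x = 0].

Definition loc_bounded_haar (l : X -> R) : Prop :=
  forall C : set X, compact C -> C `<=` G -> exists M : R, forall x, C x -> l x <= M.

Definition weighted_L2 (mu : {measure set B -> \bar R}) (l : X -> R) (s : R)
  (f : X -> R[i]) : \bar R :=
  \int[mu]_(x in G) (cabs2 (f x) * (1 + l x) `^ (2 * s))%:E.

Definition RD_haar (mu : {measure set B -> \bar R}) : Prop :=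
  exists l : X -> R, length_fun gm gi g1 G [set g1] l /\ loc_bounded_haar l /\
  exists s c : R, 0 < s /\ 0 < c /\
    forall f, Cc_fun f -> forall xi, L2_fun mu xi ->
      (L2norm2 mu (conv_haar mu f xi) <=
         (c ^+ 2)%:E * weighted_L2 mu l s f * L2norm2 mu xi)%E.

Definition RD_group : Prop :=
  exists mu : {measure set B -> \bar R}, right_haar mu /\ RD_haar mu.
End HaarRD.

(* Main.v *)
(* [Gbar] is the group of permutations of [G/H] that agree with a translation
   on every finite set of cosets, and [Hbar] is the stabilizer of the coset [H].
   Hence [H\G -> Hbar\Gbar] is a bijection, and by density it identifies the
   bi-invariant functions, lengths and convolutions of the two pairs, which
   gives (i) <-> (ii).

   (iii) -> (ii): for functions on [Hbar\Gbar] the Haar convolution is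
   [mu Hbar] times the discrete one, and a length [l] on [Gbar] is dominated by
   the bi-[Hbar]-invariant length [sup_(k, k') l (k g k')].

   (ii) -> (iii): for [f, xi >= 0] put
   [A u ^+ 2 = \int_(k, k') f (k u k') ^+ 2] and
   [Bt y ^+ 2 = \int_k xi (k y) ^+ 2], with [k, k'] in [Hbar]. Cauchy-Schwarz
   bounds the L2 norm of [f * xi] by that of the convolution of the
   [Hbar]-invariant functions [A] and [Bt], and these have the weighted norm of
   [f] and the norm of [xi] up to constants. To avoid Fubini's theorem on a
   group that need not be second countable, [f] is first dominated, up to a
   uniformly small error, by a function bi-invariant under an open subgroup
   [N], so that all integrals over [Hbar] become finite sums over [N\Hbar].

   Haar measure on [Gbar] is built from the content which to a compact open set
   [V] assigns the number of right cosets of [N] in [V] divided by the number in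
   [Hbar], for any small enough [N]. *)
Require Import Defs.
From HB Require Import structures.
From mathcomp Require Import all_boot all_order all_algebra.
From mathcomp Require Import all_classical all_reals all_analysis.
From mathcomp Require Import complex.
From mathcomp Require Import finmap measure measurable_realfun.
From mathcomp Require Import ring lra.
Set Implicit Arguments.
Unset Strict Implicit.
Unset Printing Implicit Defensive.
Import Order.TTheory GRing.Theory Num.Theory.
Import numFieldNormedType.Exports.
Local Open Scope classical_set_scope.
Local Open Scope ring_scope.

(** * Groups carried by a subset of a type *)

(** The key inequality of (ii) -> (iii) comes from writing [y = j r], with [r] a representative of a
    right coset of [Hbar] and [j] in [Hbar]. Then the value of [f * xi] at [k x] is a sum over [r]
    of integrals over [j] of [f (k x r^-1 j^-1) xi (j r)]. Cauchy-Schwarz in [j] extracts [Bt r],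
    and Minkowski's inequality for the L2 norm in [k] turns the remaining factor into [A (x r^-1)]:
    what is left is the discrete convolution of [A] and [Bt] at [x]. A length of the pair is
    constant on double cosets of [Hbar], so the square averages keep its weight. The uniform error
    lives on the compact set [Hbar C Hbar], with [C] a support of [f]; the weight has a finite
    integral there, so the error disappears in the limit. Two obstacles shape the integration
    lemmas. [Gbar] may have uncountably many cosets of [Hbar], so an integral over [Gbar] is
    compared with an unordered sum, one inequality at a time. And the measurability of [f * xi]
    would call for Fubini's theorem, so its norm is estimated by monotonicity of the integral
    alone. *)

(* The Schlichting completion is only a subset of the type of all maps on
   cosets, so groups are carried by a subset [G] of the ambient type. *)
Record group_on {X : Type} (mul : X -> X -> X) (inv : X -> X) (e : X)
    (G : set X) : Prop := GroupOn {
  gmulA : forall x y z, mul x (mul y z) = mul (mul x y) z;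
  gmul1 : forall x, mul e x = x;
  gmulx1 : forall x, mul x e = x;
  g_one : G e;
  g_mul : forall x y, G x -> G y -> G (mul x y);
  g_inv : forall x, G x -> G (inv x);
  gmulV : forall x, G x -> mul x (inv x) = e;
  gmulVx : forall x, G x -> mul (inv x) x = e }.

Section GroupOnTheory.
Context {X : Type} (mul : X -> X -> X) (inv : X -> X) (e : X)
  (G K : set X).
Hypothesis gG : group_on mul inv e G.
Hypothesis sK : is_subgroup mul inv e G K.

Lemma sub_in x : K x -> G x. Proof. by case: sK => + _ _ _; exact. Qed.
Lemma sub_one : K e. Proof. by case: sK. Qed.
Lemma sub_mul x y : K x -> K y -> K (mul x y).
Proof. by case: sK => _ _ + _; exact. Qed.
Lemma sub_inv x : K x -> K (inv x). Proof. by case: sK => _ _ _; exact. Qed.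

Lemma gmulKV x y : G y -> mul (mul x (inv y)) y = x.
Proof. by move=> Gy; rewrite -(gmulA gG) (gmulVx gG)// (gmulx1 gG). Qed.
Lemma gmulK x y : G y -> mul (mul x y) (inv y) = x.
Proof. by move=> Gy; rewrite -(gmulA gG) (gmulV gG)// (gmulx1 gG). Qed.
Lemma gmulKl x y : G y -> mul (inv y) (mul y x) = x.
Proof. by move=> Gy; rewrite (gmulA gG) (gmulVx gG)// (gmul1 gG). Qed.
Lemma gmulVKl x y : G y -> mul y (mul (inv y) x) = x.
Proof. by move=> Gy; rewrite (gmulA gG) (gmulV gG)// (gmul1 gG). Qed.
Lemma gmul_injr x y z : G z -> mul x z = mul y z -> x = y.
Proof. by move=> Gz h; rewrite -(gmulK x Gz) h gmulK. Qed.
Lemma gmul_injl x y z : G z -> mul z x = mul z y -> x = y.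
Proof. by move=> Gz h; rewrite -(gmulKl x Gz) h gmulKl. Qed.
Lemma ginvK x : G x -> inv (inv x) = x.
Proof.
move=> Gx; apply: (@gmul_injr _ _ (inv x)); first exact: (g_inv gG).
by rewrite (gmulVx gG) ?(gmulV gG)//; exact: (g_inv gG).
Qed.
Lemma ginvM x y : G x -> G y -> inv (mul x y) = mul (inv y) (inv x).
Proof.
move=> Gx Gy; apply: (@gmul_injr _ _ (mul x y)); first exact: (g_mul gG).
rewrite (gmulVx gG); last exact: (g_mul gG).
by rewrite -(gmulA gG) gmulKl// (gmulVx gG).
Qed.

Lemma gmul_mid a g k b : G k ->
  mul (mul a (mul g k)) (mul (inv k) b) = mul (mul a g) b.
Proof. by move=> Gk; rewrite !(gmulA gG) gmulK. Qed.
Lemma ginvM3 k x y : G k -> G x -> G y ->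
  mul (mul (inv (mul k (mul x (inv y)))) k) x = y.
Proof.
move=> Gk Gx Gy; have Gvy := g_inv gG Gy; have Gxy := g_mul gG Gx Gvy.
by rewrite ginvM// ginvM// ginvK// !gmulKV.
Qed.

Lemma rcosetP x y : G x -> rcoset mul K x y <-> G y /\ K (mul y (inv x)).
Proof.
move=> Gx; split=> [[k Kk <-]|[Gy Ky]].
  by split; [apply: (g_mul gG) => //; exact: sub_in | rewrite gmulK].
by exists (mul y (inv x)) => //; rewrite gmulKV.
Qed.

Lemma rcoset_refl x : rcoset mul K x x.
Proof. by exists e; [exact: sub_one|rewrite (gmul1 gG)]. Qed.

Lemma rcoset_sub x : G x -> rcoset mul K x `<=` G.
Proof. by move=> Gx y /(rcosetP _ Gx)[]. Qed.

Lemma rcoset_eq x y : G x -> rcoset mul K x y -> rcoset mul K y = rcoset mul K x.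
Proof.
move=> Gx [k Kk <-]; apply/seteqP; split=> _ [k' Kk' <-].
  by rewrite (gmulA gG); exists (mul k' k) => //; exact: sub_mul.
exists (mul k' (inv k)); first by apply: sub_mul => //; exact: sub_inv.
by rewrite (gmulA gG) gmulKV//; exact: sub_in.
Qed.

Lemma rcoset_mull k x : K k -> G x -> rcoset mul K (mul k x) = rcoset mul K x.
Proof. by move=> Kk Gx; apply: rcoset_eq => //; exists k. Qed.

End GroupOnTheory.

Section RcosetTheory.
Context {X : topologicalType} (mul : X -> X -> X) (inv : X -> X) (e : X)
  (G K : set X).
Hypothesis gG : group_on mul inv e G.
Hypothesis sK : is_subgroup mul inv e G K.

Lemma rcoset_in x : G x -> rcosets mul G K (rcoset mul K x).
Proof. by exists x. Qed.

Lemma rep_in C : rcosets mul G K C -> C (rep e C).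
Proof. by move=> [x Gx ->]; apply: xgetPex; exists x; exact: (rcoset_refl gG sK). Qed.

Lemma repG C : rcosets mul G K C -> G (rep e C).
Proof. by move=> [x Gx eC]; apply: (rcoset_sub gG sK Gx); rewrite -eC; apply: rep_in; exists x. Qed.

Lemma rcoset_of_mem C x : rcosets mul G K C -> C x -> C = rcoset mul K x.
Proof. by move=> [y Gy ->] Cx; rewrite (rcoset_eq gG sK Gy Cx). Qed.

Lemma rcoset_rep C : rcosets mul G K C -> rcoset mul K (rep e C) = C.
Proof. by move=> hC; rewrite -(rcoset_of_mem hC)//; exact: rep_in. Qed.

Lemma rcosets_sub C : rcosets mul G K C -> C `<=` G.
Proof. by move=> [x Gx ->]; exact: (rcoset_sub gG sK). Qed.

Lemma left_inv_rcoset (Y : Type) (f : X -> Y) x y :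
  (forall k z, K k -> G z -> f (mul k z) = f z) ->
  G x -> rcoset mul K x y -> f y = f x.
Proof. by move=> fK Gx [k Kk <-]; rewrite fK. Qed.

Lemma left_inv_rep (Y : Type) (f : X -> Y) x :
  (forall k z, K k -> G z -> f (mul k z) = f z) ->
  G x -> f (rep e (rcoset mul K x)) = f x.
Proof.
by move=> fK Gx; apply: left_inv_rcoset => //; apply: rep_in; exact: rcoset_in.
Qed.

Lemma left_inv_mem (Y : Type) (f : X -> Y) C x :
  (forall k z, K k -> G z -> f (mul k z) = f z) ->
  rcosets mul G K C -> C x -> f (rep e C) = f x.
Proof.
move=> fK hC Cx; rewrite (rcoset_of_mem hC Cx) left_inv_rep//.
exact: (rcosets_sub hC).
Qed.

Section Length.
Context {R : realType} (l : X -> R).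
Hypothesis ll : length_fun mul inv e G K l.

Lemma len_ge0 x : G x -> 0 <= l x. Proof. by case: ll => _ [_ [+ _]]; exact. Qed.
Lemma lenV x : G x -> l (inv x) = l x.
Proof. by move=> Gx; case: ll => _ [_ [_ [h _]]]; rewrite (h x). Qed.
Lemma lenM x y : G x -> G y -> l (mul x y) <= l x + l y.
Proof. by case: ll => _ [_ [_ [_ [h _]]]]; exact: h. Qed.
Lemma lenK k : K k -> l k = 0.
Proof. by case: ll => _ [_ [_ [_ [_ h]]]]; exact: h. Qed.

Lemma len_left k x : K k -> G x -> l (mul k x) = l x.
Proof.
move=> Kk Gx; have Gk := sub_in sK Kk; apply/eqP; rewrite eq_le; apply/andP; split.
  by rewrite (le_trans (lenM Gk Gx))// lenK// add0r.
rewrite -{1}(gmulKl gG x Gk) (le_trans (lenM _ _))//; first exact: (g_inv gG).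
  exact: (g_mul gG).
by rewrite lenK ?add0r//; exact: (sub_inv sK).
Qed.

Lemma len_right k x : K k -> G x -> l (mul x k) = l x.
Proof.
move=> Kk Gx; have Gk := sub_in sK Kk.
rewrite -lenV; last exact: (g_mul gG).
rewrite (ginvM gG)// len_left ?lenV//; [exact: (sub_inv sK)|exact: (g_inv gG)].
Qed.

(** A length is constant on each right coset of [K], so on finitely many cosets it is bounded by the
    sum of its values there. *)
Lemma len_loc_bounded : loc_bounded_disc mul G K l.
Proof.
move=> F FG /finite_seqP[s sF].
exists (\sum_(C <- s) l (rep e C)) => C FC x Cx.
have hC := FG _ FC; have Cs : C \in s by rewrite sF in FC.
rewrite -(left_inv_mem (f := l) _ hC Cx); last exact: len_left.
rewrite (big_rem C)//= lerDl big_seq sumr_ge0// => D /mem_rem Ds.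
by apply/len_ge0/repG/FG; rewrite sF.
Qed.
End Length.

End RcosetTheory.

(** * Transfer of property (RD) along a dense homomorphism *)

Section Transfer.
Context {R : realType} {X1 X2 : topologicalType}.
Context (m1 : X1 -> X1 -> X1) (v1 : X1 -> X1) (e1 : X1) (G1 K1 : set X1).
Context (m2 : X2 -> X2 -> X2) (v2 : X2 -> X2) (e2 : X2) (G2 K2 : set X2).
Hypothesis gG1 : group_on m1 v1 e1 G1.
Hypothesis sK1 : is_subgroup m1 v1 e1 G1 K1.
Hypothesis gG2 : group_on m2 v2 e2 G2.
Hypothesis sK2 : is_subgroup m2 v2 e2 G2 K2.
Variables (i : X1 -> X2) (q : X2 -> X1).
Hypothesis iG : forall x, G1 x -> G2 (i x).
Hypothesis iM : forall x y, G1 x -> G1 y -> i (m1 x y) = m2 (i x) (i y).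
Hypothesis iV : forall x, G1 x -> i (v1 x) = v2 (i x).
Hypothesis iK : forall x, G1 x -> (K2 (i x) <-> K1 x).
Hypothesis qG : forall x, G2 x -> G1 (q x).
Hypothesis qP : forall x, G2 x -> rcoset m2 K2 (i (q x)) x.
(** The form in which density is used: a right factor from [K2] can be traded for one from [K1], at
    the cost of a left factor from [K2]. *)
Hypothesis i_dense : forall x k, G1 x -> K2 k ->
  exists2 h, K1 h & rcoset m2 K2 (i (m1 x h)) (m2 (i x) k).

Let Phi (C : set X1) := rcoset m2 K2 (i (rep e1 C)).

Let i_rcoset x y : G1 x -> G1 y ->
  (rcoset m2 K2 (i x) (i y) <-> rcoset m1 K1 x y).
Proof.
move=> Gx Gy; rewrite (rcosetP gG2 sK2)// ?(rcosetP gG1 sK1)//; last exact: iG.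
have Gvx := g_inv gG1 Gx.
rewrite -iV// -iM// iK; last exact: (g_mul gG1).
by split=> -[_ ?]; split=> //; exact: iG.
Qed.

Let PhiE x : G1 x -> Phi (rcoset m1 K1 x) = rcoset m2 K2 (i x).
Proof.
move=> Gx; have hC := rcoset_in m1 K1 Gx; have rG := repG gG1 sK1 hC.
apply: (rcoset_eq gG2 sK2); first exact: iG.
by apply/i_rcoset => //; exact: (rep_in gG1 sK1 hC).
Qed.

Let Phi_bij : set_bij (rcosets m1 G1 K1) (rcosets m2 G2 K2) Phi.
Proof.
split.
- by move=> _ [x Gx ->]; exists (i x); [exact: iG|rewrite PhiE].
- move=> _ _ /set_mem[x Gx ->] /set_mem[y Gy ->]; rewrite !PhiE// => Exy.
  apply/esym/(rcoset_eq gG1 sK1) => //; apply/i_rcoset => //; rewrite Exy.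
  exact: (rcoset_refl gG2 sK2).
- move=> _ [x Gx ->]; exists (rcoset m1 K1 (q x)).
    by exists (q x) => //; exact: qG.
  rewrite PhiE; last exact: qG.
  by apply/esym/(rcoset_eq gG2 sK2); [apply/iG/qG|exact: qP].
Qed.

(** [q] is a mere choice of representatives; a left [K1]-invariant function does not see the choice,
    because [i] separates the right cosets of [K1]. *)
Let q_rcoset (Y : Type) (f : X1 -> Y) x y :
  (forall k z, K1 k -> G1 z -> f (m1 k z) = f z) ->
  G1 y -> rcoset m2 K2 (i y) x -> f (q x) = f y.
Proof.
move=> fK Gy hx; have Gx := rcoset_sub gG2 sK2 (iG Gy) hx.
apply: (left_inv_rcoset fK) => //; apply/i_rcoset => //; first exact: qG.
rewrite -(rcoset_eq gG2 sK2 (iG Gy) hx).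
rewrite (rcoset_eq gG2 sK2 (iG (qG Gx)) (qP Gx)).
exact: (rcoset_refl gG2 sK2).
Qed.

Let q_i (Y : Type) (f : X1 -> Y) x :
  (forall k z, K1 k -> G1 z -> f (m1 k z) = f z) -> G1 x -> f (q (i x)) = f x.
Proof. by move=> fK Gx; apply: q_rcoset => //; exact: (rcoset_refl gG2 sK2). Qed.

Let i_left (Y : Type) (f : X2 -> Y) :
  (forall k z, K2 k -> G2 z -> f (m2 k z) = f z) ->
  (forall k z, K1 k -> G1 z -> f (i (m1 k z)) = f (i z)).
Proof.
move=> fK k z Kk Gz; have Gk := sub_in sK1 Kk; rewrite iM// fK//; last exact: iG.
by apply/iK.
Qed.

Let i_right (Y : Type) (f : X2 -> Y) :
  (forall k z, K2 k -> G2 z -> f (m2 z k) = f z) ->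
  (forall k z, K1 k -> G1 z -> f (i (m1 z k)) = f (i z)).
Proof.
move=> fK k z Kk Gz; have Gk := sub_in sK1 Kk; rewrite iM// fK//; last exact: iG.
by apply/iK.
Qed.

Let q_left (Y : Type) (f : X1 -> Y) :
  (forall k z, K1 k -> G1 z -> f (m1 k z) = f z) ->
  (forall k z, K2 k -> G2 z -> f (q (m2 k z)) = f (q z)).
Proof.
move=> fK k z Kk Gz; apply: q_rcoset => //; first exact: qG.
rewrite -(rcoset_eq gG2 sK2 (iG (qG Gz)) (qP Gz)).
by exists k.
Qed.

Let q_mul x k y : G1 x -> K2 k -> G1 y ->
  exists2 h, K1 h & rcoset m2 K2 (i (m1 (m1 x h) y)) (m2 (m2 (i x) k) (i y)).
Proof.
move=> Gx Kk Gy; have [h Kh [k' Kk' E]] := i_dense Gx Kk; exists h => //.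
have Gh := sub_in sK1 Kh; exists k' => //.
by rewrite -E iM// ?(gmulA gG2)//; exact: (g_mul gG1).
Qed.

(** Write [z = k' i (q z)]. By density [i (q z) k] lies in the coset of [i (q z h)] for some [h] in
    [K1], and [f] ignores this [h]. *)
Let q_right (Y : Type) (f : X1 -> Y) :
  (forall k z, K1 k -> G1 z -> f (m1 k z) = f z) ->
  (forall k z, K1 k -> G1 z -> f (m1 z k) = f z) ->
  (forall k z, K2 k -> G2 z -> f (q (m2 z k)) = f (q z)).
Proof.
move=> fK fKr k z Kk Gz; have Gqz := qG Gz.
have [k' Kk' Ez] := qP Gz; have [h Kh [k'' Kk'' E]] := i_dense Gqz Kk.
rewrite -[RHS](fKr h)//; apply: q_rcoset => //.
  by apply: (g_mul gG1) => //; exact: (sub_in sK1).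
exists (m2 k' k''); first exact: (sub_mul sK2).
by rewrite -(gmulA gG2) E (gmulA gG2) Ez.
Qed.

Let rep_Phi (Y : Type) (f : X2 -> Y) C :
  (forall k z, K2 k -> G2 z -> f (m2 k z) = f z) ->
  rcosets m1 G1 K1 C -> f (rep e2 (Phi C)) = f (i (rep e1 C)).
Proof.
by move=> fK hC; apply: (left_inv_rep gG2 sK2) => //; apply/iG/(repG gG1 sK1).
Qed.

Lemma transfer_l2norm2 (f : X2 -> R[i]) : left_K_inv m2 G2 K2 f ->
  l2norm2 m1 e1 G1 K1 (f \o i) = l2norm2 m2 e2 G2 K2 f.
Proof.
move=> fK; rewrite /l2norm2 (reindex_esum _ _ _ _ Phi_bij).
by apply: eq_esum => C hC; rewrite rep_Phi.
Qed.

Lemma transfer_weighted_norm2 (l : X2 -> R) s (f : X2 -> R[i]) :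
  (forall k z, K2 k -> G2 z -> l (m2 k z) = l z) -> left_K_inv m2 G2 K2 f ->
  weighted_norm2 m1 e1 G1 K1 (l \o i) s (f \o i) =
  weighted_norm2 m2 e2 G2 K2 l s f.
Proof.
move=> lK fK; rewrite /weighted_norm2 (reindex_esum _ _ _ _ Phi_bij).
by apply: eq_esum => C hC; rewrite !rep_Phi.
Qed.

(** The two representatives attached to a coset differ by a left factor in [K2]. In the argument of
    [f] it becomes a right factor, which right invariance absorbs; in [xi] left invariance does. *)
Lemma transfer_conv_disc (f xi : X2 -> R[i]) x :
  left_K_inv m2 G2 K2 f -> right_K_inv m2 G2 K2 f -> left_K_inv m2 G2 K2 xi ->
  G1 x ->
  conv_disc m1 v1 e1 G1 K1 (f \o i) (xi \o i) x =
  conv_disc m2 v2 e2 G2 K2 f xi (i x).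
Proof.
move=> fK fKr xiK Gx; rewrite /conv_disc (reindex_fsbig _ _ _ _ Phi_bij)/=.
apply: eq_fsbigr => C /set_mem hC; congr (_ * _); last by rewrite rep_Phi.
have rG := repG gG1 sK1 hC; have irG := iG rG.
have vrG := g_inv gG1 rG.
have [k Kk <-] : rcoset m2 K2 (i (rep e1 C)) (rep e2 (Phi C)).
  by apply: (rep_in gG2 sK2); exact: rcoset_in.
have Gk := sub_in sK2 Kk; rewrite (ginvM gG2)// (gmulA gG2) fKr; last 2 first.
- exact: (sub_inv sK2).
- by apply: (g_mul gG2); [exact: iG|exact: (g_inv gG2)].
by rewrite iM// iV.
Qed.

Lemma transfer_hecke_fun (f : X2 -> R[i]) :
  left_K_inv m2 G2 K2 f -> right_K_inv m2 G2 K2 f ->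
  hecke_fun m1 e1 G1 K1 (f \o i) <-> hecke_fun m2 e2 G2 K2 f.
Proof.
move=> fK fKr; have [_ inj surj] := Phi_bij.
have E : [set C | rcosets m2 G2 K2 C /\ f (rep e2 C) != 0] =
         Phi @` [set C | rcosets m1 G1 K1 C /\ (f \o i) (rep e1 C) != 0].
  apply/seteqP; split=> [D [hD fD]|_ [C [hC fC] <-]].
    have [C hC EC] := surj _ hD; exists C => //; split=> //.
    by rewrite /= -rep_Phi// EC.
  split; first by case: Phi_bij => h _ _; exact: h.
  by rewrite rep_Phi.
split=> [[_ _ fin]|[_ _ fin]]; split=> //.
- by rewrite E; exact: finite_image.
- exact: i_left.
- exact: i_right.
- suff inj' : set_inj [set C | rcosets m1 G1 K1 C /\ (f \o i) (rep e1 C) != 0] Phi.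
    by rewrite -(eq_finite_set (inj_card_eq inj')) -E.
  move=> C D /set_mem[hC _] /set_mem[hD _] h.
  by apply: inj => //; exact: mem_set.
Qed.

Lemma transfer_length_fun (l : X2 -> R) : borel_on G1 (l \o i) ->
  length_fun m2 v2 e2 G2 K2 l -> length_fun m1 v1 e1 G1 K1 (l \o i).
Proof.
move=> bl ll; split=> //; split=> /=; last split.
- by apply: (lenK ll); apply/iK; [exact: (g_one gG1)|exact: (sub_one sK1)].
- by move=> g /iG/(len_ge0 ll).
- split=> [g Gg|]; first by rewrite iV// (lenV ll)//; exact: iG.
  split=> [g h Gg Gh|h Kh]; first by rewrite iM// (lenM ll)//; exact: iG.
  by apply: (lenK ll); apply/iK => //; exact: (sub_in sK1).
Qed.

Lemma transfer_length_fun_ext (l : X1 -> R) : borel_on G2 (l \o q) ->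
  length_fun m1 v1 e1 G1 K1 l -> length_fun m2 v2 e2 G2 K2 (l \o q).
Proof.
move=> bl ll; have lK := len_left gG1 sK1 ll; have lKr := len_right gG1 sK1 ll.
have l0 h : K2 h -> l (q h) = 0.
  move=> Kh; have Gh := sub_in sK2 Kh.
  rewrite -(lenK ll (sub_one sK1)); apply: q_rcoset => //; first exact: (g_one gG1).
  have i1 := (iK (g_one gG1)).2 (sub_one sK1).
  apply/(rcosetP gG2 sK2); first exact: (sub_in sK2).
  by split=> //; apply: (sub_mul sK2) => //; exact: (sub_inv sK2).
split=> //; split; first exact: l0 (sub_one sK2).
split=> /= [g /qG/(len_ge0 ll)//|]; split=> [g Gg|].
  have Gq := qG Gg; have [k Kk E] := qP Gg; have Gk := sub_in sK2 Kk.
  rewrite -{2}E (ginvM gG2)//; last exact: iG.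
  have [h Kh hh] := i_dense (g_inv gG1 Gq) (sub_inv sK2 Kk).
  rewrite -iV// (q_rcoset lK _ hh).
    by rewrite lKr//; [rewrite (lenV ll)|exact: (g_inv gG1)].
  by apply: (g_mul gG1); [exact: (g_inv gG1)|exact: (sub_in sK1)].
split=> // g h Gg Gh.
have Gq := qG Gg; have [k Kk E] := qP Gg; have Gk := sub_in sK2 Kk.
have Gq' := qG Gh; have [k' Kk' E'] := qP Gh; have Gk' := sub_in sK2 Kk'.
(* The factor [k'] standing between [i (q g)] and [i (q h)] is traded for [c] in [K1], which [l]
   ignores. *)
have [c Kc hc] := q_mul Gq Kk' Gq'; have Gc := sub_in sK1 Kc.
have Gqc := g_mul gG1 Gq Gc.
have -> : l (q (m2 g h)) = l (m1 (m1 (q g) c) (q h)).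
  apply: q_rcoset => //; first exact: (g_mul gG1).
  case: hc => k'' Kk'' hk''; exists (m2 k k''); first exact: (sub_mul sK2).
  by rewrite -(gmulA gG2) hk'' -(gmulA gG2) E' (gmulA gG2) E.
by rewrite (le_trans (lenM ll _ _))// lKr.
Qed.

Let conv_left (f xi : X2 -> R[i]) : left_K_inv m2 G2 K2 f ->
  left_K_inv m2 G2 K2 (conv_disc m2 v2 e2 G2 K2 f xi).
Proof.
move=> fK k x Kk Gx; apply: eq_fsbigr => C /set_mem hC.
rewrite -(gmulA gG2) fK//; apply: (g_mul gG2) => //.
by apply/(g_inv gG2)/(repG gG2 sK2).
Qed.

(** For the completion both conditions are automatic: the first group is discrete, and [K2] is open,
    so that left [K2]-invariant functions are locally constant. *)
Hypothesis borel1 : forall l : X1 -> R, borel_on G1 l.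
Hypothesis borel2 : forall l : X2 -> R,
  (forall k z, K2 k -> G2 z -> l (m2 k z) = l z) -> borel_on G2 l.

Let eq_l2norm2 (f g : X1 -> R[i]) : (forall x, G1 x -> f x = g x) ->
  l2norm2 m1 e1 G1 K1 f = l2norm2 m1 e1 G1 K1 g.
Proof. by move=> fg; apply: eq_esum => C hC; rewrite fg//; exact: (repG gG1 sK1). Qed.

Let transfer_l2norm2_conv (f xi : X2 -> R[i]) :
  left_K_inv m2 G2 K2 f -> right_K_inv m2 G2 K2 f -> left_K_inv m2 G2 K2 xi ->
  l2norm2 m1 e1 G1 K1 (conv_disc m1 v1 e1 G1 K1 (f \o i) (xi \o i)) =
  l2norm2 m2 e2 G2 K2 (conv_disc m2 v2 e2 G2 K2 f xi).
Proof.
move=> fK fKr xiK; rewrite -transfer_l2norm2; last exact: conv_left.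
by apply: eq_l2norm2 => x Gx; exact: transfer_conv_disc.
Qed.

Lemma transfer_RD_disc :
  RD_disc (R := R) m1 v1 e1 G1 K1 <-> RD_disc (R := R) m2 v2 e2 G2 K2.
Proof.
split=> -[l [ll [_ [s [c [s0 [c0 Hl]]]]]]].
- have lK := len_left gG1 sK1 ll.
  have ll2 : length_fun m2 v2 e2 G2 K2 (l \o q).
    by apply: transfer_length_fun_ext => //; apply: borel2; exact: q_left.
  exists (l \o q); split=> //; split; first exact: (len_loc_bounded gG2 sK2).
  exists s, c; split=> //; split=> // f hf xi xiK xifin; have [fK fKr _] := hf.
  have := Hl (f \o i) ((transfer_hecke_fun fK fKr).2 hf) (xi \o i) (i_left xiK).
  rewrite transfer_l2norm2_conv// !transfer_l2norm2// => /(_ xifin).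
  rewrite -(transfer_weighted_norm2 s _ fK); last exact: q_left.
  congr (_ <= _ * _ * _)%E; apply: eq_esum => C hC /=.
  by rewrite q_i//; exact: (repG gG1 sK1).
- have lK := len_left gG2 sK2 ll.
  have ll2 := transfer_length_fun (borel1 _) ll.
  exists (l \o i); split=> //; split; first exact: (len_loc_bounded gG1 sK1).
  exists s, c; split=> //; split=> // f [fK fKr ffin] xi xiK xifin.
  have fqK := q_left fK; have fqKr := q_right fK fKr; have xiqK := q_left xiK.
  have fE x : G1 x -> f x = ((f \o q) \o i) x by move=> Gx; rewrite /= q_i.
  have xiE x : G1 x -> xi x = ((xi \o q) \o i) x by move=> Gx; rewrite /= q_i.
  have hf : hecke_fun m2 e2 G2 K2 (f \o q).
    apply/transfer_hecke_fun => //; split.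
    - by move=> k z Kk Gz; rewrite -!fE ?fK//; apply: (g_mul gG1) => //; exact: (sub_in sK1).
    - by move=> k z Kk Gz; rewrite -!fE ?fKr//; apply: (g_mul gG1) => //; exact: (sub_in sK1).
    - apply: sub_finite_set ffin => C [hC fC]; split=> //.
      by rewrite fE//; exact: (repG gG1 sK1).
  have := Hl (f \o q) hf (xi \o q) xiqK.
  rewrite -transfer_l2norm2_conv// -(transfer_weighted_norm2 s lK fqK).
  rewrite -transfer_l2norm2// -(eq_l2norm2 xiE) => /(_ xifin).
  rewrite -(@eq_l2norm2 (conv_disc m1 v1 e1 G1 K1 f xi)).
    congr (_ <= _ * _ * _)%E; apply: eq_esum => C hC /=.
    by rewrite q_i//; exact: (repG gG1 sK1).
  move=> x Gx; apply: eq_fsbigr => C /set_mem hC; have Gr := repG gG1 sK1 hC.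
  rewrite -xiE// -fE//; apply: (g_mul gG1) => //; exact: (g_inv gG1).
Qed.

End Transfer.

(** * The Schlichting completion *)

Section SchlichtingTheory.
Context {gT : pointedType} (mul : gT -> gT -> gT) (inv : gT -> gT) (e : gT)
  (H : set gT).
Hypothesis gp : is_group mul inv e.
Hypothesis hp : hecke_pair mul inv e setT H.

Local Notation A := (@Ambient gT).
Local Notation X := (GbarT mul H).
Local Notation G := (Gbar mul H).
Local Notation K := (Hbar mul H).
Local Notation gm := (@smul gT mul H).
Local Notation gi := (@sinv gT mul H).
Local Notation g1 := (@sone gT mul H).
Local Notation lcos := (is_lcos mul H).
Local Notation tr := (transl mul).
Local Notation io := (Defs.iota mul H).

Lemma group_on_setT : group_on mul inv e setT.
Proof.
by case: gp => mA m1 mV; split=> //; [move=> x; case: (m1 x)|move=> x; case: (m1 x)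
  |move=> x _; case: (mV x)|move=> x _; case: (mV x)].
Qed.
Let gT' := group_on_setT.

Lemma sub_H : is_subgroup mul inv e setT H. Proof. by case: hp. Qed.

Lemma translM g h C : tr (mul g h) C = tr g (tr h C).
Proof.
apply/seteqP; split=> [_ [c Cc <-]|_ [_ [c Cc <-] <-]].
  by exists (mul h c); [exists c|rewrite (gmulA gT')].
by exists c => //; rewrite (gmulA gT').
Qed.

Lemma transl1 C : tr e C = C.
Proof.
apply/seteqP; split=> [_ [c Cc <-]|c Cc]; first by rewrite (gmul1 gT').
by exists c => //; rewrite (gmul1 gT').
Qed.

Lemma lcosH : lcos H.
Proof. by exists e; rewrite -[LHS]transl1. Qed.

Lemma transl_lcos g C : lcos C -> lcos (tr g C).
Proof. by move=> [x ->]; exists (mul g x); rewrite -[RHS]/(tr _ H) translM. Qed.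

Lemma transl_H h : tr h H = H <-> H h.
Proof.
have sH := sub_H; split=> [E|Hh].
  by rewrite -E; exists e; [exact: (sub_one sH)|rewrite (gmulx1 gT')].
apply/seteqP; split=> [_ [c Hc <-]|c Hc]; first exact: (sub_mul sH).
exists (mul (inv h) c); last by rewrite (gmulVKl gT').
by apply: (sub_mul sH) => //; exact: (sub_inv sH).
Qed.

Lemma iotaE g C : lcos C -> io g C = tr g C.
Proof. by rewrite /Defs.iota; case: asboolP. Qed.

Lemma iota_out g C : ~ lcos C -> io g C = C.
Proof. by rewrite /Defs.iota; case: asboolP. Qed.

Lemma iotaM g h : io (mul g h) = gm (io g) (io h).
Proof.
apply/funext => C; rewrite /smul; have [hC|hC] := pselect (lcos C).
  by rewrite !iotaE// ?translM//; exact: transl_lcos.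
by rewrite !iota_out.
Qed.

Lemma iota1 : io e = g1.
Proof.
apply/funext => C; have [hC|hC] := pselect (lcos C); last by rewrite iota_out.
by rewrite iotaE// transl1.
Qed.

Lemma iotaK g : gm (io g) (io (inv g)) = g1.
Proof. by rewrite -iotaM (gmulV gT')// iota1. Qed.

Lemma iotaVK g : gm (io (inv g)) (io g) = g1.
Proof. by rewrite -iotaM (gmulVx gT')// iota1. Qed.

Lemma SymGH_iota g : SymGH mul H (io g).
Proof.
split.
- by move=> C hC; rewrite iota_out.
- by move=> C hC; rewrite iotaE//; exact: transl_lcos.
- move=> C D hC hD E; rewrite -[LHS]/(g1 C) -[RHS]/(g1 D) -(iotaVK g).
  by rewrite /smul E.
- move=> D hD; exists (io (inv g) D); last by rewrite -[RHS]/(g1 D) -(iotaK g).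
  by rewrite iotaE//; exact: transl_lcos.
Qed.

Lemma sinv_lcos (s : A) C : SymGH mul H s -> lcos C ->
  lcos (gi s C) /\ s (gi s C) = C.
Proof.
move=> [_ _ _ surj] hC; rewrite /sinv; case: asboolP => // _.
by case: xgetP => [D -> //|] /=; have [D hD E] := surj _ hC; move=> /(_ D) [].
Qed.

Lemma sinv_out (s : A) C : ~ lcos C -> gi s C = C.
Proof. by rewrite /sinv; case: asboolP. Qed.

Lemma sinvK (s : A) C : SymGH mul H s -> s (gi s C) = C.
Proof.
move=> hs; have [hC|hC] := pselect (lcos C); first by case: (sinv_lcos hs hC).
by rewrite sinv_out//; case: hs => + _ _ _; exact.
Qed.

Lemma SymGH_inj (s : A) C D : SymGH mul H s -> s C = s D -> C = D.
Proof.
move=> [out inn inj _] E.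
have [hC|hC] := pselect (lcos C); have [hD|hD] := pselect (lcos D).
- exact: inj.
- by move: (inn _ hC); rewrite E (out _ hD) => /hD.
- by move: (inn _ hD); rewrite -E (out _ hC) => /hC.
- by rewrite -(out _ hC) E out.
Qed.

Lemma sinvVK (s : A) C : SymGH mul H s -> gi s (s C) = C.
Proof. by move=> hs; apply: (SymGH_inj hs); rewrite sinvK. Qed.

Lemma SymGH_mul (s t : A) : SymGH mul H s -> SymGH mul H t ->
  SymGH mul H (gm s t).
Proof.
move=> hs ht; have [so si _ ss] := hs; have [to ti _ ts] := ht; split.
- by move=> C hC; rewrite /smul to// so.
- by move=> C hC; apply/si/ti.
- by move=> C D _ _ /(SymGH_inj hs)/(SymGH_inj ht).
- by move=> D /ss[C /ts[B hB <-] <-]; exists B.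
Qed.

Lemma SymGH_inv (s : A) : SymGH mul H s -> SymGH mul H (gi s).
Proof.
move=> hs; split.
- by move=> C hC; rewrite sinv_out.
- by move=> C hC; case: (sinv_lcos hs hC).
- by move=> C D _ _ E; rewrite -(sinvK C hs) E sinvK.
- move=> D hD; exists (s D); last exact: sinvVK.
  by case: hs => _ + _ _; exact.
Qed.

Lemma nbhs_AmbientP (s : A) (U : set A) : nbhs s U <->
  exists F : seq (set gT), forall t : A, (forall C, C \in F -> t C = s C) -> U t.
Proof.
split=> [|[F hF]]; last first.
  suff : nbhs s [set t : A | forall C, C \in F -> t C = s C] by apply: filterS.
  elim: F {hF} => [|C F IH]; first by apply: filterS filterT => t _ C.
  have : nbhs s [set t : A | t C = s C].
    have pc : (fun t : A => t C) @ s --> s C.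
      by apply: (@pointwise_cvgP (Cos (gT := gT)) (Cos (gT := gT)) (nbhs s) s _).1.
    by apply: (pc [set D | D = s C]); rewrite nbhs_principalE.
  move=> h; apply: filterS2 h IH => t /= h1 h2 D; rewrite inE => /orP[/eqP->//|].
  exact: h2.
(* The filter generated by the sets [B F] converges pointwise to [s], so every neighbourhood of [s]
   contains one of them. *)
pose B (F : seq (set gT)) : set A := [set t | forall C, C \in F -> t C = s C].
have FB : Filter (filter_from [set: seq (set gT)] B).
  apply: filter_from_filter; first by exists [::].
  move=> F F' _ _; exists (F ++ F') => // t ht; split=> C hC; apply: ht.
    by rewrite mem_cat hC.
  by rewrite mem_cat hC orbT.
have : {ptws, filter_from [set: seq (set gT)] B --> (s : A)}.
  apply: (@pointwise_cvgP (Cos (gT := gT)) (Cos (gT := gT)) _ s FB).2 => C V.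
  rewrite nbhs_principalE => /principal_filterP Vs; exists [:: C] => // t ht.
  by rewrite /= ht ?inE.
by move=> h /h[F _ hF]; exists F.
Qed.

Lemma closureP (B : set A) (s : A) : closure B s <->
  forall F : seq (set gT), exists2 t, B t & forall C, C \in F -> t C = s C.
Proof.
split=> [cl F|h U /nbhs_AmbientP[F hF]].
  have [|t [Bt ht]] := cl [set t : A | forall C, C \in F -> t C = s C].
    by apply/nbhs_AmbientP; exists F.
  by exists t.
by have [t Bt ht] := h F; exists t; split=> //; exact: hF.
Qed.

Lemma GbarP (s : A) : G s <-> SymGH mul H s /\
  forall F : seq (set gT), exists g, forall C, C \in F -> io g C = s C.
Proof.
split=> [[/closureP cl ss]|[ss h]]; split=> //.
  by move=> F; have [_ [g _ <-] hg] := cl F; exists g.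
by apply/closureP => F; have [g hg] := h F; exists (io g) => //; exists g.
Qed.

Lemma Gbar_Sym s : G s -> SymGH mul H s. Proof. by case. Qed.

Lemma Gbar_approx s (F : seq (set gT)) : G s ->
  exists g, forall C, C \in F -> io g C = s C.
Proof. by move=> /GbarP[_]; exact. Qed.

Lemma Gbar_iota g : G (io g).
Proof. by apply/GbarP; split; [exact: SymGH_iota|move=> F; exists g]. Qed.

Lemma group_on_Gbar : group_on gm gi g1 G.
Proof.
split=> //.
- by rewrite -iota1; exact: Gbar_iota.
- move=> s t Gs Gt; apply/GbarP; split; first exact: SymGH_mul (Gbar_Sym Gs) (Gbar_Sym Gt).
  move=> F; have [h hh] := Gbar_approx F Gt.
  have [g hg] := Gbar_approx [seq t C | C <- F] Gs; exists (mul g h) => C hC.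
  rewrite iotaM /smul hh// hg//; exact: map_f.
- move=> s Gs; have ss := Gbar_Sym Gs; apply/GbarP; split; first exact: SymGH_inv.
  move=> F; have [g hg] := Gbar_approx [seq gi s C | C <- F] Gs.
  exists (inv g) => C hC; have := hg (gi s C) (map_f _ hC).
  rewrite sinvK// => E; rewrite -{1}E.
  by rewrite -[LHS]/(gm (io (inv g)) (io g) _) iotaVK.
- by move=> s Gs; apply/funext => C; exact: sinvK (Gbar_Sym Gs).
- by move=> s Gs; apply/funext => C; exact: sinvVK (Gbar_Sym Gs).
Qed.
Let gG := group_on_Gbar.

Lemma HbarP s : K s <-> G s /\ s H = H.
Proof.
split=> [[/closureP cl ss]|[Gs sH]].
  split.
    by apply/GbarP; split=> // F; have [_ [h _ <-] hg] := cl F; exists h.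
  have [_ [h Hh <-] hg] := cl [:: H].
  by rewrite -hg ?inE// iotaE; [exact/transl_H|exact: lcosH].
split; last exact: Gbar_Sym.
apply/closureP => F; have [g hg] := Gbar_approx (H :: F) Gs.
exists (io g); last by move=> C hC; apply: hg; rewrite inE hC orbT.
exists g => //; apply/transl_H; rewrite -iotaE; last exact: lcosH.
by rewrite hg ?inE ?eqxx.
Qed.

(* These are the basic open subgroups. *)
Definition stab (F : seq (set gT)) : set X :=
  [set s | G s /\ forall C, C \in F -> s C = C].

Lemma sub_stab F : is_subgroup gm gi g1 G (stab F).
Proof.
split=> [s []//||s t [Gs hs] [Gt ht]|s [Gs hs]].
- by split; first exact: (g_one gG).
- split; first exact: (g_mul gG).
  by move=> C hC; rewrite /smul ht// hs.
- split; first exact: (g_inv gG).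
  by move=> C hC; rewrite -{1}(hs C hC) sinvVK//; exact: Gbar_Sym.
Qed.

Lemma HbarE : K = stab [:: H].
Proof.
apply/seteqP; split=> s; rewrite /stab /=.
  by move=> /HbarP[Gs sH]; split=> // C; rewrite inE => /eqP->.
by move=> [Gs hs]; apply/HbarP; split=> //; apply: hs; rewrite inE.
Qed.

Lemma sub_Hbar : is_subgroup gm gi g1 G K.
Proof. rewrite HbarE; exact: sub_stab. Qed.

Lemma stab_sub F F' : {subset F <= F'} -> stab F' `<=` stab F.
Proof. by move=> FF' s [Gs hs]; split=> // C /FF'; exact: hs. Qed.

(** The inverse of [k s] is [s^-1 k^-1], and [k] fixes the members of [F]: a right coset of [stab F]
    is recognised by the values of inverses on [F]. All later counting of cosets rests on this. *)
Lemma stabP F s t : G s ->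
  rcoset gm (stab F) s t <-> G t /\ forall C, C \in F -> gi t C = gi s C.
Proof.
move=> Gs; rewrite (rcosetP gG (sub_stab F))//.
split=> -[Gt h]; split=> //.
  move=> C hC; have [_ /(_ _ hC) E] := h.
  by rewrite -{1}E /smul sinvVK//; exact: Gbar_Sym.
split; first by apply: (g_mul gG) => //; exact: (g_inv gG).
by move=> C hC; rewrite /smul -h// sinvK//; exact: Gbar_Sym.
Qed.

Lemma nbhs_GbarP (s : X) (U : set X) : G s ->
  nbhs s U <-> exists F : seq (set gT),
    forall t, G t -> (forall C, C \in F -> t C = s C) -> U t.
Proof.
move=> Gs; case: (nbhs_subspaceP G s) => // _; rewrite /within /=.
split=> [/nbhs_AmbientP[F hF]|[F hF]]; first by exists F => t Gt ht; exact: hF.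
by apply/nbhs_AmbientP; exists F => t ht Gt; exact: hF.
Qed.

Lemma open_GbarP (U : set X) : open U <-> forall s, G s -> U s ->
  exists F : seq (set gT),
    forall t, G t -> (forall C, C \in F -> t C = s C) -> U t.
Proof.
rewrite openE; split=> [oU s Gs Us|h s Us].
  by apply/nbhs_GbarP => //; exact: oU.
have [Gs|Gs] := pselect (G s); first by apply/nbhs_GbarP => //; exact: h.
(* Points outside [G] are isolated in the subspace topology. *)
by rewrite /interior; case: (nbhs_subspaceP G s) => // _ _ ->.
Qed.

(* left and right neighbourhood bases agree: [x stab F = stab (x F) x] *)
Lemma open_GbarPr (U : set X) : open U <-> forall s, G s -> U s ->
  exists F : seq (set gT), rcoset gm (stab F) s `<=` U.
Proof.
rewrite open_GbarP; split=> h s Gs Us; have ss := Gbar_Sym Gs.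
  have [F hF] := h s Gs Us; exists [seq s C | C <- F] => t.
  move=> /(stabP _ _ Gs)[Gt ht]; apply: hF => // C hC.
  have := ht _ (map_f _ hC); rewrite sinvVK// => E; rewrite -{1}E sinvK//.
  exact: Gbar_Sym.
have [F hF] := h s Gs Us; exists [seq gi s C | C <- F] => t Gt ht.
apply/hF/stabP => //; split=> // C hC; have := ht _ (map_f _ hC).
by rewrite sinvK// => E; rewrite -{1}E sinvVK//; exact: Gbar_Sym.
Qed.

Lemma rcoset_open F s : G s -> open (rcoset gm (stab F) s : set X).
Proof.
move=> Gs; apply/open_GbarPr => t Gt ht; exists F.
by rewrite (rcoset_eq gG (sub_stab F) Gs ht).
Qed.

Lemma left_inv_preimage_open F (Y : Type) (f : X -> Y) (B : set Y) :
  (forall k z, stab F k -> G z -> f (gm k z) = f z) ->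
  open (G `&` f @^-1` B : set X).
Proof.
move=> fK; apply/open_GbarPr => s Gs [_ Bs]; exists F => t ht /=; split.
  exact: (rcoset_sub gG (sub_stab F) Gs ht).
by rewrite /preimage /= (left_inv_rcoset fK Gs ht).
Qed.

(** Here the Hecke condition enters. The stabilizer in [H] of the coset [x H] is the intersection of
    [H] with [x H x^-1], so the [H]-orbit of [x H] is finite; and on a single coset every element of
    [Hbar] agrees with an element of [H]. *)
Lemma orbit_finite C : lcos C -> finite_set [set s C | s in (K : set A)].
Proof.
move=> [x EC]; have [sH /(_ x Logic.I) fin] := hp.
have : finite_set [set tr h C | h in H].
  (* Multiplying a coset [h (H] meet [x H x^-1)] by [C] on the right gives back [h C], so the orbit
     is an image of the finite set of cosets. *)
  apply: sub_finite_set (finite_image (fun D => [set mul d c | d in D & c in C]) fin).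
  move=> _ [h Hh <-].
  exists (lcoset mul (H `&` conjset mul inv H x) h); first by exists h.
  apply/seteqP; split=> [z [d [k [Hk [k' Hk' <-]] <-] [c0 Cc0 <-]]|_ [c Cc <-]].
    move: Cc0; rewrite EC => -[k0 Hk0 <-].
    exists (mul x (mul k' k0)); first by exists (mul k' k0) => //; exact: (sub_mul sH).
    by rewrite !(gmulA gT') (gmulKV gT').
  exists h; last by exists c.
  exists e; last by rewrite (gmulx1 gT').
  split; first exact: (sub_one sH).
  by exists e; [exact: (sub_one sH)|rewrite (gmulx1 gT') (gmulV gT')].
apply: sub_finite_set => _ [s [/closureP cl _] <-].
have [_ [h Hh <-] <-] := cl [:: C]; last by rewrite inE.
by exists h => //; rewrite iotaE//; exists x.
Qed.

Lemma Hbar_closed : closed (K : set A).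
Proof.
move=> s; rewrite -[X in closure X](_ : closure (io @` H) `&` SymGH mul H = K)//.
move=> /closureP cls.
have cl (F : seq (set gT)) : exists2 h, H h & forall C, C \in F -> io h C = s C.
  have [t [/closureP ct _] ht] := cls F; have [_ [h Hh <-] hh] := ct F.
  by exists h => // C hC; rewrite hh// ht.
split.
  by apply/closureP => F; have [h Hh hh] := cl F; exists (io h) => //; exists h.
split.
- by move=> C hC; have [h _ <-] := cl [:: C]; rewrite ?inE// iota_out.
- move=> C hC; have [h _ <-] := cl [:: C]; rewrite ?inE// iotaE//.
  exact: transl_lcos.
- move=> C D hC hD; have [h _ hh] := cl [:: C; D].
  by rewrite -!hh ?inE ?eqxx ?orbT// => /(SymGH_inj (SymGH_iota h)).
(* A pointwise limit of permutations may fail to be surjective. Here the orbit [F] of [D] is finite,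
   and an [h] that agrees with [s] on all of [F] also agrees with it at [h^-1 D], which is therefore
   a preimage of [D]. *)
- move=> D hD; have /finite_seqP[F FE] := orbit_finite hD.
  have [h Hh hh] := cl F; have sH := sub_H.
  exists (io (inv h) D); first by rewrite iotaE//; exact: transl_lcos.
  rewrite -hh; first by rewrite -[LHS]/(gm (io h) (io (inv h)) D) iotaK.
  suff : [set` F] (io (inv h) D) by [].
  rewrite -FE; exists (io (inv h)) => //; apply/HbarP; split.
    exact: Gbar_iota.
  by rewrite iotaE; [apply/transl_H/(sub_inv sH)|exact: lcosH].
Qed.

(** [Hbar] is a closed subset of the product of its finite orbits, which is compact by Tychonoff's
    theorem. *)
Lemma Hbar_compact : compact (K : set X).
Proof.
have -> : (K : set X) = K `&` G.
  by apply/seteqP; split=> [s Ks|s []//]; split=> //; case/HbarP: Ks.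
apply/compact_subspaceIP; have -> : K `&` G = K.
  by apply/seteqP; split=> [s []//|s Ks]; split=> //; case/HbarP: Ks.
pose B (C : set gT) : set (Cos (gT := gT)) := [set s C | s in (K : set A)].
apply: (@subclosed_compact _ _ [set f : A | forall C, B C (f C)]).
- exact: Hbar_closed.
- apply: (@tychonoff (set gT) (fun=> Cos (gT := gT)) B) => C.
  apply: finite_compact; have [hC|hC] := pselect (lcos C).
    exact: orbit_finite.
  apply: (@sub_finite_set _ _ [set C]); last exact: finite_set1.
  by move=> _ [s [_ [so _ _ _]] <-] /=; exact: so.
- by move=> s Ks C; exists s.
Qed.

Lemma Hbar_iota g : K (io g) <-> H g.
Proof.
rewrite HbarP iotaE; last exact: lcosH.
by rewrite transl_H; split=> [[]//|]; split=> //; exact: Gbar_iota.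
Qed.

Lemma iotaV g : io (inv g) = gi (io g).
Proof.
apply: (@gmul_injr _ _ _ _ _ gG _ _ (io g)); first exact: Gbar_iota.
by rewrite iotaVK (gmulVx gG)//; exact: Gbar_iota.
Qed.

(** The coset [Hbar s] depends only on [s^-1 H], so it is enough that [g] agrees with [s] at that
    one coset. The implication stands under the existential so that [choice] applies. *)
Lemma Gbar_rep s : exists g, G s -> rcoset gm K (io g) s.
Proof.
have [Gs|Gs] := pselect (G s); last by exists e.
have [g hg] := Gbar_approx [:: gi s H] Gs; exists g => _.
rewrite HbarE; apply/stabP; first exact: Gbar_iota.
split=> // C; rewrite inE => /eqP->; have ss := Gbar_Sym Gs.
have := hg (gi s H); rewrite inE => /(_ (eqxx _)); rewrite sinvK// => E.
by apply: (SymGH_inj (SymGH_iota g)); rewrite E sinvK//; exact: SymGH_iota.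
Qed.

Lemma iota_dense x k : K k ->
  exists2 h, H h & rcoset gm K (io (mul x h)) (gm (io x) k).
Proof.
move=> /HbarP[Gk kH]; have sk := Gbar_Sym Gk.
(* Agreement with [k] at [H] puts [h] into [H]; agreement at [k^-1 x^-1 H] puts [x h] and [x k] into
   one right coset of [Hbar]. *)
have [h hh] := Gbar_approx [:: H; gi k (gi (io x) H)] Gk.
exists h.
  apply/Hbar_iota/HbarP; split; first exact: Gbar_iota.
  by rewrite hh ?inE ?eqxx.
have Gx := Gbar_iota x; have Gh := Gbar_iota h.
rewrite iotaM HbarE; apply/stabP; first exact: (g_mul gG).
split; first exact: (g_mul gG).
move=> C; rewrite inE => /eqP->; rewrite (ginvM gG Gx Gk) (ginvM gG Gx Gh).
rewrite -[LHS]/(gi k (gi (io x) H)) -[RHS]/(gi (io h) (gi (io x) H)).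
have := hh (gi k (gi (io x) H)); rewrite !inE eqxx orbT => /(_ isT).
rewrite sinvK// => E.
apply: (SymGH_inj (SymGH_iota h)); rewrite E sinvK//; exact: SymGH_iota.
Qed.

Lemma schlichting_RD_disc (R : realType) :
  RD_disc (R := R) (X := discrete_topology gT) mul inv e setT H <->
  RD_disc (R := R) gm gi g1 G K.
Proof.
have [q qP] := choice Gbar_rep.
apply: (@transfer_RD_disc R (discrete_topology gT) X _ _ _ _ _ _ _ _ _ _
  group_on_setT sub_H gG sub_Hbar io q) => //.
- by move=> x _; exact: Gbar_iota.
- by move=> x y _ _; exact: iotaM.
- by move=> x _; exact: iotaV.
- by move=> x _; exact: Hbar_iota.
- by move=> x k _; exact: iota_dense.
- move=> l Y _; apply: sub_sigma_algebra; rewrite openE => x Bx.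
  by rewrite /interior nbhs_principalE; exact/principal_filterP.
- move=> l lK Y _; apply: sub_sigma_algebra.
  by apply: (@left_inv_preimage_open [:: H]); rewrite -HbarE.
Qed.

End SchlichtingTheory.

(** * Integrals as sums over cosets *)

(* No measurability is needed here, as the integral of a nonnegative function
   is a supremum over the simple functions below it. *)
Lemma le_integral_ge0 {d} {T : measurableType d} {R : realType}
    (mu : {measure set T -> \bar R}) (D : set T) (f g : T -> \bar R) :
  (forall x, D x -> (0 <= f x)%E /\ (f x <= g x)%E) ->
  (\int[mu]_(x in D) f x <= \int[mu]_(x in D) g x)%E.
Proof.
move=> fg; rewrite !ge0_integralE; last 2 first.
- by move=> x /fg[f0 fg']; exact: le_trans fg'.
- by move=> x /fg[].
apply: ereal_sup_le => _ [h hf <-]; exists h => // x.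
apply: (le_trans (hf x)); rewrite /patch; case: ifPn => // /set_mem Dx.
by case: (fg x Dx).
Qed.

Section SumsOfIntegrals.
Import HBNNSimple.
Local Open Scope ereal_scope.
Context {d} {T : measurableType d} {R : realType}.
Variables (mu : {measure set T -> \bar R}) (D : set T) (I : set (set T)).
Hypothesis mD : measurable D.
Hypothesis mI : forall C, I C -> measurable C.
Hypothesis ID : forall C, I C -> C `<=` D.
Hypothesis trivI : forall C C' x, I C -> I C' -> C x -> C' x -> C = C'.

Let F C : set T := if `[< I C >] then C else set0.

Let FE C : I C -> F C = C. Proof. by rewrite /F; case: asboolP. Qed.

Let mF C : measurable (F C).
Proof. by rewrite /F; case: asboolP => // IC; exact: mI. Qed.

Let trivF (s : seq (set T)) : trivIset [set` s] F.
Proof.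
move=> C C' _ _ [x []]; rewrite /F; case: asboolP => // IC Cx.
by case: asboolP => // IC' C'x; exact: (trivI IC IC' Cx C'x).
Qed.

Let int_sub (X : set (set T)) (f : T -> \bar R) : finite_set X -> X `<=` I ->
  measurable_fun (\bigcup_(C in X) C) f ->
  (forall x, (\bigcup_(C in X) C) x -> 0 <= f x) ->
  \sum_(C \in X) \int[mu]_(x in C) f x = \int[mu]_(x in \bigcup_(C in X) C) f x.
Proof.
move=> finX XI mf f0.
have [s us sE] : exists2 s : seq (set T), uniq s & X = [set` s].
  have /finite_seqP[s ->] := finX; exists (undup s); first exact: undup_uniq.
  by apply/seteqP; split=> C /=; rewrite mem_undup.
have sI C : C \in s -> I C by move=> Cs; apply: XI; rewrite sE.
have E : \bigcup_(C in X) C = \big[setU/set0]_(C <- s) F C.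
  by rewrite -bigcup_seq sE; apply: eq_bigcupr => C /sI/FE.
rewrite sE -fsbig_seq// -sE E (@ge0_integral_bigsetU _ _ _ mu _ F f)//.
- by apply: eq_big_seq => C /sI/FE->.
- by rewrite -E.
- by rewrite -E.
Qed.

Lemma esum_integral_le (f : T -> \bar R) : measurable_fun D f ->
  (forall x, D x -> 0 <= f x) ->
  \esum_(C in I) \int[mu]_(x in C) f x <= \int[mu]_(x in D) f x.
Proof.
move=> mf f0; apply: ge_ereal_sup => _ [X [finX XI] <-].
have sub : \bigcup_(C in X) C `<=` D by move=> x [C /XI/ID]; exact.
have mU : measurable (\bigcup_(C in X) C).
  by apply: fin_bigcup_measurable => // C /XI/mI.
rewrite int_sub//.
- by apply: ge0_subset_integral.
- exact: measurable_funS mf.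
- by move=> x /sub/f0.
Qed.

(* A simple function below [f] takes a least positive value [r], so it is
   supported where [r <= f], that is on finitely many pieces: no countability
   of [I] is needed. *)
Lemma integral_le_esum (f : T -> \bar R) : D `<=` \bigcup_(C in I) C ->
  (forall x, D x -> 0 <= f x) ->
  (forall r : R, (0 < r)%R ->
    finite_set [set C | I C /\ exists2 x, C x & r%:E <= f x]) ->
  \int[mu]_(x in D) f x <= \esum_(C in I) \int[mu]_(x in C) f x.
Proof.
move=> DI f0 fin; rewrite ge0_integralE//.
apply: ge_ereal_sup => _ [h hf <-].
have [r r0 hr] : exists2 r : R, (0 < r)%R & forall x, (0 < h x)%R -> (r <= h x)%R.
  have /finite_seqP[s sE] : finite_set (range h) by exact: fimfunP.
  have [r r0 hr] : exists2 r : R, (0 < r)%R & forall y, y \in s -> (0 < y)%R -> (r <= y)%R.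
    elim: s {sE} => [|y s [r r0 hr]]; first by exists 1%R.
    have [y0|y0] := ltP 0%R y.
      exists (Num.min r y); first by rewrite lt_min r0.
      move=> z; rewrite inE => /orP[/eqP->|zs] z0; first by rewrite ge_min lexx orbT.
      by rewrite ge_min hr.
    exists r => // z; rewrite inE => /orP[/eqP->|zs]; last exact: hr.
    by rewrite ltNge y0.
  exists r => // x hx; apply: hr => //.
  by have : range h (h x) by []; rewrite sE.
pose X := [set C | I C /\ exists2 x, C x & r%:E <= f x].
have XI : X `<=` I by move=> C [].
have hX x : (0 < h x)%R -> (\bigcup_(C in X) C) x /\ D x.
  move=> hx; have := hf x; rewrite /patch; case: ifPn => [/set_mem Dx hfx|_].
    have [C IC Cx] := DI _ Dx; split=> //; exists C => //; split=> //.
    by exists x => //; rewrite (le_trans _ hfx)// lee_fin hr.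
  by rewrite lee_fin leNgt hx.
have mX : measurable (\bigcup_(C in X) C).
  by apply: fin_bigcup_measurable; [exact: fin|move=> C /XI/mI].
rewrite -integralT_nnsfun.
have -> : \int[mu]_x (h x)%:E = \int[mu]_(x in \bigcup_(C in X) C) (h x)%:E.
  rewrite [RHS]integral_mkcond; apply: eq_integral => x _.
  rewrite /patch; case: ifPn => // /negP nX.
  have [hx|] := ltP 0%R (h x); first by have [/mem_set] := hX _ hx.
  by move=> h0; congr EFin; apply/eqP; rewrite eq_le h0/=.
rewrite -int_sub//; last 3 first.
- exact: fin.
- by apply/measurable_EFinP; exact: measurable_funTS.
- by move=> x _; rewrite lee_fin.
apply: esum_ge; exists X; first by split=> //; exact: fin.
apply: lee_fsum; first exact: fin.
move=> C XC; have IC := XI _ XC; apply: le_integral_ge0 => x Cx.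
have Dx := ID IC Cx; rewrite lee_fin; split=> //.
by have := hf x; rewrite patchT//; exact: mem_set.
Qed.

End SumsOfIntegrals.

Lemma esum_fin_level {R : realType} {T : choiceType} (I : set T)
    (a : T -> \bar R) (c : \bar R) :
  (0 < c)%E -> (forall i, I i -> (0 <= a i)%E) ->
  (\esum_(i in I) a i < +oo)%E ->
  finite_set [set i | I i /\ (c <= a i)%E].
Proof.
move=> c0 a0 afin; apply: contrapT => inf.
have [c1 c10 c1c] : exists2 c1 : R, (0 < c1)%R & (c1%:E <= c)%E.
  case: c c0 {inf} => [r r0|_|//]; first by exists r.
  by exists 1%R => //; rewrite leey.
have S0 : (0 <= \esum_(i in I) a i)%E by exact: esum_ge0.
move: afin; rewrite ltNge => /negP; apply; rewrite leye_eq; apply/eqP.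
apply/eq_infty => y.
have [B BI Bn] := infinite_set_fset (Num.truncn (`|y| / c1)).+1 inf.
apply: esum_ge; exists [set` B]; first by split=> // i /BI[].
rewrite (@le_trans _ _ (\sum_(i \in [set` B]) c1%:E)%E)//; last first.
  by apply: lee_fsum => // i /BI[_]; exact: le_trans.
rewrite fsbig_finite//= set_fsetK sumEFin lee_fin big_const_seq count_predT.
rewrite iter_addr_0 -mulr_natr.
rewrite (le_trans (ler_norm y))// -ler_pdivrMl// mulrC.
apply/ltW/(lt_le_trans (truncnS_gt _)).
by rewrite ler_nat.
Qed.

Lemma esumZl {R : realType} {T : choiceType} (I : set T) (a : T -> \bar R)
    (r : R) : 0 <= r -> (forall i, I i -> (0 <= a i)%E) ->
  \esum_(i in I) (r%:E * a i)%E = (r%:E * \esum_(i in I) a i)%E.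
Proof.
move=> r0 a0; rewrite /esum -ereal_supZl//; last first.
  by apply/set0P; exists (\sum_(i \in set0) a i); exists set0 => //; exact: fsets_set0.
congr ereal_sup; apply/seteqP; split=> [_ [X [finX XI] <-]|_ [_ [X [finX XI] <-] <-]].
  exists (\sum_(i \in X) a i); first by exists X.
  rewrite !fsbig_finite//= big_seq [in RHS]big_seq ge0_sume_distrr// => i.
  by rewrite in_fset_set// => /set_mem/XI/a0.
exists X => //; rewrite !fsbig_finite//= big_seq [in RHS]big_seq ge0_sume_distrr// => i.
by rewrite in_fset_set// => /set_mem/XI/a0.
Qed.

Lemma esum_seq {R : realType} {T : choiceType} (I : set T) (s : seq T)
    (a : T -> \bar R) : uniq s -> [set` s] `<=` I ->
  (forall i, I i -> (0 <= a i)%E) -> (forall i, I i -> i \notin s -> a i = 0%E) ->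
  \esum_(i in I) a i = (\sum_(i <- s) a i)%E.
Proof.
move=> us sI a0 as0; rewrite (esumID [set` s])// [X in (_ + X)%E]esum1; last first.
  by move=> i [Ii /= /negP ns]; exact: as0.
rewrite adde0 (_ : I `&` [set` s] = [set` s]); last exact/setIidr.
rewrite esum_fset; [|exact: finite_seq|].
  by rewrite -fsbig_seq.
by move=> i /set_mem/sI/a0.
Qed.

Lemma fsbig_seq_supp {V : zmodType} {T : choiceType} (I : set T) (s : seq T)
    (a : T -> V) : uniq s -> [set` s] `<=` I ->
  (forall i, I i -> i \notin s -> a i = 0) ->
  \sum_(i \in I) a i = \sum_(i <- s) a i.
Proof.
move=> us sI as0; rewrite [RHS]fsbig_seq//; apply/esym/fsbig_widen => //.
by move=> i [Ii /negP /= ns]; exact: as0.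
Qed.

Lemma finite_bigcup_compact {T : topologicalType} {I : choiceType} (D : set I)
    (F : I -> set T) : finite_set D -> (forall i, D i -> compact (F i)) ->
  compact (\bigcup_(i in D) F i).
Proof.
move=> /finite_seqP[s ->] cF; have : forall i, i \in s -> compact (F i) by [].
elim: s {cF} => [|i s IH] cF.
  rewrite (_ : \bigcup_(_ in _) _ = set0); first exact: compact0.
  by apply/seteqP; split=> // x [].
rewrite (_ : \bigcup_(j in [set` i :: s]) F j = F i `|` \bigcup_(j in [set` s]) F j).
  apply: compactU; first by apply: cF; rewrite mem_head.
  by apply: IH => j js; apply: cF; rewrite inE js orbT.
apply/seteqP; split=> x.
  by move=> [j /=]; rewrite inE => /orP[/eqP->|js] Fx; [left|right; exists j].
move=> [Fx|[j /= js Fx]]; first by exists i => //=; rewrite mem_head.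
by exists j => //=; rewrite inE js orbT.
Qed.

(** * Cosets of the basic open subgroups and their measure *)

Section CosetMeasure.
Context {R : realType} {gT : pointedType} (mul : gT -> gT -> gT)
  (inv : gT -> gT) (e : gT) (H : set gT).
Hypothesis gp : is_group mul inv e.
Hypothesis hp : hecke_pair mul inv e setT H.

Local Notation X := (GbarT mul H).
Local Notation B := (GbarB mul H).
Local Notation G := (Gbar mul H).
Local Notation K := (Hbar mul H).
Local Notation gm := (@smul gT mul H).
Local Notation gi := (@sinv gT mul H).
Local Notation g1 := (@sone gT mul H).
Local Notation N F := (@stab gT mul H F).
Let gG : group_on gm gi g1 G := group_on_Gbar H gp.
Let sN F : is_subgroup gm gi g1 G (N F) := sub_stab H gp F.
Let sK : is_subgroup gm gi g1 G K := sub_Hbar gp hp.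
Let KE : K = N [:: H] := HbarE gp hp.

Lemma stab_sub_Hbar F : H \in F -> N F `<=` K.
Proof.
by move=> HF; rewrite KE; apply: stab_sub => C; rewrite inE => /eqP->.
Qed.

Lemma rcoset_stabE F s : G s -> rcoset gm (N F) s =
  [set t : X | G t /\ [seq gi t C | C <- F] = [seq gi s C | C <- F]].
Proof.
move=> Gs; apply/seteqP; split=> t /=.
  by move=> /(stabP gp F t Gs)[Gt ht]; split=> //; apply/eq_in_map.
by move=> [Gt /eq_in_map ht]; apply/(stabP gp F t Gs).
Qed.

Lemma orbit_finite_all C : finite_set [set s C | s in (K : set X)].
Proof.
have [hC|hC] := pselect (is_lcos mul H C); first exact: (orbit_finite gp hp hC).
apply: (@sub_finite_set _ _ [set C]); last exact: finite_set1.
by move=> _ [s [_ [so _ _ _]] <-] /=; exact: so.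
Qed.

Lemma finite_orbit_seq (F : seq (set gT)) :
  finite_set [set [seq s C | C <- F] | s in (K : set X)].
Proof.
elim: F => [|C F IH].
  apply: (@sub_finite_set _ _ [set [::]]); last exact: finite_set1.
  by move=> _ [s _ <-].
apply: sub_finite_set (finite_image2 cons (orbit_finite_all C) IH).
by move=> _ [s Ks <-]; exists (s C); [exists s|exists [seq s C | C <- F] => //; exists s].
Qed.

Lemma finite_rcosets_Hbar F : finite_set [set rcoset gm (N F) k | k in (K : set X)].
Proof.
apply: sub_finite_set (finite_image (fun D => [set t : X | G t /\
  [seq gi t C | C <- F] = D]) (finite_orbit_seq F)).
move=> _ [k Kk <-]; exists [seq gi k C | C <- F].
  by exists (gi k) => //; exact: (sub_inv sK).
by rewrite rcoset_stabE//; exact: (sub_in sK).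
Qed.

(** The coset of [a k x] is determined by [x^-1 k^-1 a^-1 H], and the [Hbar]-orbit of [a^-1 H] is
    finite. *)
Lemma finite_double_coset a x : G a -> G x ->
  finite_set [set rcoset gm K (gm (gm a k) x) | k in (K : set X)].
Proof.
move=> Ga Gx; apply: sub_finite_set (finite_image (fun D => [set t : X | G t /\
  [seq gi t C | C <- [:: H]] = [:: gi x D]]) (orbit_finite_all (gi a H))).
move=> _ [k Kk <-]; have Gk := sub_in sK Kk; exists (gi k (gi a H)).
  by exists (gi k) => //; exact: (sub_inv sK).
have Gak := g_mul gG Ga Gk.
rewrite KE rcoset_stabE; last exact: (g_mul gG).
by rewrite /= (ginvM gG Gak Gx) (ginvM gG Ga Gk).
Qed.

(** The cosets are an open cover. The finite subcover comes from the near-covering form of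
    compactness, for the filter of finite sequences ordered by inclusion: what holds eventually near
    each point holds for one sequence on all of [C]. *)
Lemma compact_rcosets F (C : set X) : compact C -> C `<=` G ->
  finite_set [set rcoset gm (N F) x | x in C].
Proof.
move=> /compact_near_coveringP cC CG.
pose Fil : set_system (seq X) :=
  filter_from [set: seq X] (fun s0 => [set s : seq X | {subset s0 <= s}]).
have FF : Filter Fil.
  apply: filter_from_filter; first by exists [::].
  move=> s s' _ _; exists (s ++ s') => // t ht; split=> x hx; apply: ht.
    by rewrite mem_cat hx.
  by rewrite mem_cat hx orbT.
pose P (s : seq X) (x : X) := exists2 y, y \in s /\ G y & rcoset gm (N F) y x.
have [|s _ /(_ s (fun _ h => h)) hs] := cC _ Fil P FF.
  move=> x Cx; have Gx := CG _ Cx.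
  exists (rcoset gm (N F) x, [set s : seq X | {subset [:: x] <= s}]).
    split; last by exists [:: x].
    apply: open_nbhs_nbhs; split; first exact: (rcoset_open gp).
    exact: (rcoset_refl gG (sN F)).
  by move=> [y s] /= [hy hs]; exists x => //; split=> //; apply: hs; rewrite mem_head.
apply: sub_finite_set (finite_image (rcoset gm (N F)) (finite_seq s)).
move=> _ [x Cx <-]; have [y [ys Gy] yx] := hs x Cx; exists y => //.
by rewrite (rcoset_eq gG (sN F) Gy yx).
Qed.

Lemma left_inv_continuous F (T : topologicalType) (f : X -> T) :
  (forall k z, N F k -> G z -> f (gm k z) = f z) -> continuous f.
Proof.
move=> fK; apply/continuousP => A _; rewrite -(open_subspaceTI (A := G)).
exact: (left_inv_preimage_open gp fK).
Qed.

Lemma mulr_continuous x : G x -> continuous (fun s : X => gm s x).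
Proof.
move=> Gx; apply/continuousP => U oU; apply/(open_GbarPr gp) => s Gs /= Us.
have [F hF] := (open_GbarPr gp U).1 oU _ (g_mul gG Gs Gx) Us.
exists F => _ [k Nk <-] /=; by apply: hF; exists k.
Qed.

Lemma rcoset_Hbar_compact x : G x -> compact (rcoset gm K x : set X).
Proof.
move=> Gx; apply: (@continuous_compact X X (fun s => gm s x)).
  exact/continuous_subspaceT/mulr_continuous.
exact: (Hbar_compact gp hp).
Qed.

Lemma open_measurable (U : set X) : open U -> measurable (U : set B).
Proof. exact: sub_sigma_algebra. Qed.

Lemma measurable_Gbar : measurable (G : set B).
Proof. by apply: open_measurable; exact: open_subspaceT. Qed.

Lemma measurable_rcoset F x : G x -> measurable (rcoset gm (N F) x : set B).
Proof. by move=> Gx; apply: open_measurable; exact: (rcoset_open gp). Qed.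

Lemma left_inv_measurable F d (T : measurableType d) (f : X -> T) :
  (forall k z, N F k -> G z -> f (gm k z) = f z) -> measurable_fun (G : set B) f.
Proof.
move=> fK _ Y _; apply: open_measurable; exact: (left_inv_preimage_open gp fK).
Qed.

Variable mu : {measure set B -> \bar R}.
Hypothesis hm : right_haar mu.
Local Open Scope ereal_scope.

Lemma stabE F : rcoset gm (N F) g1 = N F.
Proof.
apply/seteqP; split=> [_ [k Nk <-]|k Nk]; first by rewrite (gmulx1 gG).
by exists k; rewrite ?(gmulx1 gG).
Qed.

Lemma haar_rcoset F x : G x -> mu (rcoset gm (N F) x) = mu (N F).
Proof.
case: hm => inv_mu _ _ _ _ Gx; apply: inv_mu => //; last by move=> s [].
by rewrite -stabE; apply: measurable_rcoset; exact: (g_one gG).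
Qed.

Lemma haar_stab_gt0 F : 0 < mu (N F).
Proof.
case: hm => _ _ pos _ _; apply: pos.
- by rewrite -(stabE F); apply: (rcoset_open gp); exact: (g_one gG).
- by move=> s [].
- by exists g1; exact: (sub_one (sN F)).
Qed.

Lemma haar_Hbar_fin : mu K < +oo.
Proof.
case: hm => _ fin _ _ _; apply: fin; first exact: (Hbar_compact gp hp).
exact: (sub_in sK).
Qed.

Lemma measurable_stab F : measurable (N F : set B).
Proof. by rewrite -stabE; apply: measurable_rcoset; exact: (g_one gG). Qed.

Lemma haar_stab_fin F : H \in F -> mu (N F) < +oo.
Proof.
move=> HF; apply: le_lt_trans haar_Hbar_fin.
apply: le_measure; [apply: mem_set|apply: mem_set|exact: stab_sub_Hbar].
  exact: measurable_stab.
rewrite KE; exact: measurable_stab.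
Qed.

Lemma haar_stabE F : H \in F ->
  exists2 m : R, (0 < m)%R & mu (N F) = m%:E.
Proof.
move=> HF; have := haar_stab_gt0 F; have := haar_stab_fin HF.
by case: (mu _) => // m _; exists m.
Qed.

Lemma integral_rcoset F x (f : X -> \bar R) : G x ->
  (forall k z, N F k -> G z -> f (gm k z) = f z) ->
  \int[mu]_(y in rcoset gm (N F) x) f y = f x * mu (N F).
Proof.
move=> Gx fK; rewrite -(haar_rcoset F Gx) -integral_cst; last first.
  exact: measurable_rcoset.
apply: eq_integral => y /set_mem hy.
exact: (left_inv_rcoset fK Gx hy).
Qed.

Lemma rcosets_meet F C C' x : rcosets gm G (N F) C -> rcosets gm G (N F) C' ->
  C x -> C' x -> C = C'.
Proof.
move=> hC hC' Cx C'x.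
by rewrite (rcoset_of_mem gG (sN F) hC Cx) (rcoset_of_mem gG (sN F) hC' C'x).
Qed.

Lemma esum_integral_rcosets_le F (f : X -> \bar R) :
  measurable_fun (G : set B) f -> (forall x, G x -> 0 <= f x) ->
  \esum_(C in rcosets gm G (N F)) \int[mu]_(x in C) f x <= \int[mu]_(x in G) f x.
Proof.
move=> mf f0; apply: (@esum_integral_le _ B R mu G (rcosets gm G (N F))) => //.
- exact: measurable_Gbar.
- by move=> _ [x Gx ->]; exact: measurable_rcoset.
- by move=> _ [x Gx ->]; exact: (rcoset_sub gG (sN F)).
- move=> C C' x; exact: rcosets_meet.
Qed.

Lemma integral_rcosets_le_esum F (f : X -> \bar R) :
  (forall x, G x -> 0 <= f x) ->
  (forall r : R, (0 < r)%R -> finite_set [set C | rcosets gm G (N F) C /\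
     exists2 x, C x & r%:E <= f x]) ->
  \int[mu]_(x in G) f x <= \esum_(C in rcosets gm G (N F)) \int[mu]_(x in C) f x.
Proof.
move=> f0 fin; apply: (@integral_le_esum _ B R mu G (rcosets gm G (N F))) => //.
- by move=> _ [x Gx ->]; exact: measurable_rcoset.
- by move=> _ [x Gx ->]; exact: (rcoset_sub gG (sN F)).
- by move=> C C' x; exact: rcosets_meet.
- move=> x Gx; exists (rcoset gm (N F) x); first by exists x.
  exact: (rcoset_refl gG (sN F)).
Qed.

(** Only [<=] for a finite right side needs an argument. A coset [C] of [Hbar] with a point where
    [f >= r] contains a whole coset of [N F] on which [f >= r], so its term is at least [r] times
    [mu (N F)]; there are finitely many such [C], as [integral_rcosets_le_esum] requires. *)
Lemma integral_left_inv F (f : X -> R) : H \in F ->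
  (forall k z, N F k -> G z -> f (gm k z) = f z) ->
  (forall x, G x -> (0 <= f x)%R) ->
  \int[mu]_(x in G) (f x)%:E =
  \esum_(C in rcosets gm G K) \int[mu]_(x in C) (f x)%:E.
Proof.
move=> HF fK f0; have f0' x : G x -> 0 <= (f x)%:E by move=> /f0; rewrite lee_fin.
have mf : measurable_fun (G : set B) (EFin \o f).
  by apply/measurable_EFinP; exact: (left_inv_measurable fK).
rewrite KE; apply/eqP; rewrite eq_le esum_integral_rcosets_le// andbT.
have [->|] := eqVneq (\esum_(C in rcosets gm G (N [:: H])) \int[mu]_(x in C) (f x)%:E) +oo.
  exact: leey.
rewrite -ltey => sfin; apply: integral_rcosets_le_esum => // r r0.
have i0 C : rcosets gm G (N [:: H]) C -> 0 <= \int[mu]_(x in C) (f x)%:E.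
  by move=> hC; apply: integral_ge0 => x /(rcosets_sub gG (sN [:: H]) hC)/f0'.
have [m m0 mE] := haar_stabE HF.
have rm0 : 0 < (r * m)%:E by rewrite lte_fin mulr_gt0.
apply: sub_finite_set (esum_fin_level rm0 i0 sfin).
move=> C [hC [x Cx rx]]; split=> //.
have Gx := rcosets_sub gG (sN [:: H]) hC Cx.
rewrite (@le_trans _ _ (\int[mu]_(y in rcoset gm (N F) x) (f y)%:E))//.
  rewrite (@integral_rcoset F x (EFin \o f))//; last by move=> k z Nk Gz; rewrite /= fK.
  by rewrite mE EFinM lee_wpmul2r// lee_fin ltW.
have sub : rcoset gm (N F) x `<=` C.
  rewrite (rcoset_of_mem gG (sN _) hC Cx) => _ [k Nk <-]; exists k => //.
  by rewrite -KE; exact: stab_sub_Hbar Nk.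
have CG := rcosets_sub gG (sN [:: H]) hC.
have mC : measurable (C : set B) by move: hC => [y Gy ->]; exact: measurable_rcoset.
apply: ge0_subset_integral => //.
- exact: measurable_rcoset.
- by apply: measurable_funS mf => //; exact: measurable_Gbar.
- by move=> y /CG/f0'.
Qed.

Lemma integral_Hbar_inv (f : X -> R) :
  (forall k z, K k -> G z -> f (gm k z) = f z) ->
  (forall x, G x -> (0 <= f x)%R) ->
  \int[mu]_(x in G) (f x)%:E =
  mu K * \esum_(C in rcosets gm G K) (f (rep g1 C))%:E.
Proof.
move=> fK f0; have [m m0 mE] := haar_stabE (mem_head H [::]).
rewrite (@integral_left_inv [:: H]) ?mem_head//; last by rewrite -KE.
rewrite {2}KE mE -esumZl ?ltW//; last first.
  by move=> C hC; rewrite lee_fin f0//; exact: (repG gG sK).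
apply: eq_esum => C hC; have Gr := repG gG sK hC.
rewrite -{1}(rcoset_rep gG sK hC) KE (@integral_rcoset _ _ (EFin \o f))//.
  by rewrite mE muleC.
by move=> k z Nk Gz; rewrite /= fK// KE.
Qed.

(* The right cosets of [N F] in [K x] are the [N F (k x)], for [k] in a list of
   representatives that does not depend on [x]. *)
Lemma stab_transversal F : H \in F -> exists ks : seq X,
  [/\ uniq ks, forall k, k \in ks -> K k,
      forall k, K k -> exists2 k', k' \in ks & rcoset gm (N F) k' k
    & forall k k' x, k \in ks -> k' \in ks ->
        rcoset gm (N F) k x -> rcoset gm (N F) k' x -> k = k'].
Proof.
move=> HF; have /finite_seqP[s sE] := finite_rcosets_Hbar F.
have sP C : C \in s -> exists2 k, K k & rcoset gm (N F) k = C.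
  by move=> Cs; suff : [set` s] C by rewrite -sE => -[k Kk <-]; exists k.
have sG C : C \in s -> rcosets gm G (N F) C.
  by move=> /sP[k Kk <-]; exists k => //; exact: (sub_in sK).
have inj : {in undup s &, injective (rep g1)}.
  move=> C C'; rewrite !mem_undup => /sG hC /sG hC' E.
  by rewrite -(rcoset_rep gG (sN F) hC) E (rcoset_rep gG (sN F) hC').
exists [seq rep g1 C | C <- undup s]; split.
- by rewrite map_inj_in_uniq ?undup_uniq.
- move=> z /mapP[C]; rewrite mem_undup => Cs ->; have [k Kk E] := sP _ Cs.
  have := rep_in gG (sN F) (sG _ Cs); rewrite -{1}E => -[n Nn <-].
  by apply: (sub_mul sK) => //; exact: stab_sub_Hbar Nn.
- move=> k Kk; have Cs : rcoset gm (N F) k \in s.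
    by suff : [set` s] (rcoset gm (N F) k) by []; rewrite -sE; exists k.
  exists (rep g1 (rcoset gm (N F) k)); first by apply/map_f; rewrite mem_undup.
  rewrite (rcoset_rep gG (sN F) (sG _ Cs)); exact: (rcoset_refl gG (sN F)).
- move=> z z' x /mapP[C + ->] /mapP[C' + ->]; rewrite !mem_undup => /sG hC /sG hC'.
  rewrite !(rcoset_rep gG (sN F))// => Cx C'x.
  by rewrite (rcosets_meet hC hC' Cx C'x).
Qed.

End CosetMeasure.

(** * From the group to the pair *)

Section DiscFromHaar.
Context {R : realType} {gT : pointedType} (mul : gT -> gT -> gT)
  (inv : gT -> gT) (e : gT) (H : set gT).
Hypothesis gp : is_group mul inv e.
Hypothesis hp : hecke_pair mul inv e setT H.

Local Notation X := (GbarT mul H).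
Local Notation B := (GbarB mul H).
Local Notation G := (Gbar mul H).
Local Notation K := (Hbar mul H).
Local Notation gm := (@smul gT mul H).
Local Notation gi := (@sinv gT mul H).
Local Notation g1 := (@sone gT mul H).
Local Notation N F := (@stab gT mul H F).
Let gG : group_on gm gi g1 G := group_on_Gbar H gp.
Let sK : is_subgroup gm gi g1 G K := sub_Hbar gp hp.
Let KE : K = N [:: H] := HbarE gp hp.

(** If [f] does not vanish at [x y^-1], then [y] lies in [d^-1 K x] for one of the finitely many
    representatives [d] of the support of [f], and each of these sets meets finitely many cosets. *)
Lemma hecke_finite_conv (f : X -> R[i]) x : hecke_fun gm g1 G K f -> G x ->
  finite_set [set C | rcosets gm G K C /\ f (gm x (gi (rep g1 C))) != 0].
Proof.
move=> [fK fKr fin] Gx.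
apply: (@sub_finite_set _ _ (\bigcup_(D in [set C | rcosets gm G K C /\ f (rep g1 C) != 0])
   [set rcoset gm K (gm (gm (gi (rep g1 D)) k) x) | k in (K : set X)])); last first.
  apply: bigcup_finite => // D [hD _]; apply: (finite_double_coset gp hp) => //.
  exact/(g_inv gG)/(repG gG sK).
move=> C [hC fC]; have Gr := repG gG sK hC; set y := rep g1 C in Gr fC *.
have Gvy := g_inv gG Gr; have Gxy := g_mul gG Gx Gvy.
pose D := rcoset gm K (gm x (gi y)); have hD : rcosets gm G K D by exact: rcoset_in.
exists D; first by split=> //; rewrite (left_inv_rep gG sK fK Gxy).
have Gd := repG gG sK hD.
have [k Kk Ek] := rep_in gG sK hD; have Gk := sub_in sK Kk.
exists k => //; rewrite -Ek (ginvM3 gG Gk Gx Gr).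
exact: (rcoset_rep gG sK hC).
Qed.

Variable mu : {measure set B -> \bar R}.
Hypothesis hm : right_haar mu.

Let mK_ex : exists2 m : R, 0 < m & mu K = m%:E.
Proof. by rewrite KE; apply: (haar_stabE gp hp hm); exact: mem_head. Qed.

Lemma Rintegral_Hbar_inv (g : X -> R) (s : seq (set X)) :
  (forall k z, K k -> G z -> g (gm k z) = g z) ->
  uniq s -> [set` s] `<=` rcosets gm G K ->
  (forall C, rcosets gm G K C -> C \notin s -> g (rep g1 C) = 0) ->
  Rintegral mu G g = fine (mu K) * \sum_(C <- s) g (rep g1 C).
Proof.
move=> gK us sI gs0; have [m m0 mE] := mK_ex; rewrite mE /=.
have pos (h : X -> R) : (forall k z, K k -> G z -> h (gm k z) = h z) ->
    (forall x, 0 <= h x) ->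
    (forall C, rcosets gm G K C -> C \notin s -> h (rep g1 C) = 0) ->
    (\int[mu]_(x in G) (h x)%:E = (m * \sum_(C <- s) h (rep g1 C))%:E)%E.
  move=> hK h0 hs0; rewrite (integral_Hbar_inv gp hp hm)// mE.
  rewrite (esum_seq us sI) ?sumEFin//; first by move=> C _; rewrite lee_fin h0.
  by move=> C hC Cs; rewrite hs0.
rewrite /Rintegral integralE.
have -> : (fun x => (EFin \o g)^\+ x)%E = (fun x => (Num.max (g x) 0)%:E).
  by apply/funext => x; rewrite funeposE -EFin_max.
have -> : (fun x => (EFin \o g)^\- x)%E = (fun x => (Num.max (- g x) 0)%:E).
  by apply/funext => x; rewrite funenegE -EFin_max.
rewrite !pos.
- rewrite -EFinB /= -mulrBr -sumrB; congr (_ * _); apply: eq_bigr => C _.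
  by rewrite /Num.max; case: ltgtP => h; case: ltgtP => h'; lra.
- by move=> k z Kk Gz; rewrite gK.
- by move=> x; rewrite le_max lexx orbT.
- by move=> C hC Cs; rewrite gs0// oppr0 maxxx.
- by move=> k z Kk Gz; rewrite gK.
- by move=> x; rewrite le_max lexx orbT.
- by move=> C hC Cs; rewrite gs0// maxxx.
Qed.

Lemma cre_sum (T : Type) (s : seq T) (F : T -> R[i]) :
  cre (\sum_(i <- s) F i) = \sum_(i <- s) cre (F i).
Proof. by apply: (big_morph cre) => // -[a b] [c d]. Qed.
Lemma cim_sum (T : Type) (s : seq T) (F : T -> R[i]) :
  cim (\sum_(i <- s) F i) = \sum_(i <- s) cim (F i).
Proof. by apply: (big_morph cim) => // -[a b] [c d]. Qed.

Lemma conv_haar_disc (f xi : X -> R[i]) x : hecke_fun gm g1 G K f ->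
  left_K_inv gm G K xi -> G x ->
  conv_haar mu f xi x = Complex (fine (mu K)) 0 * conv_disc gm gi g1 G K f xi x.
Proof.
move=> hf xiK Gx; have [fK fKr _] := hf.
have /finite_seqP[s0 s0E] := hecke_finite_conv hf Gx.
pose s := undup s0; have us : uniq s by exact: undup_uniq.
have sE C : C \in s <-> rcosets gm G K C /\ f (gm x (gi (rep g1 C))) != 0.
  rewrite mem_undup; suff : [set` s0] C <->
    (rcosets gm G K C /\ f (gm x (gi (rep g1 C))) != 0) by [].
  by rewrite -s0E.
have sI : [set` s] `<=` rcosets gm G K by move=> C /= /sE[].
have s0' C : rcosets gm G K C -> C \notin s -> f (gm x (gi (rep g1 C))) = 0.
  by move=> hC /negP Cs; apply/eqP/negPn/negP => h; apply: Cs; apply/sE.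
pose F y := f (gm x (gi y)) * xi y.
have FK k z : K k -> G z -> F (gm k z) = F z.
  move=> Kk Gz; rewrite /F xiK//; congr (_ * _).
  have Gk := sub_in sK Kk; have Gvz := g_inv gG Gz.
  rewrite (ginvM gG Gk Gz) (gmulA gG) fKr//; first exact: (sub_inv sK).
  exact: (g_mul gG).
rewrite /conv_haar /cintegral.
rewrite (@Rintegral_Hbar_inv (fun y => cre (F y)) s)//; last 2 first.
- by move=> k z Kk Gz; rewrite FK.
- by move=> C hC Cs; rewrite /F s0'// mul0r.
rewrite (@Rintegral_Hbar_inv (fun y => cim (F y)) s)//; last 2 first.
- by move=> k z Kk Gz; rewrite FK.
- by move=> C hC Cs; rewrite /F s0'// mul0r.
rewrite /conv_disc (fsbig_seq_supp us sI); last first.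
  by move=> C hC Cs; rewrite s0'// mul0r.
rewrite -cre_sum -cim_sum; case: (\sum_(C <- s) _) => a b /=.
by rewrite /cre /cim /GRing.mul /= !mul0r subr0 addr0.
Qed.

Lemma cabs2_ge0 (z : R[i]) : 0 <= cabs2 z.
Proof. by rewrite addr_ge0// sqr_ge0. Qed.

Lemma cabs2_scale (m : R) (z : R[i]) : cabs2 (Complex m 0 * z) = m ^+ 2 * cabs2 z.
Proof.
case: z => a b.
have -> : Complex m 0 * Complex a b = Complex (m * a) (m * b) :> R[i].
  by rewrite /GRing.mul /= !mul0r subr0 addr0.
by rewrite /cabs2 /cre /cim /=; ring.
Qed.

Lemma conv_disc_left (f xi : X -> R[i]) : left_K_inv gm G K f ->
  left_K_inv gm G K (conv_disc gm gi g1 G K f xi).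
Proof.
move=> fK k x Kk Gx; apply: eq_fsbigr => C /set_mem hC.
rewrite -(gmulA gG) fK//; apply: (g_mul gG) => //.
exact/(g_inv gG)/(repG gG sK).
Qed.

Lemma L2norm2_Hbar_inv (xi : X -> R[i]) : left_K_inv gm G K xi ->
  L2norm2 mu xi = (mu K * l2norm2 gm g1 G K xi)%E.
Proof.
move=> xiK; rewrite /L2norm2 (integral_Hbar_inv gp hp hm)//.
- by move=> k z Kk Gz; rewrite xiK.
- by move=> x _; exact: cabs2_ge0.
Qed.

Lemma hecke_Cc (f : X -> R[i]) : hecke_fun gm g1 G K f -> Cc_fun f.
Proof.
move=> [fK fKr fin]; split.
- apply: (@left_inv_continuous gT mul inv e H gp [:: H]) => k z Nk Gz.
  by rewrite fK// KE.
- apply: (@left_inv_continuous gT mul inv e H gp [:: H]) => k z Nk Gz.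
  by rewrite fK// KE.
exists (\bigcup_(C in [set C | rcosets gm G K C /\ f (rep g1 C) != 0]) C); first split.
- apply: finite_bigcup_compact => // C [[x Gx ->] _].
  exact: (rcoset_Hbar_compact gp hp).
- by move=> x [C [hC _] Cx]; exact: (rcosets_sub gG sK hC).
move=> x Gx nx; apply/eqP/negPn/negP => fx; apply: nx.
have hC := rcoset_in gm K Gx.
exists (rcoset gm K x); last exact: (rcoset_refl gG sK).
by split=> //; rewrite (left_inv_rep gG sK fK Gx).
Qed.

Lemma left_L2_fun (xi : X -> R[i]) : left_K_inv gm G K xi ->
  (l2norm2 gm g1 G K xi < +oo)%E -> L2_fun mu xi.
Proof.
move=> xiK xifin; split.
- apply: (@left_inv_measurable gT mul inv e H gp [:: H]) => k z Nk Gz.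
  by rewrite xiK// KE.
- apply: (@left_inv_measurable gT mul inv e H gp [:: H]) => k z Nk Gz.
  by rewrite xiK// KE.
rewrite L2norm2_Hbar_inv//; have [m m0 ->] := mK_ex.
by rewrite lte_mul_pinfty// ?lee_fin ?ltW.
Qed.

(* A length on [Gbar] becomes bi-[K]-invariant by taking suprema over double
   cosets; redefining it as [0] on [K] then makes it a length on the pair. *)
Section BiInvariantLength.
Variable l : X -> R.
Hypothesis ll : length_fun gm gi g1 G [set g1] l.
Hypothesis lb : loc_bounded_haar l.

Let M_ex : exists2 M : R, 0 <= M & forall k, K k -> l k <= M.
Proof.
have [M hM] := lb (Hbar_compact gp hp) (sub_in sK); exists M => //.
have K1 := sub_one sK; apply: le_trans (hM _ K1).
exact: (len_ge0 ll (g_one gG)).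
Qed.

Let S g : set R := [set z | exists k k', [/\ K k, K k' & z = l (gm (gm k g) k')]].
Let L0 g : R := sup (S g).
Definition biinv_len g : R := if `[< K g >] then 0 else L0 g.

Let S_ub M g : (forall k, K k -> l k <= M) -> G g -> ubound (S g) (l g + M + M).
Proof.
move=> hM Gg _ [k [k' [Kk Kk' ->]]].
have Gk := sub_in sK Kk; have Gk' := sub_in sK Kk'; have Gkg := g_mul gG Gk Gg.
rewrite (le_trans (lenM ll Gkg Gk'))// lerD//; last exact: hM.
by rewrite (le_trans (lenM ll Gk Gg))// addrC lerD// hM.
Qed.

Let S_bd g : G g -> has_ubound (S g).
Proof. by have [M _ hM] := M_ex; move=> Gg; exists (l g + M + M); exact: S_ub. Qed.

Let S_ne g : S g !=set0.
Proof. by exists (l (gm (gm g1 g) g1)), g1, g1; split=> //; exact: (sub_one sK). Qed.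

Let S_le g z : G g -> S g z -> z <= L0 g.
Proof. by move=> Gg Sz; apply: sup_ubound => //; exact: S_bd. Qed.

Let L0_le g : G g -> l g <= L0 g.
Proof.
move=> Gg; apply: S_le => //; exists g1, g1.
by split; [exact: (sub_one sK)|exact: (sub_one sK)|].
Qed.

Let S_left k g : K k -> G g -> S (gm k g) = S g.
Proof.
move=> Kk Gg; have Gk := sub_in sK Kk; apply/seteqP; split=> _ [a [b [Ka Kb ->]]].
  exists (gm a k), b; split=> //; exact: (sub_mul sK).
exists (gm a (gi k)), b; split=> //.
  by apply: (sub_mul sK) => //; exact: (sub_inv sK).
by rewrite (gmulA gG (gm a (gi k)) k g) (gmulKV gG).
Qed.

Let S_right k g : K k -> G g -> S (gm g k) = S g.
Proof.
move=> Kk Gg; have Gk := sub_in sK Kk; apply/seteqP; split=> _ [a [b [Ka Kb ->]]].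
  exists a, (gm k b); split=> //; exact: (sub_mul sK).
exists a, (gm (gi k) b); split=> //.
  by apply: (sub_mul sK) => //; exact: (sub_inv sK).
by rewrite (gmul_mid gG).
Qed.

Let K_left k g : K k -> G g -> K (gm k g) <-> K g.
Proof.
move=> Kk Gg; split=> h; last exact: (sub_mul sK).
rewrite -(gmulKl gG g (sub_in sK Kk)).
by apply: (sub_mul sK) => //; exact: (sub_inv sK).
Qed.

Lemma biinv_len_left k g : K k -> G g -> biinv_len (gm k g) = biinv_len g.
Proof.
move=> Kk Gg; rewrite /biinv_len /L0 S_left//.
by rewrite (asbool_equiv_eq (K_left Kk Gg)).
Qed.

Let L0_ge0 g : G g -> 0 <= L0 g.
Proof. by move=> Gg; rewrite (le_trans _ (L0_le Gg))//; exact: (len_ge0 ll). Qed.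

Let S_inv g : G g -> S (gi g) `<=` S g.
Proof.
move=> Gg _ [a [b [Ka Kb ->]]]; exists (gi b), (gi a).
have Ga := sub_in sK Ka; have Gb := sub_in sK Kb; have Gvg := g_inv gG Gg.
split; [exact: (sub_inv sK)|exact: (sub_inv sK)|].
have Gag := g_mul gG Ga Gvg; have Gagb := g_mul gG Gag Gb.
rewrite -(lenV ll Gagb) (ginvM gG Gag Gb) (ginvM gG Ga Gvg) (ginvK gG Gg).
by rewrite (gmulA gG).
Qed.

Lemma biinv_len_length : length_fun gm gi g1 G K biinv_len.
Proof.
have b0 g : G g -> 0 <= biinv_len g.
  by move=> Gg; rewrite /biinv_len; case: asboolP => // _; exact: L0_ge0.
split.
  move=> Y _; apply: sub_sigma_algebra.
  apply: (left_inv_preimage_open gp (F := [:: H])) => k z Nk Gz.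
  by rewrite biinv_len_left// KE.
have lK h : K h -> biinv_len h = 0 by rewrite /biinv_len; case: asboolP.
split; first exact: lK (sub_one sK).
split=> //; split=> [g Gg|].
  have Gvg := g_inv gG Gg.
  have E : S g = S (gi g).
    apply/seteqP; split; last exact: S_inv.
    by rewrite -{1}(ginvK gG Gg); exact: S_inv.
  rewrite /biinv_len /L0 E; suff -> : `[< K g >] = `[< K (gi g) >] by [].
  apply: asbool_equiv_eq; split=> [|h]; first exact: (sub_inv sK).
  by rewrite -(ginvK gG Gg); exact: (sub_inv sK).
split=> // g h Gg Gh; have Ggh := g_mul gG Gg Gh.
(* If [g] or [h] lies in [K], its length was set to 0 and subadditivity is an instance of
   invariance. Otherwise [a g h b] is split as [a g] times [h b], whose lengths are bounded by the
   two suprema. *)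
have [Kg|Kg] := pselect (K g); first by rewrite biinv_len_left// (lK g)// add0r.
have [Kh|Kh] := pselect (K h).
  rewrite (lK _ Kh) addr0 /biinv_len /L0 S_right//.
  suff -> : `[< K (gm g h) >] = `[< K g >] by [].
  apply: asbool_equiv_eq; split=> h'; last exact: (sub_mul sK).
  rewrite -(gmulK gG g (sub_in sK Kh)); apply: (sub_mul sK) => //.
  exact: (sub_inv sK).
have bN x : ~ K x -> biinv_len x = L0 x by rewrite /biinv_len; case: asboolP.
rewrite (bN g)// (bN h)// {1}/biinv_len; case: asboolP => [_|Kgh].
  by rewrite addr_ge0// L0_ge0.
apply: ge_sup => // _ [a [b [Ka Kb ->]]].
have Ga := sub_in sK Ka; have Gb := sub_in sK Kb.
rewrite (gmulA gG a g h) -(gmulA gG (gm a g)).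
have Gag := g_mul gG Ga Gg; have Ghb := g_mul gG Gh Gb.
rewrite (le_trans (lenM ll Gag Ghb))// lerD//; apply: S_le => //.
  by exists a, g1; split=> //; exact: (sub_one sK).
by exists g1, b; split=> //; exact: (sub_one sK).
Qed.

(** On [K] the new length is 0 while [l] is only bounded, so the comparison needs the added 1 and a
    factor [P]. *)
Lemma le_biinv_len : exists2 P : R, 0 < P &
  forall g, G g -> 1 + l g <= P * (1 + biinv_len g).
Proof.
have [M M0 hM] := M_ex; exists (1 + M); first by rewrite ltr_pwDl.
move=> g Gg; rewrite /biinv_len; case: asboolP => Kg.
  by rewrite addr0 mulr1 lerD2l hM.
rewrite (@le_trans _ _ (1 + L0 g))//; first by rewrite lerD2l L0_le.
by rewrite ler_peMl ?lerDl// addr_ge0// L0_ge0.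
Qed.

End BiInvariantLength.

Lemma RD_haar_disc : RD_haar mu ->
  RD_disc (R := R) gm gi g1 G K.
Proof.
move=> [l [ll [lb [s [c [s0 [c0 Hl]]]]]]].
have l'l := biinv_len_length ll lb; have [P P0 hP] := le_biinv_len ll lb.
exists (biinv_len l); split=> //; split; first exact: (len_loc_bounded gG sK l'l).
have [m m0 mE] := mK_ex.
(* In the Haar inequality the left side carries [m ^+ 3], two factors from the convolution and one
   from the norm, and the right side [m ^+ 2], one from each norm; the change of length costs
   P^(2s). *)
pose c' := c * P `^ s / Num.sqrt m.
have c'E : c' ^+ 2 = c ^+ 2 * P `^ (2 * s) / m.
  rewrite /c' !exprMn exprVn sqr_sqrtr ?ltW//; congr (_ * _ / _).
  by rewrite (mulrC 2) powRrM -powR_mulrn ?powR_ge0.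
exists s, c'; split=> //; split.
  by rewrite /c' divr_gt0// ?mulr_gt0// ?powR_gt0// sqrtr_gt0.
move=> f hf xi xiK xifin; have [fK fKr _] := hf.
have := Hl f (hecke_Cc hf) xi (left_L2_fun xiK xifin).
have -> : L2norm2 mu (conv_haar mu f xi) =
    ((m ^+ 3)%:E * l2norm2 gm g1 G K (conv_disc gm gi g1 G K f xi))%E.
  transitivity (\int[mu]_(x in G)
      (m ^+ 2 * cabs2 (conv_disc gm gi g1 G K f xi x))%:E)%E.
    apply: eq_integral => x /set_mem Gx.
    by rewrite conv_haar_disc// cabs2_scale mE.
  rewrite (integral_Hbar_inv gp hp hm); last 2 first.
  - by move=> k z Kk Gz; rewrite conv_disc_left.
  - by move=> x _; rewrite mulr_ge0 ?sqr_ge0 ?cabs2_ge0.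
  under eq_esum do rewrite EFinM.
  rewrite esumZl ?sqr_ge0//; last by move=> C _; rewrite lee_fin cabs2_ge0.
  by rewrite mE muleA -EFinM -exprS.
rewrite (L2norm2_Hbar_inv xiK) mE.
have hW : (weighted_L2 mu l s f <=
    (m * P `^ (2 * s))%:E * weighted_norm2 gm g1 G K (biinv_len l) s f)%E.
  have b0 x : G x -> 0 <= biinv_len l x by exact: (len_ge0 l'l).
  rewrite /weighted_norm2 EFinM -muleA -esumZl ?powR_ge0//; last first.
    by move=> C _; rewrite lee_fin mulr_ge0 ?cabs2_ge0 ?powR_ge0.
  under eq_esum do rewrite -EFinM.
  rewrite -mE -(integral_Hbar_inv gp hp hm (f := fun x => P `^ (2 * s) *
     (cabs2 (f x) * (1 + biinv_len l x) `^ (2 * s)))); last 2 first.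
  - by move=> k z Kk Gz; rewrite fK// (len_left gG sK l'l).
  - by move=> x _; rewrite !mulr_ge0 ?cabs2_ge0 ?powR_ge0.
  apply: le_integral_ge0 => x Gx; rewrite !lee_fin; split.
    by rewrite mulr_ge0 ?cabs2_ge0 ?powR_ge0.
  rewrite mulrCA ler_wpM2l ?cabs2_ge0//.
  rewrite -powRM ?(ltW P0) ?addr_ge0 ?b0//.
  apply: ge0_ler_powR; rewrite ?nnegrE ?mulr_ge0 ?(ltW s0) ?(ltW P0) ?addr_ge0 ?b0//.
  - exact: (len_ge0 ll).
  - exact: hP.
move: hW; set W := weighted_norm2 _ _ _ _ _ _ _; set A := l2norm2 _ _ _ _ (conv_disc _ _ _ _ _ _ _).
set Z := l2norm2 _ _ _ _ xi; set W0 := weighted_L2 _ _ _ _ => hW hA.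
have Z0 : (0 <= Z)%E by apply: esum_ge0 => C _; rewrite lee_fin cabs2_ge0.
have {}hA : ((m ^+ 3)%:E * A <= (c ^+ 2)%:E * ((m * P `^ (2 * s))%:E * W) * (m%:E * Z))%E.
  apply: (le_trans hA); apply: lee_wpmul2r.
    by rewrite mule_ge0// lee_fin ltW.
  by apply: lee_wpmul2l => //; rewrite lee_fin sqr_ge0.
rewrite -[A]mul1e -(mulVf (lt0r_neq0 (exprn_gt0 3 m0))) EFinM -muleA.
rewrite c'E (le_trans (lee_wpmul2l _ hA))//; first by rewrite lee_fin invr_ge0 exprn_ge0// ltW.
rewrite le_eqVlt; apply/orP; left; apply/eqP.
rewrite (muleA (c ^+ 2)%:E) -EFinM muleACA -EFinM muleA -EFinM muleA.
congr (_%:E * _ * _)%E; field; exact: lt0r_neq0.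
Qed.

End DiscFromHaar.

(** * Haar measure *)

Section HaarContent.
Context {R : realType} {gT : pointedType} (mul : gT -> gT -> gT)
  (inv : gT -> gT) (e : gT) (H : set gT).
Hypothesis gp : is_group mul inv e.
Hypothesis hp : hecke_pair mul inv e setT H.

Local Notation X := (GbarT mul H).
Local Notation G := (Gbar mul H).
Local Notation K := (Hbar mul H).
Local Notation gm := (@smul gT mul H).
Local Notation gi := (@sinv gT mul H).
Local Notation g1 := (@sone gT mul H).
Local Notation N F := (@stab gT mul H F).
Let gG : group_on gm gi g1 G := group_on_Gbar H gp.
Let sN F : is_subgroup gm gi g1 G (N F) := sub_stab H gp F.
Let sK : is_subgroup gm gi g1 G K := sub_Hbar gp hp.
Let KE : K = N [:: H] := HbarE gp hp.

(* Lebesgue number lemma for the uniformity of right cosets *)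
Lemma lebesgue_rcoset (C : set X) (P : set X -> Prop) : compact C -> C `<=` G ->
  (forall A A', A `<=` A' -> P A' -> P A) ->
  (forall s, C s -> exists F, P (rcoset gm (N F) s)) ->
  exists F, forall s, C s -> P (rcoset gm (N F) s).
Proof.
move=> /compact_near_coveringP cC CG Pdown Ploc.
pose Fil : set_system (seq (set gT)) := filter_from [set: seq (set gT)]
  (fun s0 => [set s : seq (set gT) | {subset s0 <= s}]).
have FF : Filter Fil.
  apply: filter_from_filter; first by exists [::].
  move=> s s' _ _; exists (s ++ s') => // t ht; split=> x hx; apply: ht.
    by rewrite mem_cat hx.
  by rewrite mem_cat hx orbT.
have [|F _ /(_ F (fun _ h => h)) hF] :=
  cC _ Fil (fun F s => P (rcoset gm (N F) s)) FF; last by exists F.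
move=> x Cx; have Gx := CG _ Cx; have [F0 hF0] := Ploc x Cx.
exists (rcoset gm (N F0) x, [set F : seq (set gT) | {subset F0 <= F}]).
  split; last by exists F0.
  apply: open_nbhs_nbhs; split; first exact: (rcoset_open gp).
  exact: (rcoset_refl gG (sN F0)).
move=> [y F] /= [hy hF]; apply: Pdown hF0.
rewrite -(rcoset_eq gG (sN F0) Gx hy) => _ [k Nk <-]; exists k => //.
exact: (stab_sub hF).
Qed.

(** By [stabP] the values of [t^-1] on [F] serve as a name for the right coset of [t]. Right
    translation by [x] then applies [x^-1] to each entry of the name. *)
Definition traces F (V : set X) : set (seq (set gT)) :=
  [set [seq gi t C | C <- F] | t in V].

Definition saturated F (V : set X) : Prop :=
  V `<=` G /\ forall s, V s -> rcoset gm (N F) s `<=` V.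

(* number of right cosets of [stab F] that meet [V] *)
Definition ncosets F (V : set X) : \bar R := (\esum_(c in traces F V) 1)%E.

Local Open Scope ereal_scope.

Lemma ncosets_ge0 F V : 0 <= ncosets F V.
Proof. exact: esum_ge0. Qed.

Lemma saturated_mem F V s t : saturated F V -> V s -> G t ->
  [seq gi t C | C <- F] = [seq gi s C | C <- F] -> V t.
Proof.
move=> [VG Vsat] Vs Gt E; apply: (Vsat s) => //.
by rewrite (rcoset_stabE gp)//; exact: VG.
Qed.

Lemma saturated_sub F F' V : {subset F <= F'} -> saturated F V -> saturated F' V.
Proof.
move=> FF' [VG Vsat]; split=> // s Vs t [k Nk <-]; apply: (Vsat s Vs).
by exists k => //; exact: (stab_sub FF').
Qed.

Lemma ncosets_mulr F V x : G x -> V `<=` G ->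
  ncosets F [set gm a x | a in V] = ncosets F V.
Proof.
move=> Gx VG; rewrite /ncosets.
have -> : traces F [set gm a x | a in V] =
    (fun c => [seq gi x C | C <- c]) @` traces F V.
  apply/seteqP; split=> z.
    move=> [_ [a Va <-] <-]; exists [seq gi a C | C <- F]; first by exists a.
    rewrite -map_comp; apply: eq_map => C /=.
    by rewrite (ginvM gG (VG _ Va) Gx).
  move=> [_ [a Va <-] <-]; exists (gm a x); first by exists a.
  rewrite -map_comp; apply: eq_map => C /=.
  by rewrite (ginvM gG (VG _ Va) Gx).
rewrite esum_image// => c c' _ _; apply: inj_map => C D.
exact: (SymGH_inj (SymGH_inv (Gbar_Sym Gx))).
Qed.

Lemma ncosetsU F V W : saturated F V -> saturated F W -> V `&` W = set0 ->
  ncosets F (V `|` W) = ncosets F V + ncosets F W.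
Proof.
move=> sV sW VW; have tU : traces F (V `|` W) = traces F V `|` traces F W.
  by rewrite /traces image_setU.
rewrite /ncosets (esumID (traces F V))//; congr (_ + _); congr (esum _ _).
  by rewrite tU setIC; apply/setIidl; exact: subsetUl.
rewrite tU setIUl setICr set0U; apply/setIidl => _ [w Ww <-] [v Vv Ev].
suff : (V `&` W) w by rewrite VW.
split=> //; apply: (saturated_mem sV Vv) => //.
by case: sW => + _; exact.
Qed.

Lemma ncosets_fin F V : finite_set (traces F V) ->
  ncosets F V = (fine (ncosets F V))%:E.
Proof.
move=> fin; rewrite fineK// /ncosets esum_fset// fsbig_finite//=.
by rewrite sumEFin.
Qed.

(** [V] is a disjoint union of right cosets of [N F]. Each is a right translate of [N F], hence
    splits into equally many right cosets of [N F']. *)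
Lemma ncosets_refine F F' V : H \in F -> {subset F <= F'} -> saturated F V ->
  finite_set (traces F' (N F)) ->
  ncosets F' V = ncosets F V * ncosets F' (N F).
Proof.
move=> HF FF' sV fin; have [VG Vsat] := sV.
pose J c := traces F' [set t | V t /\ [seq gi t C | C <- F] = c].
have JE c : traces F V c -> \esum_(d in J c) (1 : \bar R) = ncosets F' (N F).
  move=> [s Vs <-]; have Gs := VG _ Vs.
  rewrite -(ncosets_mulr F' Gs (sub_in (sN F))); congr (esum (traces F' _) _).
  rewrite -[RHS]/(rcoset gm (N F) s) (rcoset_stabE gp _ Gs).
  apply/seteqP; split=> t /= [h1 h2]; split=> //; first exact: VG.
  exact: (saturated_mem sV Vs).
have [r r0 rE] : exists2 r : R, (0 <= r)%R & ncosets F' (N F) = r%:E.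
  exists (fine (ncosets F' (N F))); last exact: ncosets_fin.
  by rewrite fine_ge0// ncosets_ge0.
transitivity (\esum_(c in traces F V) \esum_(d in J c) (1 : \bar R)).
  rewrite esum_esum//.
  apply: (reindex_esum (traces F V `*`` J) (traces F' V) snd (fun=> 1)); split.
  - by move=> [c d] /= [_ [t [Vt _] <-]]; exists t.
  - move=> [c d] [c' d'] /set_mem[/= _ [t [Vt <-] <-]] /set_mem[/= _ [t' [Vt' <-] <-]].
    move=> /eq_in_map E; rewrite (_ : [seq gi t C | C <- F] = [seq gi t' C | C <- F]).
      by congr pair; apply/eq_in_map => C hC; apply: E.
    by apply/eq_in_map => C hC; apply/E/FF'.
  - move=> _ [t Vt <-]; exists ([seq gi t C | C <- F], [seq gi t C | C <- F']) => //.
    by split=> /=; exists t.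
rewrite (eq_esum JE) rE muleC -esumZl//; apply: eq_esum => c _.
by rewrite mule1.
Qed.

Lemma finite_traces_Hbar F : finite_set (traces F K).
Proof.
apply: sub_finite_set (finite_orbit_seq gp hp F) => _ [s Ks <-].
by exists (gi s) => //; exact: (sub_inv sK).
Qed.

Lemma finite_traces_stab F F' : H \in F -> finite_set (traces F' (N F)).
Proof.
move=> HF; apply: sub_finite_set (finite_traces_Hbar F').
exact/image_subset/(stab_sub_Hbar gp hp HF).
Qed.

Lemma ncosets_gt0 F V s : finite_set (traces F V) -> V s -> (0 < fine (ncosets F V))%R.
Proof.
move=> fin Vs; rewrite -lte_fin -ncosets_fin// (@lt_le_trans _ _ 1)//.
apply: esum_ge; exists [set [seq gi s C | C <- F]].
  by split; [exact: finite_set1|move=> _ ->; exists s].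
by rewrite fsbig_set1.
Qed.

(** [V] is a finite union of right cosets of [stab F], a subgroup of [Hbar] since [H] is in [F]. The
    sets that have a frame are the compact open subsets of [Gbar], the domain of the content. *)
Definition frame F (V : set X) : Prop :=
  [/\ H \in F, saturated F V & finite_set (traces F V)].

Definition copen (V : set X) : Prop := exists F, frame F V.

Definition content_at F (V : set X) : R :=
  (fine (ncosets F V) / fine (ncosets F K))%R.

Lemma saturated_Hbar F : H \in F -> saturated F K.
Proof.
move=> HF; split; first exact: (sub_in sK).
move=> s Ks _ [k Nk <-]; apply: (sub_mul sK) => //.
exact: (stab_sub_Hbar gp hp HF).
Qed.

(** Numerator and denominator are both multiplied by the index of [N F'] in [N F]. *)
Lemma content_at_refine F F' V : {subset F <= F'} -> frame F V ->
  content_at F' V = content_at F V.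
Proof.
move=> FF' [HF sV fin]; have finN := finite_traces_stab F' HF.
rewrite /content_at (ncosets_refine HF FF' sV finN).
rewrite (ncosets_refine HF FF' (saturated_Hbar HF) finN).
rewrite (ncosets_fin fin) (ncosets_fin (finite_traces_Hbar F)) (ncosets_fin finN).
have q0 : (0 < fine (ncosets F' (N F)))%R.
  exact: (ncosets_gt0 finN (sub_one (sN F))).
have k0 := ncosets_gt0 (finite_traces_Hbar F) (sub_one sK).
by rewrite -!EFinM /=; field; rewrite !lt0r_neq0.
Qed.

Definition content (V : set X) : R := content_at (xget [::] [set F : seq (set gT) | frame F V]) V.

Lemma contentE F V : frame F V -> content V = content_at F V.
Proof.
move=> fV; have fV' : frame (xget [::] [set F : seq (set gT) | frame F V]) V.
  by have := @xgetPex _ [::] [set F : seq (set gT) | frame F V]; apply; exists F.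
rewrite /content; set F' := xget _ _ in fV' *.
rewrite -(@content_at_refine F' (F' ++ F))// -?(@content_at_refine F (F' ++ F))//.
  by move=> C hC; rewrite mem_cat hC orbT.
by move=> C hC; rewrite mem_cat hC.
Qed.

(** [V] is covered by finitely many right translates of [N F]. This lies in [Hbar], whose orbits are
    finite, so each translate has finitely many traces on [F']. *)
Lemma finite_traces_refine F F' V : H \in F -> finite_set (traces F V) -> V `<=` G ->
  finite_set (traces F' V).
Proof.
move=> HF /finite_seqP[s sE] VG.
have [q qP] : exists q : seq (set gT) -> X, forall c, traces F V c ->
    V (q c) /\ [seq gi (q c) C | C <- F] = c.
  have : forall c, exists t : X, traces F V c -> V t /\ [seq gi t C | C <- F] = c.
    move=> c; have [[t Vt E]|nc] := pselect (traces F V c); first by exists t.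
    by exists g1 => /nc.
  by move=> /choice[q hq]; exists q.
apply: (@sub_finite_set _ _ (\bigcup_(c in [set` s]) traces F' (rcoset gm (N F) (q c)))).
  move=> _ [t Vt <-]; have ht : traces F V [seq gi t C | C <- F] by exists t.
  exists [seq gi t C | C <- F]; first by rewrite -sE.
  have [Vq Eq] := qP _ ht; exists t => //.
  by rewrite (rcoset_stabE gp) ?Eq//; [split=> //; exact: VG|exact: VG].
apply: bigcup_finite; first exact: finite_seq.
move=> c sc; have [Vq _] : V (q c) /\ [seq gi (q c) C | C <- F] = c.
  by apply: qP; rewrite sE.
apply: sub_finite_set (finite_image (fun d => [seq gi (q c) C | C <- d])
  (finite_traces_stab F' HF)).
move=> _ [_ [k Nk <-] <-]; exists [seq gi k C | C <- F']; first by exists k.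
rewrite -map_comp; apply: eq_map => C /=.
by rewrite (ginvM gG (sub_in (sN F) Nk) (VG _ Vq)).
Qed.

Lemma frame_refine F F' V : {subset F <= F'} -> frame F V -> frame F' V.
Proof.
move=> FF' [HF sV fin]; split; first exact: FF'.
  exact: saturated_sub sV.
by apply: (finite_traces_refine F' HF fin); case: sV.
Qed.

Lemma copen2 V W : copen V -> copen W -> exists F, frame F V /\ frame F W.
Proof.
move=> [F fV] [F' fW]; exists (F ++ F'); split.
  by apply: frame_refine fV => C hC; rewrite mem_cat hC.
by apply: frame_refine fW => C hC; rewrite mem_cat hC orbT.
Qed.

Lemma copen_sub V : copen V -> V `<=` G. Proof. by move=> [F [_ []]]. Qed.

Lemma frame_rcoset F s : H \in F -> G s -> frame F (rcoset gm (N F) s).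
Proof.
move=> HF Gs; split=> //.
  split; first exact: (rcoset_sub gG (sN F)).
  by move=> t ht; rewrite (rcoset_eq gG (sN F) Gs ht).
apply: (@sub_finite_set _ _ [set [seq gi s C | C <- F]]); last exact: finite_set1.
by move=> _ [t + <-]; rewrite (rcoset_stabE gp)// => -[_ ->].
Qed.

Lemma frameD F V (P : set X) : frame F V ->
  (forall s, V s -> ~ P s -> rcoset gm (N F) s `<=` ~` P) -> frame F (V `\` P).
Proof.
move=> [HF [VG Vsat] fin] hP; split=> //.
  split; first by move=> s [/VG].
  by move=> s [Vs nP] t ht; split; [exact: (Vsat s)|exact: (hP s)].
by apply: sub_finite_set fin; apply: image_subset => s [].
Qed.

Lemma copenD V W : copen V -> copen W -> copen (V `\` W).
Proof.
move=> cV cW; have [F [fV fW]] := copen2 cV cW; exists F; apply: frameD => //.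
move=> s Vs nW t ht Wt; apply: nW; case: fW => _ [_ /(_ t Wt)] + _; apply.
have [_ [VG _] _] := fV; have Gs := VG _ Vs.
rewrite (rcoset_eq gG (sN F) Gs ht); exact: (rcoset_refl gG (sN F)).
Qed.

Lemma contentU V W : copen V -> copen W -> V `&` W = set0 ->
  copen (V `|` W) /\ content (V `|` W) = (content V + content W)%R.
Proof.
move=> cV cW VW; have [F [fV fW]] := copen2 cV cW.
have [HF sV finV] := fV; have [_ sW finW] := fW.
have fU : frame F (V `|` W).
  split=> //; last by rewrite /traces image_setU finite_setU.
  case: sV sW => VG Vs [WG Ws]; split; first by move=> s [/VG|/WG].
  by move=> s [/Vs|/Ws] h t /h; [left|right].
split; first by exists F.
rewrite (contentE fU) (contentE fV) (contentE fW) /content_at ncosetsU//.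
by rewrite (ncosets_fin finV) (ncosets_fin finW) -EFinD /= mulrDl.
Qed.

Lemma content_ge0 V : (0 <= content V)%R.
Proof. by rewrite divr_ge0// fine_ge0// ncosets_ge0. Qed.

Lemma le_content V W : copen V -> copen W -> V `<=` W -> (content V <= content W)%R.
Proof.
move=> cV cW VW; have cD := copenD cW cV.
have [_] := contentU cV cD (setDIK _ _).
by rewrite setDUK// => ->; rewrite lerDl content_ge0.
Qed.

Lemma copen_mulr V x : G x -> copen V -> copen [set gm a x | a in V] /\
  content [set gm a x | a in V] = content V.
Proof.
move=> Gx [F fV]; have [HF [VG Vsat] fin] := fV.
have fVx : frame F [set gm a x | a in V].
  split=> //.
    split; first by move=> _ [a /VG Ga <-]; exact: (g_mul gG).
    move=> _ [a Va <-] _ [k Nk <-]; exists (gm k a); last by rewrite (gmulA gG).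
    by apply: (Vsat a) => //; exists k.
  apply: sub_finite_set (finite_image (fun c => [seq gi x C | C <- c]) fin).
  move=> _ [_ [a Va <-] <-]; exists [seq gi a C | C <- F]; first by exists a.
  rewrite -map_comp; apply: eq_map => C /=.
  by rewrite (ginvM gG (VG _ Va) Gx).
split; first by exists F.
by rewrite (contentE fV) (contentE fVx) /content_at ncosets_mulr.
Qed.

Lemma content_gt0 V s : copen V -> V s -> (0 < content V)%R.
Proof.
move=> [F fV] Vs; rewrite (contentE fV); have [_ _ fin] := fV.
by rewrite divr_gt0// ?(ncosets_gt0 fin Vs)// (ncosets_gt0 (finite_traces_Hbar F) (sub_one sK)).
Qed.

Lemma open_copen (U : set X) s : open U -> U `<=` G -> U s ->
  exists2 V, copen V & V s /\ V `<=` U.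
Proof.
move=> oU UG Us; have [F hF] := (open_GbarPr gp U).1 oU s (UG _ Us) Us.
exists (rcoset gm (N (H :: F)) s).
  by exists (H :: F); apply: frame_rcoset; [exact: mem_head|exact: UG].
split; first exact: (rcoset_refl gG (sN _)).
move=> _ [k Nk <-]; apply: hF; exists k => //.
by apply: stab_sub Nk => C hC; rewrite inE hC orbT.
Qed.

Lemma frame_open F V : frame F V -> open V.
Proof. by move=> [_ [VG Vsat] _]; apply/(open_GbarPr gp) => s Gs Vs; exists F; exact: Vsat. Qed.

Lemma frame_openC F V : frame F V -> open (~` V).
Proof.
move=> [_ [VG Vsat] _]; apply/(open_GbarPr gp) => s Gs nV; exists F => t ht Vt.
apply: nV; apply: (Vsat t Vt); rewrite (rcoset_eq gG (sN F) Gs ht).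
exact: (rcoset_refl gG (sN F)).
Qed.

Lemma copen_compact V : copen V -> compact V.
Proof.
move=> [F fV]; have [HF [VG Vsat] fin] := fV.
apply: (@subclosed_compact _ _ (\bigcup_(C in [set rcoset gm K t | t in V]) C)).
- by rewrite -openC; exact: frame_openC fV.
- apply: finite_bigcup_compact; last first.
    by move=> _ [t Vt <-]; apply: (rcoset_Hbar_compact gp hp); exact: VG.
  have fin1 : finite_set (traces [:: H] V) by exact: (finite_traces_refine _ HF).
  apply: sub_finite_set (finite_image (fun c => [set t : X | G t /\
    [seq gi t C | C <- [:: H]] = c]) fin1).
  move=> _ [t Vt <-]; exists [seq gi t C | C <- [:: H]]; first by exists t.
  by rewrite KE (rcoset_stabE gp)//; exact: VG.
- move=> t Vt; exists (rcoset gm K t); first by exists t.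
  exact: (rcoset_refl gG sK).
Qed.

End HaarContent.

(** * From the content on compact open sets to a regular Borel measure *)

Section HaarMeasure.
Context {R : realType} {gT : pointedType} (mul : gT -> gT -> gT)
  (inv : gT -> gT) (e : gT) (H : set gT).
Hypothesis gp : is_group mul inv e.
Hypothesis hp : hecke_pair mul inv e setT H.

Local Notation X := (GbarT mul H).
Local Notation B := (GbarB mul H).
Local Notation G := (Gbar mul H).
Local Notation K := (Hbar mul H).
Local Notation gm := (@smul gT mul H).
Local Notation gi := (@sinv gT mul H).
Local Notation g1 := (@sone gT mul H).
Local Notation N F := (@stab gT mul H F).
Local Notation copen := (@copen gT mul H).
Local Notation content := (@content R gT mul H).
Let gG : group_on gm gi g1 G := group_on_Gbar H gp.
Let sN F : is_subgroup gm gi g1 G (N F) := sub_stab H gp F.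
Let sK : is_subgroup gm gi g1 G K := sub_Hbar gp hp.
Let KE : K = N [:: H] := HbarE gp hp.
Local Open Scope ereal_scope.

Definition haar_inner (U : set X) : \bar R :=
  ereal_sup [set (content V)%:E | V in [set V | copen V /\ V `<=` U]].

(** The Borel sets are subsets of the whole type of maps; intersecting with [G] makes the points
    outside [Gbar] a null set. *)
Definition haar_outer (A : set B) : \bar R :=
  ereal_inf [set haar_inner U |
    U in [set U : set X | [/\ open U, A `&` G `<=` U & U `<=` G]]].

Lemma copen0 : copen set0.
Proof.
exists [:: H]; split; [exact: mem_head|by split|].
by rewrite /traces image_set0; exact: finite_set0.
Qed.

Lemma content0 : content set0 = 0%R.
Proof.
have [_] := contentU (R := R) gp hp copen0 copen0 (setI0 _).
by rewrite setU0 => h; lra.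
Qed.

Lemma haar_inner_ge0 U : 0 <= haar_inner U.
Proof. by apply: ereal_sup_ubound; exists set0; rewrite ?content0//; split=> //; exact: copen0. Qed.

Lemma le_haar_inner U V : U `<=` V -> haar_inner U <= haar_inner V.
Proof.
move=> UV; apply: ereal_sup_le => _ [W [cW WU] <-]; exists W => //.
by split=> // s /WU/UV.
Qed.

Lemma haar_inner_ub U V : copen V -> V `<=` U -> (content V)%:E <= haar_inner U.
Proof. by move=> cV VU; apply: ereal_sup_ubound; exists V. Qed.

Lemma haar_inner_bigcup (U : nat -> set X) : (forall n, open (U n)) ->
  haar_inner (\bigcup_n U n) <= \sum_(n <oo) haar_inner (U n).
Proof.
move=> oU; apply: ge_ereal_sup => _ [V [cV VU] <-].
have [F1 fV1] := cV; have VG := copen_sub cV.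
pose P (A : set X) := exists n, A `<=` U n.
have [|s Vs|F0 hF0] := lebesgue_rcoset gp (copen_compact gp hp cV) VG (P := P).
- by move=> A A' AA' [n hn]; exists n => s /AA'/hn.
- have [n _ Us] := VU s Vs; have [F hF] := (open_GbarPr gp _).1 (oU n) s (VG _ Vs) Us.
  by exists F, n.
pose F := F1 ++ F0.
have fV : frame F V by apply: (frame_refine gp hp _ fV1) => C hC; rewrite mem_cat hC.
have hF s : V s -> exists n, rcoset gm (N F) s `<=` U n.
  move=> /hF0[n hn]; exists n => _ [k Nk <-]; apply: hn; exists k => //.
  by apply: stab_sub Nk => C hC; rewrite mem_cat hC orbT.
(* [W n] collects the cosets of [N F] in [V] that lie in some [U i] with [i < n]. The layer added by
   passing from [n] to [n.+1] lies in [U n], and [W n] exhausts [V] for large [n] because [V] has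
   finitely many cosets. *)
pose W n := V `\` [set s | forall i, (i < n)%N -> ~ (rcoset gm (N F) s `<=` U i)].
have eqr s t : V s -> rcoset gm (N F) s t -> rcoset gm (N F) t = rcoset gm (N F) s.
  by move=> Vs; apply: (rcoset_eq gG (sN F)); exact: VG.
have cW n : copen (W n).
  exists F; apply: frameD => // s Vs nP t ht hP; apply: nP => i ilt.
  by rewrite -(eqr s t Vs ht); exact: hP.
have WS n : (content (W n.+1) <= content (W n) + content (W n.+1 `\` W n))%R.
  have cD := copenD gp hp (cW n.+1) (cW n).
  have [_ <-] := contentU (R := R) gp hp (cW n) cD (setDIK _ _).
  apply: (le_content gp hp) => //.
    by have [] := contentU (R := R) gp hp (cW n) cD (setDIK _ _).
  by move=> s Ws; have [|] := pselect (W n s); [left|right].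
have Wle n : (content (W n))%:E <= \sum_(0 <= i < n) haar_inner (U i).
  elim: n => [|n IH].
    rewrite big_geq// (_ : W 0%N = set0) ?content0//.
    by apply/seteqP; split=> // s [_ []].
  rewrite big_nat_recr//= (le_trans (_ : _ <= (content (W n) + content (W n.+1 `\` W n))%:E))//.
    by rewrite lee_fin.
  rewrite EFinD leeD// haar_inner_ub//; first exact: (copenD gp hp).
  move=> s [[Vs hs] nW]; apply: contrapT => nU; apply: nW; split=> // hs'.
  apply: hs => i; rewrite ltnS leq_eqVlt => /orP[/eqP->|/hs'//] sub.
  by apply/nU/sub; exact: (rcoset_refl gG (sN F)).
have [n Wn] : exists n, V `<=` W n.
  have [_ _ /finite_seqP[cs csE]] := fV.
  suff [n hn] : exists n, forall s, V s -> [seq gi s C | C <- F] \in cs ->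
      exists2 i, (i < n)%N & rcoset gm (N F) s `<=` U i.
    exists n => s Vs; split=> // hs.
    have cs_s : [set` cs] [seq gi s C | C <- F] by rewrite -csE; exists s.
    by have [i ilt sub] := hn s Vs cs_s; exact: (hs i).
  elim: cs {csE} => [|c cs [n hn]]; first by exists 0%N.
  have [[s0 [Vs0 E0]]|nc] := pselect (exists s, V s /\ [seq gi s C | C <- F] = c).
    have [m hm] := hF s0 Vs0; exists (maxn n m.+1) => s Vs; rewrite inE => /orP[/eqP Ec|].
      exists m; first by rewrite leq_max ltnSn orbT.
      rewrite (eqr s0 s Vs0)//; rewrite (rcoset_stabE gp); last exact: VG.
      by split; [exact: VG|rewrite Ec].
    by move=> /(hn s Vs)[i ilt sub]; exists i => //; rewrite leq_max ilt.
  exists n => s Vs; rewrite inE => /orP[/eqP Ec|]; last exact: hn.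
  by case: nc; exists s.
rewrite (le_trans _ (le_trans (Wle n) _))//.
  by rewrite lee_fin (le_content gp hp).
by apply: nneseries_lim_ge => *; exact: haar_inner_ge0.
Qed.

Lemma haar_outer_ge0 A : 0 <= haar_outer A.
Proof. by apply: le_ereal_inf_tmp => _ [U _ <-]; exact: haar_inner_ge0. Qed.

Lemma le_haar_outer : {homo haar_outer : A A' / A `<=` A' >-> A <= A'}.
Proof.
move=> A A' AA'; apply: ereal_inf_le_tmp => _ [U [oU AU UG] <-]; exists U => //.
by split=> // s [/AA' As Gs]; exact: AU.
Qed.

Lemma haar_outer_open (U : set X) : open U -> U `<=` G ->
  haar_outer U = haar_inner U.
Proof.
move=> oU UG; apply/eqP; rewrite eq_le; apply/andP; split.
  by apply: ereal_inf_lbound; exists U => //; split=> // s [].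
apply: le_ereal_inf_tmp => _ [W [oW UW WG] <-]; apply: le_haar_inner => s Us.
by apply: UW; split=> //; exact: UG.
Qed.

Lemma copen_open V : copen V -> open (V : set X).
Proof. by move=> [F fV]; exact: (frame_open gp fV). Qed.

Lemma haar_outer_copen V : copen V -> haar_outer V = (content V)%:E.
Proof.
move=> cV; rewrite haar_outer_open; [|exact: copen_open|exact: copen_sub].
apply/eqP; rewrite eq_le haar_inner_ub// andbT.
by apply: ge_ereal_sup => _ [W [cW WV] <-]; rewrite lee_fin (le_content gp hp).
Qed.

Lemma haar_outer0 : haar_outer set0 = 0.
Proof. by rewrite (haar_outer_copen copen0) content0. Qed.

Lemma haar_outer_sigma_subadditive : sigma_subadditive haar_outer.
Proof.
move=> A; have [[i ioo]|] := pselect (exists i, haar_outer (A i) = +oo).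
  rewrite (eseries_pinfty _ _ ioo) ?leey// => n _.
  by rewrite -ltNye (lt_le_trans _ (haar_outer_ge0 _)).
rewrite -forallNE => Aoo; apply/lee_addgt0Pr => r r0.
rewrite (le_trans _ (epsilon_trick _ _ (ltW r0)))//; last first.
  by move=> n; exact: haar_outer_ge0.
have /choice[U hU] : forall n, exists U : set X, [/\ open U, A n `&` G `<=` U, U `<=` G &
    haar_inner U <= haar_outer (A n) + (r / (2 ^ n.+1)%:R)%:E].
  move=> n; have en : (0 < r / (2 ^ n.+1)%:R)%R by rewrite divr_gt0// ltr0n expn_gt0.
  have fin : haar_outer (A n) \is a fin_num.
    by rewrite ge0_fin_numE ?haar_outer_ge0// ltey; apply/eqP/Aoo.
  have [_ [U [oU AU UG] <-] lt] := lb_ereal_inf_adherent en fin.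
  by exists U; split=> //; exact: ltW.
rewrite (@le_trans _ _ (\sum_(n <oo) haar_inner (U n)))//; last first.
  apply: lee_nneseries => n _; last by case: (hU n).
  by move=> *; exact: haar_inner_ge0.
rewrite (le_trans _ (haar_inner_bigcup _))//; last by move=> n; case: (hU n).
rewrite -haar_outer_open; last 2 first.
- by apply: bigcup_open => n _; case: (hU n).
- by move=> s [n _]; case: (hU n) => _ _ + _; exact.
apply: ereal_inf_le_tmp => _ [W [oW UW WG] <-]; exists W => //; split=> //.
move=> s [[n _ As] Gs]; apply: UW; split=> //; exists n => //.
by case: (hU n) => _ + _ _; apply.
Qed.

Definition haar_outer_measure : {outer_measure set B -> \bar R} :=
  HB.pack haar_outer (isOuterMeasure.Build R B haar_outer haar_outer0
    haar_outer_ge0 le_haar_outer haar_outer_sigma_subadditive).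

(** Let [W] be open around [A]. A compact open [V] inside the intersection of [W] and [U] is also
    closed, so [W] minus [V] is open; it contains the part of [A] outside [U]. Additivity of the
    content bounds the sum of the two by the value of [W], and [V] then exhausts the
    intersection. *)
Lemma open_caratheodory (U : set X) : open U ->
  haar_outer_measure.-caratheodory (U : set B).
Proof.
move=> oU; apply: le_caratheodory_measurable => A.
apply: le_ereal_inf_tmp => _ [W [oW AW WG] <-].
have hl V : copen V -> V `<=` W `&` U ->
    (content V)%:E + haar_outer (A `&` ~` U) <= haar_inner W.
  move=> cV VWU.
  have oD : open (W `\` V : set X).
    by apply: openI => //; case: cV => F fV; exact: (frame_openC gp fV).
  have DG : W `\` V `<=` G by move=> s [/WG].
  rewrite (@le_trans _ _ ((content V)%:E + haar_inner (W `\` V)))//.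
    rewrite leeD2l// -haar_outer_open//.
    apply: ereal_inf_le_tmp => _ [Z [oZ DZ ZG] <-]; exists Z => //; split=> //.
    move=> s [[As nU] Gs]; apply: DZ; split=> //; split; first exact: AW.
    by move=> /VWU[].
  rewrite -leeBrDl//; apply: ge_ereal_sup => _ [V' [cV' V'D] <-].
  have VV' : V `&` V' = set0.
    by apply/seteqP; split=> // s [Vs /V'D[]].
  have [cU cE] := contentU (R := R) gp hp cV cV' VV'.
  rewrite leeBrDl// -EFinD -cE; apply: haar_inner_ub => // s [/VWU[]|/V'D[]]//.
have oWU : open (W `&` U : set X) by exact: openI.
have AU : haar_outer (A `&` U) <= haar_inner (W `&` U).
  rewrite -haar_outer_open//; last by move=> s [/WG].
  apply: ereal_inf_le_tmp => _ [Z [oZ DZ ZG] <-]; exists Z => //; split=> //.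
  by move=> s [[As Us] Gs]; apply: DZ; split=> //; split=> //; exact: AW.
rewrite (le_trans (leeD2r _ AU))//.
have [Woo|Wfin] := eqVneq (haar_inner W) +oo; first by rewrite Woo leey.
have o0 : haar_outer (A `&` ~` U) \is a fin_num.
  rewrite ge0_fin_numE ?haar_outer_ge0//; apply: le_lt_trans (_ : haar_inner W < _).
    apply: le_trans (hl _ copen0 _); last by [].
    by rewrite content0 add0e.
  by rewrite ltey.
rewrite -leeBrDr//; apply: ge_ereal_sup => _ [V [cV VWU] <-].
by rewrite leeBrDr//; exact: hl.
Qed.

Lemma measurable_caratheodory (A : set B) : measurable A ->
  haar_outer_measure.-caratheodory A.
Proof.
suff : @measurable _ B `<=` haar_outer_measure.-cara.-measurable by exact.
apply: smallest_sub; last by move=> U oU; exact: open_caratheodory.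
split; [exact: caratheodory_measurable_set0| |exact: caratheodory_measurable_bigcup].
by move=> A' mA'; rewrite setTD; exact: caratheodory_measurable_setC.
Qed.

Lemma haar_sigma_additive : semi_sigma_additive (haar_outer : set B -> \bar R).
Proof.
move=> A mA tA mU.
apply: (@caratheodory_measure_sigma_additive R B haar_outer_measure A) => //.
- by move=> n; exact: measurable_caratheodory.
- exact: measurable_caratheodory.
Qed.

Definition haar_measure : {measure set B -> \bar R} :=
  HB.pack haar_outer (isMeasure.Build _ B R haar_outer haar_outer0
    haar_outer_ge0 haar_sigma_additive).

Lemma haar_outer_mulr_le (A : set X) x : A `<=` G -> G x ->
  haar_outer [set gm a x | a in A] <= haar_outer A.
Proof.
move=> AG Gx; have Gvx := g_inv gG Gx.
apply: le_ereal_inf_tmp => _ [U [oU AU UG] <-].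
pose V : set X := (fun s => gm s (gi x)) @^-1` U.
have oV : open V by apply: (continuousP _).1 => //; exact: (mulr_continuous gp).
have VG : V `<=` G.
  by move=> s /UG Gs; rewrite -(gmulKV gG s Gx); exact: (g_mul gG).
apply: (@le_trans _ _ (haar_inner V)).
  apply: ereal_inf_lbound; exists V => //; split=> // _ [[a Aa <-] Gax].
  by rewrite /V /= (gmulK gG a Gx); apply: AU; split=> //; exact: AG.
apply: ge_ereal_sup => _ [W [cW WV] <-].
have [cWx <-] := copen_mulr (R := R) gp hp Gvx cW.
by apply: haar_inner_ub => // _ [w /WV ? <-].
Qed.

Lemma haar_outer_mulr (A : set X) x : A `<=` G -> G x ->
  haar_outer [set gm a x | a in A] = haar_outer A.
Proof.
move=> AG Gx; apply/eqP; rewrite eq_le haar_outer_mulr_le//=.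
have E : A = [set gm a (gi x) | a in [set gm a x | a in A]].
  apply/seteqP; split=> [a Aa|_ [_ [a Aa <-] <-]].
    by exists (gm a x); [exists a|rewrite (gmulK gG a Gx)].
  by rewrite (gmulK gG a Gx).
rewrite {1}E; apply: haar_outer_mulr_le; last exact: (g_inv gG).
by move=> _ [a Aa <-]; apply: (g_mul gG) => //; exact: AG.
Qed.

Lemma copenU V W : copen V -> copen W -> copen (V `|` W).
Proof.
move=> cV cW; have cD := copenD gp hp cW cV.
have [+ _] := contentU (R := R) gp hp cV cD (setDIK _ _).
suff -> : V `|` (W `\` V) = V `|` W by [].
by apply/seteqP; split=> s; [move=> [|[]]; [left|right]|
  move=> [|Ws]; [left|have [|] := pselect (V s); [left|right]]].
Qed.

Lemma copen_bigcup (D : set (set X)) : finite_set D -> (forall C, D C -> copen C) ->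
  copen (\bigcup_(C in D) C).
Proof.
move=> /finite_seqP[s ->] cD; have {}cD : forall C, C \in s -> copen C by [].
elim: s cD => [|C s IH] cD.
  rewrite (_ : \bigcup_(_ in _) _ = set0); first exact: copen0.
  by apply/seteqP; split=> // x [].
rewrite (_ : \bigcup_(C in [set` C :: s]) C = C `|` \bigcup_(C in [set` s]) C).
  apply: copenU; first by apply: cD; exact: mem_head.
  by apply: IH => C' hC'; apply: cD; rewrite inE hC' orbT.
apply/seteqP; split=> x.
  by move=> [C' /=]; rewrite inE => /orP[/eqP->|hC'] Cx; [left|right; exists C'].
move=> [Cx|[C' /= hC' Cx]]; first by exists C => //=; exact: mem_head.
by exists C' => //=; rewrite inE hC' orbT.
Qed.

Lemma haar_measure_right_haar : right_haar haar_measure.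
Proof.
split.
- by move=> A mA AG g Gg; exact: haar_outer_mulr.
- move=> A cA AG; have fin := compact_rcosets gp [:: H] cA AG.
  have cV : copen (\bigcup_(C in [set rcoset gm (N [:: H]) x | x in A]) C).
    apply: copen_bigcup => // _ [x Ax <-]; exists [:: H].
    by apply: (frame_rcoset gp); [exact: mem_head|exact: AG].
  apply: (@le_lt_trans _ _ (haar_outer (\bigcup_(C in [set rcoset gm (N [:: H]) x | x in A]) C))).
    apply: le_haar_outer => s As; exists (rcoset gm (N [:: H]) s); first by exists s.
    exact: (rcoset_refl gG (sN _)).
  by rewrite haar_outer_copen// ltry.
- move=> U oU UG [s Us]; have [V cV [Vs VU]] := open_copen gp oU UG Us.
  rewrite /haar_measure /= haar_outer_open//.
  apply: lt_le_trans (haar_inner_ub cV VU).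
  by rewrite lte_fin (content_gt0 gp hp cV Vs).
- move=> A mA AG; rewrite /haar_measure /=; congr ereal_inf.
  apply/seteqP; split=> [_ [U [oU AU UG] <-]|_ [U [oU AU UG] <-]].
    exists U; last by rewrite haar_outer_open.
    by split=> // s As; apply: AU; split=> //; exact: AG.
  exists U; last by rewrite haar_outer_open.
  by split=> // s [/AU].
- move=> U oU UG; rewrite /haar_measure /=; apply/eqP; rewrite eq_le; apply/andP; split.
    rewrite haar_outer_open//; apply: ereal_sup_le => _ [V [cV VU] <-].
    exists V; last by rewrite haar_outer_copen.
    by split=> //; exact: (copen_compact gp hp).
  by apply: ge_ereal_sup => _ [C [cC CU] <-]; exact: le_haar_outer.
Qed.

End HaarMeasure.

(** * From the pair to the group *)

Section FiniteSums.
Context {R : realType} {I : Type}.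

Lemma sum_cauchy_schwarz (r : seq I) (P Q : I -> R) :
  (\sum_(i <- r) P i * Q i) ^+ 2 <=
  (\sum_(i <- r) P i ^+ 2) * (\sum_(i <- r) Q i ^+ 2).
Proof.
set t := \sum_(i <- r) P i * Q i; set u := \sum_(i <- r) P i ^+ 2.
set v := \sum_(i <- r) Q i ^+ 2.
have v0 : 0 <= v by apply: sumr_ge0 => i _; exact: sqr_ge0.
have u0 : 0 <= u by apply: sumr_ge0 => i _; exact: sqr_ge0.
have quad x y : 0 <= x ^+ 2 * u + 2 * x * y * t + y ^+ 2 * v.
  rewrite /u /t /v !mulr_sumr -!big_split /=; apply: sumr_ge0 => i _.
  rewrite (_ : _ + _ = (x * P i + y * Q i) ^+ 2) ?sqr_ge0//; ring.
have [v1|v1] := ltP 0 v.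
  (* At this point the form takes the value [v (u v - t^2)]. *)
  have := quad v (- t).
  rewrite (_ : _ + _ = v * (u * v - t ^+ 2)); last by ring.
  by rewrite pmulr_rge0// subr_ge0.
have {v0 v1}v0 : v = 0 by apply/eqP; rewrite eq_le v0 v1.
(* For [v = 0] the form at this point is [- t^2 (u + 2)], which forces [t = 0]. *)
have := quad (- t) (u + 1); rewrite v0 !mulr0 addr0 => h.
have : 0 <= - t ^+ 2 * (u + 2).
  by apply: le_trans h _; rewrite le_eqVlt; apply/orP; left; apply/eqP; ring.
by rewrite pmulr_lge0 ?ltr_wpDl// oppr_ge0.
Qed.

Lemma minkowski_add (r : seq I) (P Q : I -> R) (p q : R) : 0 <= p -> 0 <= q ->
  \sum_(i <- r) P i ^+ 2 <= p ^+ 2 -> \sum_(i <- r) Q i ^+ 2 <= q ^+ 2 ->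
  \sum_(i <- r) (P i + Q i) ^+ 2 <= (p + q) ^+ 2.
Proof.
move=> p0 q0 hP hQ.
have pq : \sum_(i <- r) P i * Q i <= p * q.
  apply: (le_trans (ler_norm _)).
  rewrite -(ger0_norm (mulr_ge0 p0 q0)) -ler_sqr ?nnegrE// !real_normK ?num_real//.
  rewrite exprMn (le_trans (sum_cauchy_schwarz _ _ _))//.
  by apply: ler_pM => //; apply: sumr_ge0 => i _; exact: sqr_ge0.
have -> : \sum_(i <- r) (P i + Q i) ^+ 2 = \sum_(i <- r) P i ^+ 2 +
    2 * (\sum_(i <- r) P i * Q i) + \sum_(i <- r) Q i ^+ 2.
  by rewrite mulr_sumr -!big_split /=; apply: eq_bigr => i _; ring.
rewrite (_ : (p + q) ^+ 2 = p ^+ 2 + 2 * (p * q) + q ^+ 2); last by ring.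
by rewrite !lerD// ler_pM2l.
Qed.

(** The norms are replaced by upper bounds [p j], so that no square root occurs and the induction on
    [s] reduces to two terms. *)
Lemma sum_minkowski {J : Type} (r : seq I) (s : seq J) (P : J -> I -> R)
    (p : J -> R) : (forall j, 0 <= p j) ->
  (forall j, \sum_(i <- r) P j i ^+ 2 <= p j ^+ 2) ->
  \sum_(i <- r) (\sum_(j <- s) P j i) ^+ 2 <= (\sum_(j <- s) p j) ^+ 2.
Proof.
move=> p0 hP; elim: s => [|j s IH].
  by rewrite big_nil expr0n big1// => i _; rewrite big_nil expr0n.
rewrite big_cons (eq_bigr (fun i => (P j i + \sum_(j0 <- s) P j0 i) ^+ 2)); last first.
  by move=> i _; rewrite big_cons.
by apply: minkowski_add => //; exact: sumr_ge0.
Qed.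

End FiniteSums.

Section IntegralBounds.
Context {d} {T : measurableType d} {R : realType} (mu : {measure set T -> \bar R}).
Local Open Scope ereal_scope.

Lemma sq_integral_le (D : set T) (b : T -> R) (m : R) : measurable D ->
  (0 < m)%R -> mu D = m%:E -> measurable_fun D b ->
  (forall x, D x -> (0 <= b x)%R) ->
  \int[mu]_(x in D) ((b x) ^+ 2)%:E < +oo ->
  exists2 i : R, \int[mu]_(x in D) (b x)%:E = i%:E &
    (i ^+ 2)%:E <= m%:E * \int[mu]_(x in D) ((b x) ^+ 2)%:E.
Proof.
move=> mD m0 muD mb b0 Jfin.
have mb2 : measurable_fun D (fun x => (b x ^+ 2)%R) by exact: measurable_funX.
have J0 : 0 <= \int[mu]_(x in D) ((b x) ^+ 2)%:E.
  by apply: integral_ge0 => x _; rewrite lee_fin sqr_ge0.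
have I0 : 0 <= \int[mu]_(x in D) (b x)%:E.
  by apply: integral_ge0 => x /b0; rewrite lee_fin.
(* This is [2 t b <= t^2 + b^2] integrated over [D]. The choice [t = 1] shows that the integral [i]
   of [b] is finite; [t = i / m] is the optimal choice and yields the estimate. *)
have quad (t : R) : (0 <= t)%R -> (2 * t)%:E * \int[mu]_(x in D) (b x)%:E <=
    (t ^+ 2 * m)%:E + \int[mu]_(x in D) ((b x) ^+ 2)%:E.
  move=> t0; have h1 x : D x -> 0 <= (b x)%:E by move=> /b0; rewrite lee_fin.
  have h2 : measurable_fun D (fun x => (b x)%:E) by exact/measurable_EFinP.
  have h3 x : D x -> 0 <= (b x ^+ 2)%:E by rewrite lee_fin sqr_ge0.
  have h4 : measurable_fun D (fun x => (b x ^+ 2)%:E) by exact/measurable_EFinP.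
  have h5 : (0 <= 2 * t)%R by rewrite mulr_ge0.
  have h6 x : D x -> 0 <= cst (t ^+ 2)%:E x by rewrite lee_fin sqr_ge0.
  rewrite -ge0_integralZl_EFin// (EFinM (t ^+ 2)) -muD -integral_cst// -ge0_integralD//.
  apply: le_integral_ge0 => x /b0 bx; rewrite -EFinM !lee_fin; split.
    by rewrite !mulr_ge0.
  by rewrite -subr_ge0 (_ : _ - _ = (t - b x) ^+ 2)%R ?sqr_ge0//; ring.
move: J0 Jfin quad; case: (\int[mu]_(x in D) ((b x) ^+ 2)%:E) => // j j0 _ quad.
have := quad 1%R ler01; move: I0 quad.
case: (\int[mu]_(x in D) (b x)%:E) => [i i0 quad _|_ quad|//]; last first.
  by rewrite gt0_muley ?lte_fin.
exists i => //; rewrite lee_fin in i0.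
have := quad (i / m)%R (divr_ge0 i0 (ltW m0)); rewrite -!EFinM !lee_fin => h.
rewrite -subr_ge0 -(pmulr_rge0 _ (_ : 0 < m^-1)%R) ?invr_gt0//.
have {}h : (0 <= (i / m) ^+ 2 * m + j - 2 * (i / m) * i)%R by rewrite subr_ge0.
apply: le_trans h _; rewrite le_eqVlt; apply/orP; left; apply/eqP; field.
exact: lt0r_neq0.
Qed.

(** By monotonicity alone the positive and the negative part of [g] have integrals in [[0, t]], so
    their difference lies in [[-t, t]]. *)
Lemma normr_Rintegral_le (D : set T) (g h : T -> R) (t : R) :
  (forall x, D x -> (`|g x| <= h x)%R) -> \int[mu]_(x in D) (h x)%:E = t%:E ->
  (`|Rintegral mu D g| <= t)%R.
Proof.
move=> gh ht; rewrite /Rintegral integralE.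
have hp : \int[mu]_(x in D) (EFin \o g)^\+ x <= t%:E.
  rewrite -ht; apply: le_integral_ge0 => x Dx; split=> //.
  rewrite funeposE -EFin_max lee_fin ge_max (le_trans (ler_norm _) (gh x Dx)).
  by rewrite (le_trans (normr_ge0 (g x)) (gh x Dx)).
have hn : \int[mu]_(x in D) (EFin \o g)^\- x <= t%:E.
  rewrite -ht; apply: le_integral_ge0 => x Dx; split=> //.
  rewrite funenegE -EFin_max lee_fin ge_max.
  rewrite (le_trans (ler_norm _))/= ?normrN ?gh//.
  by rewrite (le_trans (normr_ge0 (g x)) (gh x Dx)).
have p0 : 0 <= \int[mu]_(x in D) (EFin \o g)^\+ x by apply: integral_ge0.
have n0 : 0 <= \int[mu]_(x in D) (EFin \o g)^\- x by apply: integral_ge0.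
move: hp hn p0 n0; case: (\int[mu]_(x in D) (EFin \o g)^\+ x) => // p.
case: (\int[mu]_(x in D) (EFin \o g)^\- x) => // n.
rewrite !lee_fin /= => hp hn p0 n0; rewrite ler_norml; lra.
Qed.
End IntegralBounds.

(** * Domination by functions bi-invariant under an open subgroup *)

Section UniformApproximation.
Context {R : realType} {gT : pointedType} (mul : gT -> gT -> gT)
  (inv : gT -> gT) (e : gT) (H : set gT).
Hypothesis gp : is_group mul inv e.
Hypothesis hp : hecke_pair mul inv e setT H.

Local Notation X := (GbarT mul H).
Local Notation B := (GbarB mul H).
Local Notation G := (Gbar mul H).
Local Notation K := (Hbar mul H).
Local Notation gm := (@smul gT mul H).
Local Notation gi := (@sinv gT mul H).
Local Notation g1 := (@sone gT mul H).
Local Notation N F := (@stab gT mul H F).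
Let gG : group_on gm gi g1 G := group_on_Gbar H gp.
Let sN F : is_subgroup gm gi g1 G (N F) := sub_stab H gp F.
Let sK : is_subgroup gm gi g1 G K := sub_Hbar gp hp.
Let KE : K = N [:: H] := HbarE gp hp.

Lemma continuous_measurable (f : X -> R) : continuous (f : X -> R^o) ->
  measurable_fun (G : set B) f.
Proof.
move=> cf; apply: (measurability _ (RGenOpens.measurableE R)) => _ [_ [a [b ->]] <-].
apply: open_measurable; apply: openI; first exact: open_subspaceT.
by move/continuousP : cf; apply; exact: interval_open.
Qed.

(** Inversion exchanges the two neighbourhood bases of [open_GbarP] and [open_GbarPr], which define
    the same topology. *)
Lemma sinv_continuous : continuous (gi : X -> X).
Proof.
apply/continuousP => U oU; apply/(open_GbarPr gp) => s Gs Us.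
have [F hF] := (open_GbarP (mul := mul) (H := H) U).1 oU _ (g_inv gG Gs) Us.
exists F => t /(stabP gp F t Gs)[Gt ht]; apply: hF => //; exact: (g_inv gG).
Qed.

Lemma uniform_left (f : X -> R) (C : set X) (eps : R) :
  continuous (f : X -> R^o) -> compact C -> C `<=` G -> 0 < eps ->
  exists F, forall x n, C x -> N F n -> `|f (gm n x) - f x| <= eps.
Proof.
move=> cf cC CG e0.
pose P (A : set X) := forall s t, A s -> A t -> `|f s - f t| <= eps.
have [|s Cs|F hF] := lebesgue_rcoset gp cC CG (P := P).
- by move=> A A' AA' hA s t /AA' ? /AA' ?; exact: hA.
- have Gs := CG _ Cs.
  have oU : open ((f : X -> R^o) @^-1` ball (f s) (eps / 2)).
    by move/continuousP : cf; apply; exact: ball_open.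
  have [|F hF] := (open_GbarPr gp _).1 oU s Gs.
    by rewrite /preimage /=; apply: ballxx; rewrite divr_gt0.
  exists F => t t' /hF ht /hF ht'; move: ht ht'; rewrite /preimage /= /ball /= => ht ht'.
  rewrite (_ : f t - f t' = (f s - f t') - (f s - f t)); last by ring.
  by rewrite (le_trans (ler_normB _ _))// (splitr eps) lerD// ltW.
exists F => x n Cx Nn; apply: (hF x Cx); first by exists n.
exact: (rcoset_refl gG (sN F)).
Qed.

(** The set [K C K]: outside it the approximating functions can be set to 0 without losing
    invariance on either side. *)
Definition Ksat (C : set X) : set X :=
  [set s | G s /\ exists k k', [/\ K k, K k' & C (gm (gm k s) k')]].

Lemma Ksat_sub (C : set X) : C `<=` G -> C `<=` Ksat C.
Proof.
move=> CG s Cs; split; first exact: CG.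
by exists g1, g1; split; [exact: (sub_one sK)|exact: (sub_one sK)|].
Qed.

Lemma Ksat_left (C : set X) k s : K k -> G s -> Ksat C (gm k s) <-> Ksat C s.
Proof.
have imp k' s' : K k' -> G s' -> Ksat C s' -> Ksat C (gm k' s').
  move=> Kk Gs [_ [a [b [Ka Kb Cab]]]]; have Gk := sub_in sK Kk.
  split; first exact: (g_mul gG).
  exists (gm a (gi k')), b; split=> //.
    by apply: (sub_mul sK) => //; exact: (sub_inv sK).
  by rewrite (gmulA gG (gm a (gi k')) k' s') (gmulKV gG).
move=> Kk Gs; have Gk := sub_in sK Kk; split; last exact: imp.
by move=> /(imp (gi k) _ (sub_inv sK Kk) (g_mul gG Gk Gs)); rewrite (gmulKl gG s Gk).
Qed.

Lemma Ksat_right (C : set X) k s : K k -> G s -> Ksat C (gm s k) <-> Ksat C s.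
Proof.
have imp k' s' : K k' -> G s' -> Ksat C s' -> Ksat C (gm s' k').
  move=> Kk Gs [_ [a [b [Ka Kb Cab]]]]; have Gk := sub_in sK Kk.
  split; first exact: (g_mul gG).
  exists a, (gm (gi k') b); split=> //.
    by apply: (sub_mul sK) => //; exact: (sub_inv sK).
  by rewrite (gmul_mid gG a s' b Gk).
move=> Kk Gs; have Gk := sub_in sK Kk; split; last exact: imp.
by move=> /(imp (gi k) _ (sub_inv sK Kk) (g_mul gG Gs Gk)); rewrite (gmulK gG s Gk).
Qed.

Lemma Ksat_finite (C : set X) : compact C -> C `<=` G ->
  finite_set [set rcoset gm K s | s in Ksat C].
Proof.
move=> cC CG; have := compact_rcosets gp [:: H] cC CG; rewrite -KE => fin.
apply: (@sub_finite_set _ _ (\bigcup_(D in [set rcoset gm K x | x in C])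
   [set rcoset gm K (gm (gm (rep g1 D) k) g1) | k in (K : set X)])); last first.
  apply: bigcup_finite => // _ [x Cx <-].
  apply: (finite_double_coset gp hp); last exact: (g_one gG).
  by apply: (repG gG sK); apply: rcoset_in; exact: CG.
move=> _ [s [Gs [k [k' [Kk Kk' Cs]]]] <-]; set x := gm _ _ in Cs.
have Gx := CG _ Cs; have hD := rcoset_in gm K Gx.
exists (rcoset gm K x); first by exists x.
exists (gi k'); first exact: (sub_inv sK).
have Gk := sub_in sK Kk; have Gk' := sub_in sK Kk'; have Gr := repG gG sK hD.
have Gks := g_mul gG Gk Gs.
rewrite (gmulx1 gG); apply/esym/(rcoset_eq gG sK).
  by apply: (g_mul gG) => //; exact: (g_inv gG).
have [h Kh Eh] := rep_in gG sK hD; have Gh := sub_in sK Kh.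
exists (gi (gm h k)); first by apply: (sub_inv sK); exact: (sub_mul sK).
rewrite -Eh /x -(gmulA gG h) (gmulK gG _ Gk') (gmulA gG h k s).
exact: (gmulKl gG s (g_mul gG Gh Gk)).
Qed.

Lemma Ksat_compact (C : set X) : compact C -> C `<=` G -> compact (Ksat C).
Proof.
move=> cC CG; rewrite (_ : Ksat C = \bigcup_(D in [set rcoset gm K s | s in Ksat C]) D).
  apply: finite_bigcup_compact; first exact: Ksat_finite.
  by move=> _ [s [Gs _] <-]; exact: (rcoset_Hbar_compact gp hp).
apply/seteqP; split=> [s Ss|s [_ [t St <-] [k Kk <-]]].
  by exists (rcoset gm K s); [exists s|exact: (rcoset_refl gG sK)].
by apply/Ksat_left => //; case: St.
Qed.

Let DC F (x : X) : set X := [set y | exists n n', [/\ N F n, N F n' & y = gm (gm n x) n']].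

Let DC_left F k x : N F k -> G x -> DC F (gm k x) = DC F x.
Proof.
move=> Nk Gx; have Gk := sub_in (sN F) Nk; apply/seteqP; split=> _ [a [b [Na Nb ->]]].
  by exists (gm a k), b; split=> //; exact: (sub_mul (sN F)).
exists (gm a (gi k)), b; split=> //.
  by apply: (sub_mul (sN F)) => //; exact: (sub_inv (sN F)).
by rewrite (gmulA gG (gm a (gi k)) k x) (gmulKV gG).
Qed.

Let DC_right F k x : N F k -> G x -> DC F (gm x k) = DC F x.
Proof.
move=> Nk Gx; have Gk := sub_in (sN F) Nk; apply/seteqP; split=> _ [a [b [Na Nb ->]]].
  by exists a, (gm k b); split=> //; exact: (sub_mul (sN F)).
exists a, (gm (gi k) b); split=> //.
  by apply: (sub_mul (sN F)) => //; exact: (sub_inv (sN F)).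
by rewrite (gmul_mid gG a x b Gk).
Qed.

(** On each double coset of [N F] inside [K C K], [a] is the value of [f] at a chosen point plus
    [eps / 2]. For small [N F] any value of [f] on the double coset is within [eps / 2] of the
    chosen one, hence [f <= a <= f + eps]. *)
Lemma biinv_approx (f : X -> R) (C : set X) (eps : R) :
  continuous (f : X -> R^o) -> compact C -> C `<=` G ->
  (forall x, 0 <= f x) -> (forall x, G x -> ~ C x -> f x = 0) -> 0 < eps ->
  exists F, exists a : X -> R, [/\ H \in F,
    forall k x, N F k -> G x -> a (gm k x) = a x,
    forall k x, N F k -> G x -> a (gm x k) = a x,
    forall x, 0 <= a x &
    forall x, G x -> [/\ f x <= a x, Ksat C x -> a x <= f x + eps &
      ~ Ksat C x -> a x = 0]].
Proof.
move=> cf cC CG f0 fC e0; have e4 : 0 < eps / 4 by rewrite divr_gt0.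
have cS := Ksat_compact cC CG.
have SG : Ksat C `<=` G by move=> s [].
have [F1 hF1] := uniform_left cf cS SG e4.
(* Uniform continuity under right translation is obtained from that under left translation by
   passing to inverses. *)
have cfi : continuous (f \o gi : X -> R^o).
  by move=> x; apply: continuous_comp; [exact: sinv_continuous|exact: cf].
have cSi : compact (gi @` Ksat C).
  apply: continuous_compact => //; apply: continuous_subspaceT; exact: sinv_continuous.
have SiG : gi @` Ksat C `<=` G by move=> _ [s [Gs _] <-]; exact: (g_inv gG).
have [F2 hF2] := uniform_left cfi cSi SiG e4.
pose F := H :: F1 ++ F2.
have NK : N F `<=` K by apply: (stab_sub_Hbar gp hp); exact: mem_head.
have N1 : N F `<=` N F1.
  by apply: stab_sub => D hD; rewrite inE mem_cat hD orbT.
have N2 : N F `<=` N F2.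
  by apply: stab_sub => D hD; rewrite inE mem_cat hD !orbT.
have osc x n n' : Ksat C x -> N F n -> N F n' ->
    `|f (gm (gm n x) n') - f x| <= eps / 2.
  move=> Sx Nn Nn'; have Gx := SG _ Sx.
  have Gn := sub_in (sN F) Nn; have Gn' := sub_in (sN F) Nn'.
  have Sxn : Ksat C (gm x n') by apply/Ksat_right => //; exact: NK.
  have h1 := hF1 _ _ Sxn (N1 _ Nn).
  have Six : (gi @` Ksat C) (gi x) by exists x.
  have := hF2 _ _ Six (N2 _ (sub_inv (sN F) Nn')); rewrite /=.
  rewrite (ginvM gG (g_inv gG Gn') (g_inv gG Gx)) (ginvK gG Gx) (ginvK gG Gn') => h2.
  rewrite -(gmulA gG n x n').
  rewrite (_ : _ - f x = (f (gm n (gm x n')) - f (gm x n')) + (f (gm x n') - f x)); last by ring.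
  by rewrite (le_trans (ler_normD _ _))// (le_trans (lerD h1 h2))//; lra.
have rP x : DC F x (xget g1 (DC F x)).
  apply: xgetPex; exists (gm (gm g1 x) g1), g1, g1.
  by split; [exact: (sub_one (sN F))|exact: (sub_one (sN F))|].
exists F, (fun x => if `[< Ksat C x >] then f (xget g1 (DC F x)) + eps / 2 else 0).
split; first exact: mem_head.
- move=> k x Nk Gx; rewrite DC_left//.
  by rewrite (asbool_equiv_eq (Ksat_left C (NK _ Nk) Gx)).
- move=> k x Nk Gx; rewrite DC_right//.
  by rewrite (asbool_equiv_eq (Ksat_right C (NK _ Nk) Gx)).
- by move=> x; case: asboolP => // _; rewrite addr_ge0// divr_ge0// ltW.
- move=> x Gx; case: asboolP => Sx; split=> //.
  + have [n [n' [Nn Nn' ->]]] := rP x; have := osc _ _ _ Sx Nn Nn'.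
    by rewrite ler_norml => /andP[h1 h2]; lra.
  + move=> _; have [n [n' [Nn Nn' ->]]] := rP x; have := osc _ _ _ Sx Nn Nn'.
    by rewrite ler_norml => /andP[h1 h2]; lra.
  + by rewrite fC// => /(Ksat_sub CG).
Qed.

End UniformApproximation.

(** * Integrals over [Hbar] as sums over representatives of the cosets of [N F] *)

Section Transversal.
Context {R : realType} {gT : pointedType} (mul : gT -> gT -> gT)
  (inv : gT -> gT) (e : gT) (H : set gT).
Hypothesis gp : is_group mul inv e.
Hypothesis hp : hecke_pair mul inv e setT H.

Local Notation X := (GbarT mul H).
Local Notation B := (GbarB mul H).
Local Notation G := (Gbar mul H).
Local Notation K := (Hbar mul H).
Local Notation gm := (@smul gT mul H).
Local Notation gi := (@sinv gT mul H).
Local Notation g1 := (@sone gT mul H).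
Local Notation N F := (@stab gT mul H F).
Let gG : group_on gm gi g1 G := group_on_Gbar H gp.
Let sN F : is_subgroup gm gi g1 G (N F) := sub_stab H gp F.
Let sK : is_subgroup gm gi g1 G K := sub_Hbar gp hp.
Let KE : K = N [:: H] := HbarE gp hp.

Variables (mu : {measure set B -> \bar R}) (F : seq (set gT)) (ks : seq X) (m : R).
Hypothesis hm : right_haar mu.
Hypothesis HF : H \in F.
Hypothesis ks_uniq : uniq ks.
Hypothesis ks_K : forall k, k \in ks -> K k.
Hypothesis ks_cov : forall k, K k -> exists2 k', k' \in ks & rcoset gm (N F) k' k.
Hypothesis ks_inj : forall k k' x, k \in ks -> k' \in ks ->
  rcoset gm (N F) k x -> rcoset gm (N F) k' x -> k = k'.
Hypothesis m0 : 0 < m.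
Hypothesis mE : mu (N F) = m%:E.

Let ksG k : k \in ks -> G k. Proof. by move=> /ks_K/(sub_in sK). Qed.

(** Right multiplication by [k0] permutes the right cosets of [N F] in [K]; [sg] is the induced
    permutation of the representatives. *)
Lemma transversal_sum (phi : X -> R) k0 z :
  (forall n y, N F n -> G y -> phi (gm n y) = phi y) -> K k0 -> G z ->
  \sum_(k <- ks) phi (gm k (gm k0 z)) = \sum_(k <- ks) phi (gm k z).
Proof.
move=> phiN Kk0 Gz; have Gk0 := sub_in sK Kk0.
have /choice[sg hsg] : forall k, exists k', k \in ks ->
    k' \in ks /\ rcoset gm (N F) k' (gm k k0).
  move=> k; have [ksk|nk] := boolP (k \in ks); last by exists k => h; case/negP: nk.
  have [k' ksk' h] := ks_cov (sub_mul sK (ks_K ksk) Kk0).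
  by exists k'.
have E k : k \in ks -> phi (gm k (gm k0 z)) = phi (gm (sg k) z).
  move=> ksk; have [ks' [n Nn En]] := hsg k ksk.
  rewrite (gmulA gG k k0 z) -En -(gmulA gG n (sg k) z) phiN//.
  by apply: (g_mul gG) => //; exact: ksG.
rewrite (eq_big_seq _ E) -(big_map sg xpredT (fun k => phi (gm k z))).
have us : uniq (map sg ks).
  rewrite map_inj_in_uniq// => k1 k2 ks1 ks2 E12.
  have [ks' [n1 Nn1 En1]] := hsg _ ks1; have [_ [n2 Nn2 En2]] := hsg _ ks2.
  have inN k n : k \in ks -> N F n -> gm n (sg k1) = gm k k0 ->
      rcoset gm (N F) k (gm (sg k1) (gi k0)).
    move=> ksk Nn En; have Gn := sub_in (sN F) Nn.
    exists (gi n); first exact: (sub_inv (sN F)).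
    apply: (gmul_injl gG Gn); rewrite (gmulVKl gG k Gn) (gmulA gG n (sg k1) (gi k0)) En.
    by rewrite (gmulK gG k Gk0).
  apply: (ks_inj ks1 ks2); first exact: inN En1.
  by apply: inN Nn2 _ => //; rewrite E12.
have sub : {subset map sg ks <= ks}.
  by move=> _ /mapP[k ksk ->]; case: (hsg k ksk).
apply: perm_big; apply: uniq_perm => //.
by have [] := uniq_min_size us sub; rewrite ?size_map.
Qed.

Lemma integral_transversal (f : X -> \bar R) y : measurable_fun (G : set B) f ->
  (forall x, G x -> (0 <= f x)%E) -> G y ->
  (\int[mu]_(x in rcoset gm K y) f x =
   \sum_(k <- ks) \int[mu]_(x in rcoset gm (N F) (gm k y)) f x)%E.
Proof.
move=> mf f0 Gy.
pose D (k : X) : set B := if k \in ks then rcoset gm (N F) (gm k y) else set0.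
have mD k : measurable (D k).
  rewrite /D; case: ifPn => // ksk; apply: (measurable_rcoset gp).
  by apply: (g_mul gG) => //; exact: ksG.
have DU : rcoset gm K y = \big[setU/set0]_(k <- ks) D k.
  rewrite -bigcup_seq; apply/seteqP; split=> [_ [k Kk <-]|z [k /= ksk]].
    have [k' ksk' [n Nn En]] := ks_cov Kk; exists k' => //=.
    by rewrite /D ksk'; exists n => //; rewrite (gmulA gG n k' y) En.
  rewrite /D ksk => -[n Nn <-]; exists (gm n k); last by rewrite (gmulA gG n k y).
  by apply: (sub_mul sK); [exact: (stab_sub_Hbar gp hp HF)|exact: ks_K].
rewrite DU (@ge0_integral_bigsetU _ B R mu X D)//.
- by apply: eq_big_seq => k ksk; rewrite /D ksk.
- move=> k k' /= ksk ksk' [z []]; rewrite /D ksk ksk' => -[n Nn <-] [n' Nn' E].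
  apply: (@ks_inj k k' (gm n k)) => //; first by exists n.
  exists n' => //; apply: (gmul_injr gG Gy).
  by rewrite -(gmulA gG n' k' y) E (gmulA gG n k y).
- rewrite -DU; apply: measurable_funS mf; first exact: measurable_Gbar.
  exact: (rcoset_sub gG sK).
- by rewrite -DU => z /(rcoset_sub gG sK Gy)/f0.
Qed.

Lemma haar_Hbar_transversal : mu K = ((size ks)%:R * m)%:E.
Proof.
have -> : mu K = (\int[mu]_(x in rcoset gm K g1) cst 1 x)%E.
  rewrite integral_cst; last by rewrite KE; apply: (measurable_rcoset gp); exact: (g_one gG).
  by rewrite mul1e {2}KE (haar_rcoset gp hm _ (g_one gG)) -KE.
rewrite integral_transversal//; last exact: (g_one gG).
rewrite (eq_big_seq (fun=> m%:E)); last first.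
  move=> k ksk; have Gk : G (gm k g1) by rewrite (gmulx1 gG); exact: ksG.
  by rewrite integral_cst ?mul1e ?(haar_rcoset gp hm _ Gk)//; exact: (measurable_rcoset gp).
by rewrite sumEFin big_const_seq count_predT iter_addr_0 mulr_natl.
Qed.

Lemma integral_transversal_inv (f : X -> R) y :
  (forall n z, N F n -> G z -> f (gm n z) = f z) ->
  (forall x, G x -> 0 <= f x) -> G y ->
  (\int[mu]_(x in rcoset gm K y) (f x)%:E = (m * \sum_(k <- ks) f (gm k y))%:E)%E.
Proof.
move=> fN f0 Gy; have mf : measurable_fun (G : set B) (EFin \o f).
  by apply/measurable_EFinP; exact: (left_inv_measurable gp fN).
rewrite (@integral_transversal (EFin \o f))// mulr_sumr -sumEFin; apply: eq_big_seq => k ksk.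
have Gky : G (gm k y) by apply: (g_mul gG) => //; exact: ksG.
rewrite (integral_rcoset gp hm (f := EFin \o f))//.
  by rewrite mE /= EFinM muleC.
by move=> n z Nn Gz; rewrite /= fN.
Qed.

(* Right translation by [j] in [K] permutes the right cosets of [K]. *)
Lemma integral_mulr_Hbar (f : X -> R) j :
  (forall n z, N F n -> G z -> f (gm n z) = f z) ->
  (forall x, G x -> 0 <= f x) -> K j ->
  (\esum_(C in rcosets gm G K) \int[mu]_(x in rcoset gm K (gm (rep g1 C) j)) (f x)%:E =
   \int[mu]_(x in G) (f x)%:E)%E.
Proof.
move=> fN f0 Kj; have Gj := sub_in sK Kj.
rewrite (integral_left_inv gp hp hm HF fN f0).
pose Phi (C : set X) := rcoset gm K (gm (rep g1 C) j).
apply/esym/(reindex_esum (rcosets gm G K) (rcosets gm G K) Phi); split.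
- move=> C hC; apply: rcoset_in; apply: (g_mul gG) => //; exact: (repG gG sK).
- move=> C C' /set_mem hC /set_mem hC' E.
  have Gr := repG gG sK hC; have Gr' := repG gG sK hC'.
  have [k Kk Ek] : Phi C' (gm (rep g1 C) j).
    by rewrite -E; exact: (rcoset_refl gG sK).
  rewrite -(rcoset_rep gG sK hC) -(rcoset_rep gG sK hC').
  apply: (rcoset_eq gG sK Gr'); exists k => //.
  by apply: (gmul_injr gG Gj); rewrite -(gmulA gG k (rep g1 C') j).
- move=> _ [x Gx ->]; have Gxj := g_mul gG Gx (g_inv gG Gj).
  have hC := rcoset_in gm K Gxj; exists (rcoset gm K (gm x (gi j))) => //.
  apply: (rcoset_eq gG sK Gx); have [k Kk <-] := rep_in gG sK hC.
  by exists k => //; rewrite -(gmulA gG k _ j) (gmulKV gG x Gj).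
Qed.

End Transversal.

(** * The convolution bound for a kernel bi-invariant under [N F] *)

Section BiInvariantConvolution.
Context {R : realType} {gT : pointedType} (mul : gT -> gT -> gT)
  (inv : gT -> gT) (e : gT) (H : set gT).
Hypothesis gp : is_group mul inv e.
Hypothesis hp : hecke_pair mul inv e setT H.

Local Notation X := (GbarT mul H).
Local Notation B := (GbarB mul H).
Local Notation G := (Gbar mul H).
Local Notation K := (Hbar mul H).
Local Notation gm := (@smul gT mul H).
Local Notation gi := (@sinv gT mul H).
Local Notation g1 := (@sone gT mul H).
Local Notation N F := (@stab gT mul H F).
Let gG : group_on gm gi g1 G := group_on_Gbar H gp.
Let sN F : is_subgroup gm gi g1 G (N F) := sub_stab H gp F.
Let sK : is_subgroup gm gi g1 G K := sub_Hbar gp hp.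
Let KE : K = N [:: H] := HbarE gp hp.

Variables (mu : {measure set B -> \bar R}) (l : X -> R) (s c : R).
Hypothesis hm : right_haar mu.
Hypothesis ll : length_fun gm gi g1 G K l.
Hypothesis Hl : forall f, hecke_fun gm g1 G K f ->
  forall xi, left_K_inv gm G K xi -> (l2norm2 gm g1 G K xi < +oo)%E ->
    (l2norm2 gm g1 G K (conv_disc gm gi g1 G K f xi) <=
     (c ^+ 2)%:E * weighted_norm2 gm g1 G K l s f * l2norm2 gm g1 G K xi)%E.

Variables (F : seq (set gT)) (a b : X -> R) (S : set X).
Hypothesis HF : H \in F.
Hypothesis aL : forall n x, N F n -> G x -> a (gm n x) = a x.
Hypothesis aR : forall n x, N F n -> G x -> a (gm x n) = a x.
Hypothesis a_ge0 : forall x, 0 <= a x.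
Hypothesis SL : forall k x, K k -> G x -> S (gm k x) <-> S x.
Hypothesis SR : forall k x, K k -> G x -> S (gm x k) <-> S x.
Hypothesis Sfin : finite_set [set rcoset gm K x | x in S].
Hypothesis aS : forall x, G x -> ~ S x -> a x = 0.
Hypothesis mb : measurable_fun (G : set B) b.
Hypothesis b_ge0 : forall x, 0 <= b x.
Hypothesis bfin : (\int[mu]_(x in G) ((b x) ^+ 2)%:E < +oo)%E.

Let NK n : N F n -> K n. Proof. exact: (stab_sub_Hbar gp hp HF). Qed.

(** This is [hecke_finite_conv] for the indicator function of [S]. *)
Let conv_supp x : G x -> exists sx : seq (set X),
  [/\ uniq sx, [set` sx] `<=` rcosets gm G K &
   forall C, rcosets gm G K C -> C \notin sx -> ~ S (gm x (gi (rep g1 C)))].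
Proof.
move=> Gx; pose fS (u : X) : R[i] := if `[< S u >] then 1 else 0.
have fSn u : S u -> fS u != 0 by rewrite /fS; case: asboolP => // _ _; exact: oner_neq0.
have hf : hecke_fun gm g1 G K fS.
  split.
  - by move=> k z Kk Gz; rewrite /fS (asbool_equiv_eq (SL Kk Gz)).
  - by move=> k z Kk Gz; rewrite /fS (asbool_equiv_eq (SR Kk Gz)).
  - apply: sub_finite_set Sfin => C [hC]; rewrite /fS; case: asboolP => [Sr _|]; last by rewrite eqxx.
    by exists (rep g1 C) => //; exact: (rcoset_rep gG sK hC).
have /finite_seqP[s0 s0E] := hecke_finite_conv gp hp hf Gx.
exists (undup s0); split; first exact: undup_uniq.
  move=> C /=; rewrite mem_undup => Cs; have : [set` s0] C by [].
  by rewrite -s0E => -[].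
move=> C hC; rewrite mem_undup => /negP Cs SC; apply: Cs.
by suff : [set` s0] C by []; rewrite -s0E; split=> //; exact: fSn.
Qed.

Section WithTransversal.
Variables (ks : seq X) (m : R).
Hypothesis ks_uniq : uniq ks.
Hypothesis ks_K : forall k, k \in ks -> K k.
Hypothesis ks_cov : forall k, K k -> exists2 k', k' \in ks & rcoset gm (N F) k' k.
Hypothesis ks_inj : forall k k' x, k \in ks -> k' \in ks ->
  rcoset gm (N F) k x -> rcoset gm (N F) k' x -> k = k'.
Hypothesis m0 : 0 < m.
Hypothesis mE : mu (N F) = m%:E.

Let m_ge0 : 0 <= m. Proof. exact: ltW. Qed.

Let ksG k : k \in ks -> G k. Proof. by move=> /ks_K/(sub_in sK). Qed.

Let tsum := @transversal_sum R gT mul inv e H gp hp F ks ks_uniq ks_K ks_cov ks_inj.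
Let tint := integral_transversal gp hp mu HF ks_uniq ks_K ks_cov ks_inj.
Let tinv := integral_transversal_inv gp hp hm HF ks_uniq ks_K ks_cov ks_inj mE.

(** [b] has no invariance, so its values are replaced by its integrals [Bc] over the cosets of
    [N F]. [A] and [Bt] are the square averages over [K], as sums without the factor [m]. *)
Let Bc y : R := fine (\int[mu]_(x in rcoset gm (N F) y) (b x)%:E)%E.
Let A u : R := Num.sqrt (\sum_(i <- ks) \sum_(j <- ks) a (gm (gm i u) (gi j)) ^+ 2).
Let Bt y : R := Num.sqrt (\sum_(j <- ks) Bc (gm j y) ^+ 2).
Let Af u : R[i] := Complex (A u) 0.
Let Bf y : R[i] := Complex (Bt y) 0.

Let A2 u : A u ^+ 2 = \sum_(i <- ks) \sum_(j <- ks) a (gm (gm i u) (gi j)) ^+ 2.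
Proof.
by rewrite sqr_sqrtr//; apply: sumr_ge0 => i _; apply: sumr_ge0 => j _; exact: sqr_ge0.
Qed.

Let Bt2 y : Bt y ^+ 2 = \sum_(j <- ks) Bc (gm j y) ^+ 2.
Proof. by rewrite sqr_sqrtr//; apply: sumr_ge0 => j _; exact: sqr_ge0. Qed.

Let BcN n y : N F n -> G y -> Bc (gm n y) = Bc y.
Proof. by move=> Nn Gy; rewrite /Bc (rcoset_mull gG (sN F) Nn Gy). Qed.

Let mb2 : measurable_fun (G : set B) (fun x => (b x ^+ 2)%:E).
Proof. by apply/measurable_EFinP; exact: measurable_funX. Qed.

Let BcE y : G y ->
  (\int[mu]_(x in rcoset gm (N F) y) (b x)%:E = (Bc y)%:E /\
   (Bc y ^+ 2)%:E <= m%:E * \int[mu]_(x in rcoset gm (N F) y) ((b x) ^+ 2)%:E)%E.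
Proof.
move=> Gy; have mD : measurable (rcoset gm (N F) y : set B) by exact: (measurable_rcoset gp).
have DG := rcoset_sub gG (sN F) Gy.
have muD : mu (rcoset gm (N F) y) = m%:E by rewrite (haar_rcoset gp hm _ Gy).
have mbD : measurable_fun (rcoset gm (N F) y : set B) b.
  by apply: measurable_funS mb => //; exact: measurable_Gbar.
have fin : (\int[mu]_(x in rcoset gm (N F) y) ((b x) ^+ 2)%:E < +oo)%E.
  apply: le_lt_trans bfin; apply: ge0_subset_integral => //.
    exact: measurable_Gbar.
  by move=> x _; rewrite lee_fin sqr_ge0.
have [i iE hi] := sq_integral_le mD m0 muD mbD (fun x _ => b_ge0 x) fin.
by rewrite /Bc iE.
Qed.

Let A_left k u : K k -> G u -> A (gm k u) = A u.
Proof.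
move=> Kk Gu; congr Num.sqrt.
apply: (tsum (phi := fun z => \sum_(j <- ks) a (gm z (gi j)) ^+ 2)) => // n y Nn Gy.
apply: eq_big_seq => j jks; have Gvj := g_inv gG (ksG jks).
by rewrite -(gmulA gG n y (gi j)) aL//; exact: (g_mul gG).
Qed.

Let A_right k u : K k -> G u -> A (gm u k) = A u.
Proof.
move=> Kk Gu; congr Num.sqrt; rewrite exchange_big [RHS]exchange_big /=.
have Gk := sub_in sK Kk; have Gvk := g_inv gG Gk.
pose psi z := \sum_(i <- ks) a (gm (gm i u) (gi z)) ^+ 2.
(* Since [k j^-1] is the inverse of [j k^-1], right invariance is again a translation of the
   representatives; [g1] is inserted only to match the shape of [tsum]. *)
transitivity (\sum_(j <- ks) psi (gm j (gm (gi k) g1))).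
  apply: eq_big_seq => j jks; have Gj := ksG jks; rewrite (gmulx1 gG (gi k)) /psi.
  rewrite (ginvM gG Gj Gvk) (ginvK gG Gk); apply: eq_bigr => i _.
  by rewrite (gmulA gG i u k) (gmulA gG (gm i u) k (gi j)).
rewrite tsum.
- by apply: eq_bigr => j _; rewrite (gmulx1 gG j).
- move=> n y Nn Gy; have Gn := sub_in (sN F) Nn; have Gvy := g_inv gG Gy.
  apply: eq_big_seq => i iks; have Giu := g_mul gG (ksG iks) Gu.
  rewrite (ginvM gG Gn Gy) (gmulA gG (gm i u) (gi y) (gi n)) aR//.
    exact: (sub_inv (sN F)).
  exact: (g_mul gG).
- exact: (sub_inv sK).
- exact: (g_one gG).
Qed.

Let A_supp u : G u -> ~ S u -> A u = 0.
Proof.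
move=> Gu nS; apply/eqP; rewrite -sqrf_eq0 A2 big1_seq// => i /= iks.
apply: big1_seq => j /= jks; have Gi := ksG iks; have Gj := ksG jks.
have Giu := g_mul gG Gi Gu; have Gvj := g_inv gG Gj.
rewrite aS ?expr0n//; first exact: (g_mul gG).
move=> h; apply: nS; apply/(SL (ks_K iks) Gu).
by apply/(SR (sub_inv sK (ks_K jks)) Giu).
Qed.

Let Af_hecke : hecke_fun gm g1 G K Af.
Proof.
split.
- by move=> k z Kk Gz; rewrite /Af A_left.
- by move=> k z Kk Gz; rewrite /Af A_right.
apply: sub_finite_set Sfin => C [hC nz]; have Gr := repG gG sK hC.
exists (rep g1 C); last exact: (rcoset_rep gG sK hC).
by apply: contrapT => nS; move: nz; rewrite /Af A_supp// eqxx.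
Qed.

Let Bf_left : left_K_inv gm G K Bf.
Proof.
move=> k y Kk Gy; congr Complex; congr Num.sqrt.
by apply: (tsum (phi := fun z => Bc z ^+ 2)) => // n z Nn Gz; rewrite BcN.
Qed.

Let cabs2_real (x : R) : cabs2 (Complex x 0) = x ^+ 2.
Proof. by rewrite /cabs2 /cre /cim /= expr0n addr0. Qed.

Let Bf_norm : (l2norm2 gm g1 G K Bf <= m%:E * \int[mu]_(x in G) ((b x) ^+ 2)%:E)%E.
Proof.
have b2_0 x : (0 <= (b x ^+ 2)%:E)%E by rewrite lee_fin sqr_ge0.
apply: (@le_trans _ _ (m%:E * \esum_(C in rcosets gm G K)
    \int[mu]_(x in C) ((b x) ^+ 2)%:E)%E); last first.
  apply: lee_wpmul2l; first by rewrite lee_fin ltW.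
  by rewrite KE; exact: (esum_integral_rcosets_le gp).
rewrite -esumZl//; last by move=> C _; exact: integral_ge0.
rewrite /l2norm2; apply: le_esum => C hC; have Gr := repG gG sK hC.
rewrite /Bf cabs2_real Bt2 -{2}(rcoset_rep gG sK hC) tint//.
rewrite -sumEFin ge0_sume_distrr; last by move=> k _; exact: integral_ge0.
rewrite big_seq [leRHS]big_seq; apply: lee_sum => k kks.
by apply: (BcE _).2; apply: (g_mul gG) => //; exact: ksG.
Qed.

Let Bf_fin : (l2norm2 gm g1 G K Bf < +oo)%E.
Proof.
by apply: le_lt_trans Bf_norm _; exact: lte_mul_pinfty.
Qed.

Let w x := (1 + l x) `^ (2 * s).

Let g x := a x ^+ 2 * w x.

Let w_left k x : K k -> G x -> w (gm k x) = w x.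
Proof. by move=> Kk Gx; rewrite /w (len_left gG sK ll). Qed.
Let w_right k x : K k -> G x -> w (gm x k) = w x.
Proof. by move=> Kk Gx; rewrite /w (len_right gG sK ll). Qed.

Let g_left n x : N F n -> G x -> g (gm n x) = g x.
Proof. by move=> Nn Gx; rewrite /g aL// w_left//; exact: NK. Qed.

Let g_ge0 x : 0 <= g x.
Proof. by rewrite mulr_ge0 ?sqr_ge0 ?powR_ge0. Qed.

(** For fixed [j] the sum over [i] is the integral of [g] over the coset [K r j^-1]. Right
    translation by [j^-1] permutes these cosets, so every [j] contributes the whole integral of
    [g]. *)
Let Af_weighted : (m%:E * weighted_norm2 gm g1 G K l s Af =
  (size ks)%:R%:E * \int[mu]_(x in G) (g x)%:E)%E.
Proof.
rewrite /weighted_norm2 -esumZl//; last first.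
  by move=> C _; rewrite lee_fin mulr_ge0 ?cabs2_ge0 ?powR_ge0.
transitivity (\esum_(C in rcosets gm G K) \sum_(j <- ks)
    \int[mu]_(x in rcoset gm K (gm (rep g1 C) (gi j))) (g x)%:E)%E.
  apply: eq_esum => C hC; have Gr := repG gG sK hC.
  rewrite cabs2_real A2 exchange_big /= mulr_suml -EFinM mulr_sumr -sumEFin.
  apply: eq_big_seq => j jks; have Gvj := g_inv gG (ksG jks).
  have Grj := g_mul gG Gr Gvj; rewrite tinv//; congr EFin; congr (_ * _).
  rewrite mulr_suml; apply: eq_big_seq => i iks; have Gi := ksG iks.
  rewrite /g w_left//; last exact: ks_K.
  by rewrite w_right//; exact: (sub_inv sK (ks_K jks)).
rewrite esum_sum; last by move=> C j _ _; apply: integral_ge0 => x _; rewrite lee_fin.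
rewrite (eq_big_seq (fun=> \int[mu]_(x in G) (g x)%:E)%E); last first.
  move=> j jks; apply: (integral_mulr_Hbar gp hp hm HF) => //.
  exact: (sub_inv sK (ks_K jks)).
have : (0 <= \int[mu]_(x in G) (g x)%:E)%E by apply: integral_ge0 => x _; rewrite lee_fin.
elim: ks => [|j ks' IH] I0; first by rewrite big_nil mul0e.
rewrite big_cons IH//= -add1n natrD EFinD ge0_muleDl// ?mul1e//.
Qed.

Let T x : R := fine (\int[mu]_(y in G) (a (gm x (gi y)) * b y)%:E)%E.

Let Pt x C j k := a (gm (gm k (gm x (gi (rep g1 C)))) (gi j)).

(** On the coset of [N F] through [j r] the kernel is constant by right invariance, and [b]
    integrates to [Bc]. The extra left factor [k] is the variable of the later Minkowski
    inequality. *)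
Let conv_formula x (sx : seq (set X)) k : G x -> uniq sx ->
  [set` sx] `<=` rcosets gm G K ->
  (forall C, rcosets gm G K C -> C \notin sx -> ~ S (gm x (gi (rep g1 C)))) ->
  K k -> (\int[mu]_(y in G) (a (gm (gm k x) (gi y)) * b y)%:E =
   (\sum_(C <- sx) \sum_(j <- ks) Pt x C j k * Bc (gm j (rep g1 C)))%:E)%E.
Proof.
move=> Gx us sxI sxS Kk; have Gk := sub_in sK Kk; have Gkx := g_mul gG Gk Gx.
pose psi y := (a (gm (gm k x) (gi y)) * b y)%:E.
have aN n y : N F n -> G y -> a (gm (gm k x) (gi (gm n y))) = a (gm (gm k x) (gi y)).
  move=> Nn Gy; have Gn := sub_in (sN F) Nn; have Gvy := g_inv gG Gy.
  rewrite (ginvM gG Gn Gy) (gmulA gG (gm k x) (gi y) (gi n)) aR//.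
    exact: (sub_inv (sN F)).
  exact: (g_mul gG).
have mpsi : measurable_fun (G : set B) psi.
  apply/measurable_EFinP; apply: measurable_funM => //.
  exact: (left_inv_measurable gp aN).
have psi0 y : (0 <= psi y)%E by rewrite lee_fin mulr_ge0.
have supp C y : rcosets gm G K C -> C y -> C \notin sx -> psi y = 0%E.
  move=> hC Cy Csx; have Gr := repG gG sK hC.
  have [k' Kk' Ey] : rcoset gm K (rep g1 C) y by rewrite (rcoset_rep gG sK hC).
  have Gk' := sub_in sK Kk'; have Gvr := g_inv gG Gr; have Gvk' := g_inv gG Gk'.
  have Gxr := g_mul gG Gx Gvr; have Gkxr := g_mul gG Gk Gxr.
  rewrite /psi aS ?mul0r//.
    by apply: (g_mul gG) => //; apply: (g_inv gG); exact: (rcosets_sub gG sK hC).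
  rewrite -Ey (ginvM gG Gk' Gr) (gmulA gG (gm k x)) -(gmulA gG k x).
  move=> /(SR (sub_inv sK Kk') Gkxr)/(SL Kk Gxr); exact: sxS.
have -> : (\int[mu]_(y in G) psi y = \esum_(C in rcosets gm G K) \int[mu]_(y in C) psi y)%E.
  rewrite KE; apply/eqP; rewrite eq_le (esum_integral_rcosets_le gp)// andbT.
  apply: (integral_rcosets_le_esum gp) => // r r0.
  apply: (@sub_finite_set _ _ [set` sx]); last exact: finite_seq.
  move=> C [hC [y Cy ry]]; rewrite /=; apply/negPn/negP => nC.
  have hC' : rcosets gm G K C by rewrite KE.
  by move: ry; rewrite (supp C y hC' Cy nC) leNgt lte_fin r0.
rewrite (esum_seq us sxI); last 2 first.
- by move=> C _; exact: integral_ge0.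
- by move=> C hC Csx; apply: integral0_eq => y Cy; exact: (supp C).
rewrite -sumEFin; apply: eq_big_seq => C Csx; have hC := sxI _ Csx.
have Gr := repG gG sK hC; rewrite -{1}(rcoset_rep gG sK hC) tint//.
rewrite -sumEFin; apply: eq_big_seq => j jks; have Gj := ksG jks.
have Gjr := g_mul gG Gj Gr; have Gvr := g_inv gG Gr; have Gvj := g_inv gG Gj.
have jrG := rcoset_sub gG (sN F) Gjr.
have E : gm (gm k x) (gi (gm j (rep g1 C))) =
    gm (gm k (gm x (gi (rep g1 C)))) (gi j).
  rewrite (ginvM gG Gj Gr) (gmulA gG (gm k x) _ (gi j)).
  by rewrite -(gmulA gG k x).
transitivity (\int[mu]_(y in rcoset gm (N F) (gm j (rep g1 C)))
    ((Pt x C j k)%:E * (b y)%:E))%E.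
  apply: eq_integral => y /set_mem hy; rewrite /psi EFinM; congr (_%:E * _)%E.
  by rewrite /Pt -E; apply: (left_inv_rcoset aN).
rewrite ge0_integralZl_EFin//.
- by rewrite (BcE Gjr).1 -EFinM.
- exact: (measurable_rcoset gp).
- by move=> y _; rewrite lee_fin.
- apply/measurable_EFinP; apply: measurable_funS mb => //; exact: measurable_Gbar.
- exact: a_ge0.
Qed.

Let T_E x : G x -> (\int[mu]_(y in G) (a (gm x (gi y)) * b y)%:E = (T x)%:E)%E.
Proof.
move=> Gx; have [sx [us sxI sxS]] := conv_supp Gx.
have := conv_formula Gx us sxI sxS (sub_one sK).
by rewrite (gmul1 gG x) /T => ->.
Qed.

Let T_left n x : N F n -> G x -> T (gm n x) = T x.
Proof.
move=> Nn Gx; congr fine; apply: eq_integral => y /set_mem Gy; congr EFin.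
have Gvy := g_inv gG Gy; congr (_ * _); rewrite -(gmulA gG n x (gi y)) aL//.
exact: (g_mul gG).
Qed.

(* Minkowski's inequality over [ks], after Cauchy-Schwarz on each coset *)
Let T_sum x : G x -> \sum_(i <- ks) T (gm i x) ^+ 2 <=
  cabs2 (conv_disc gm gi g1 G K Af Bf x).
Proof.
move=> Gx; have [sx [us sxI sxS]] := conv_supp Gx.
have TE i : i \in ks ->
    T (gm i x) = \sum_(C <- sx) \sum_(j <- ks) Pt x C j i * Bc (gm j (rep g1 C)).
  by move=> iks; rewrite /T (conv_formula Gx us sxI sxS (ks_K iks)).
have -> : conv_disc gm gi g1 G K Af Bf x =
    Complex (\sum_(C <- sx) A (gm x (gi (rep g1 C))) * Bt (rep g1 C)) 0.
  rewrite /conv_disc (fsbig_seq_supp us sxI); last first.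
    move=> C hC Cs; rewrite /Af A_supp ?mul0r//; last exact: sxS.
    by apply: (g_mul gG) => //; apply/(g_inv gG)/(repG gG sK).
  have E C : Af (gm x (gi (rep g1 C))) * Bf (rep g1 C) =
      Complex (A (gm x (gi (rep g1 C))) * Bt (rep g1 C)) 0.
    by rewrite /Af /Bf /GRing.mul /= !mul0r !mulr0 subr0 addr0.
  under eq_bigr do rewrite E.
  elim: sx {us sxI sxS TE} => [|C sx IH]; first by rewrite !big_nil.
  by rewrite !big_cons IH /GRing.add /= addr0.
rewrite cabs2_real (eq_big_seq (fun i => (\sum_(C <- sx) \sum_(j <- ks)
    Pt x C j i * Bc (gm j (rep g1 C))) ^+ 2)); last by move=> i /TE->.
apply: (@sum_minkowski R X (set X) ks sx
  (fun C i => \sum_(j <- ks) Pt x C j i * Bc (gm j (rep g1 C)))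
  (fun C => A (gm x (gi (rep g1 C))) * Bt (rep g1 C))).
  by move=> C; rewrite mulr_ge0 ?sqrtr_ge0.
move=> C; rewrite exprMn A2 Bt2 mulr_suml; apply: ler_sum => i _.
exact: sum_cauchy_schwarz.
Qed.

(** The square of [T] contributes a factor [m], which [Af_weighted] turns into [size ks]; [Bf_norm]
    brings another [m], and [size ks] times [m] is [mu K]. *)
Lemma biinv_conv_bound_aux :
  (\int[mu]_(x in G) ((T x) ^+ 2)%:E <= (c ^+ 2)%:E * mu K *
   \int[mu]_(x in G) (g x)%:E * \int[mu]_(x in G) ((b x) ^+ 2)%:E)%E.
Proof.
have I0 : (0 <= \int[mu]_(x in G) (g x)%:E)%E by apply: integral_ge0 => x _; rewrite lee_fin.
have J0 : (0 <= \int[mu]_(x in G) ((b x) ^+ 2)%:E)%E.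
  by apply: integral_ge0 => x _; rewrite lee_fin sqr_ge0.
have T2N n z : N F n -> G z -> T (gm n z) ^+ 2 = T z ^+ 2 by move=> Nn Gz; rewrite T_left.
have h1 : (\int[mu]_(x in G) ((T x) ^+ 2)%:E <=
    m%:E * l2norm2 gm g1 G K (conv_disc gm gi g1 G K Af Bf))%E.
  rewrite /l2norm2 (integral_left_inv gp hp hm HF)//; last by move=> x _; exact: sqr_ge0.
  rewrite -esumZl//; last by move=> C _; rewrite lee_fin cabs2_ge0.
  apply: le_esum => C hC; have Gr := repG gG sK hC.
  rewrite -{1}(rcoset_rep gG sK hC) tinv//; last by move=> x _; exact: sqr_ge0.
  by rewrite -EFinM lee_fin ler_pM2l// T_sum.
apply: (le_trans h1).
have h2 := Hl Af_hecke Bf_left Bf_fin.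
apply: (le_trans (lee_wpmul2l (_ : 0 <= m%:E)%E h2)); first by rewrite lee_fin ltW.
rewrite !muleA (muleC m%:E) -(muleA (c ^+ 2)%:E) Af_weighted.
rewrite (haar_Hbar_transversal gp hp hm HF ks_uniq ks_K ks_cov ks_inj mE).
apply: le_trans (lee_wpmul2l _ Bf_norm) _.
  by rewrite !mule_ge0// lee_fin ?sqr_ge0.
rewrite le_eqVlt; apply/orP; left; apply/eqP.
rewrite (EFinM (size ks)%:R m) -!muleA; congr (_ * (_ * _))%E; exact: muleCA.
Qed.

Lemma biinv_conv_fin_aux :
  (forall x, G x -> \int[mu]_(y in G) (a (gm x (gi y)) * b y)%:E = (T x)%:E)%E /\
  (forall n x, N F n -> G x -> T (gm n x) = T x).
Proof. by split=> [x Gx|n x Nn Gx]; [exact: T_E|exact: T_left]. Qed.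

End WithTransversal.

Lemma biinv_conv_bound : exists T : X -> R,
  [/\ forall x, G x -> (\int[mu]_(y in G) (a (gm x (gi y)) * b y)%:E = (T x)%:E)%E,
      forall n x, N F n -> G x -> T (gm n x) = T x &
  (\int[mu]_(x in G) ((T x) ^+ 2)%:E <= (c ^+ 2)%:E * mu K *
   \int[mu]_(x in G) (a x ^+ 2 * (1 + l x) `^ (2 * s))%:E *
   \int[mu]_(x in G) ((b x) ^+ 2)%:E)%E].
Proof.
have [ks [us ksK kscov ksinj]] := stab_transversal gp hp HF.
have [m m0 mE] := haar_stabE gp hp hm HF.
have [h1 h2] := biinv_conv_fin_aux us ksK kscov ksinj m0 mE.
exists (fun x => fine (\int[mu]_(y in G) (a (gm x (gi y)) * b y)%:E)%E).
split=> //; exact: (biinv_conv_bound_aux us ksK kscov ksinj m0 mE).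
Qed.

End BiInvariantConvolution.

(** * Passage to complex functions and to the limit *)

Section HaarFromDisc.
Context {R : realType} {gT : pointedType} (mul : gT -> gT -> gT)
  (inv : gT -> gT) (e : gT) (H : set gT).
Hypothesis gp : is_group mul inv e.
Hypothesis hp : hecke_pair mul inv e setT H.

Local Notation X := (GbarT mul H).
Local Notation B := (GbarB mul H).
Local Notation G := (Gbar mul H).
Local Notation K := (Hbar mul H).
Local Notation gm := (@smul gT mul H).
Local Notation gi := (@sinv gT mul H).
Local Notation g1 := (@sone gT mul H).
Local Notation N F := (@stab gT mul H F).
Let gG : group_on gm gi g1 G := group_on_Gbar H gp.
Let sK : is_subgroup gm gi g1 G K := sub_Hbar gp hp.
Let KE : K = N [:: H] := HbarE gp hp.

(** The l^1 modulus is continuous, bounds both parts of a product by the product of moduli, and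
    exceeds the usual modulus by at most the square root of 2. *)
Definition cabs1 (z : R[i]) : R := `|cre z| + `|cim z|.

Lemma cabs1_ge0 z : 0 <= cabs1 z. Proof. by rewrite addr_ge0. Qed.

Lemma cabs1_sq z : cabs1 z ^+ 2 <= 2 * cabs2 z.
Proof.
rewrite /cabs1 /cabs2 -(real_normK (num_real (cre z))) -(real_normK (num_real (cim z))).
rewrite -subr_ge0 (_ : _ - _ = (`|cre z| - `|cim z|) ^+ 2) ?sqr_ge0//; ring.
Qed.

Lemma cabs1_cre (u v : R[i]) : `|cre (u * v)| <= cabs1 u * cabs1 v.
Proof.
case: u => a b; case: v => c d; rewrite /cabs1 /cre /cim /=.
rewrite (le_trans (ler_normB _ _))// !normrM mulrDl !mulrDr.
by have := mulr_ge0 (normr_ge0 a) (normr_ge0 d);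
  have := mulr_ge0 (normr_ge0 b) (normr_ge0 c); lra.
Qed.

Lemma cabs1_cim (u v : R[i]) : `|cim (u * v)| <= cabs1 u * cabs1 v.
Proof.
case: u => a b; case: v => c d; rewrite /cabs1 /cre /cim /=.
rewrite (le_trans (ler_normD _ _))// !normrM mulrDl !mulrDr.
by have := mulr_ge0 (normr_ge0 a) (normr_ge0 c);
  have := mulr_ge0 (normr_ge0 b) (normr_ge0 d); lra.
Qed.

Lemma cabs2_le_sq (z : R[i]) t : `|cre z| <= t -> `|cim z| <= t -> cabs2 z <= 2 * t ^+ 2.
Proof.
move=> h1 h2; have t0 : 0 <= t by exact: le_trans h1.
rewrite /cabs2 -(real_normK (num_real (cre z))) -(real_normK (num_real (cim z))).
have : `|cre z| ^+ 2 <= t ^+ 2 by rewrite ler_sqr ?nnegrE.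
have : `|cim z| ^+ 2 <= t ^+ 2 by rewrite ler_sqr ?nnegrE.
lra.
Qed.

Variable mu : {measure set B -> \bar R}.
Hypothesis hm : right_haar mu.

Section Bound.
Variables (l : X -> R) (s c : R).
Hypothesis ll : length_fun gm gi g1 G K l.
Hypothesis Hl : forall f, hecke_fun gm g1 G K f ->
  forall xi, left_K_inv gm G K xi -> (l2norm2 gm g1 G K xi < +oo)%E ->
    (l2norm2 gm g1 G K (conv_disc gm gi g1 G K f xi) <=
     (c ^+ 2)%:E * weighted_norm2 gm g1 G K l s f * l2norm2 gm g1 G K xi)%E.

Let w x := (1 + l x) `^ (2 * s).
Let w0 x : 0 <= w x. Proof. exact: powR_ge0. Qed.
Let w_left k x : K k -> G x -> w (gm k x) = w x.
Proof. by move=> Kk Gx; rewrite /w (len_left gG sK ll). Qed.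

Let mw : measurable_fun (G : set B) w.
Proof.
by apply: (left_inv_measurable gp (F := [:: H])) => k z Nk Gz; rewrite w_left// KE.
Qed.

Variables (f xi : X -> R[i]) (C : set X).
Hypothesis cre_f : continuous (fun x : X => (cre (f x) : R^o)).
Hypothesis cim_f : continuous (fun x : X => (cim (f x) : R^o)).
Hypothesis cC : compact C.
Hypothesis CG : C `<=` G.
Hypothesis fC : forall x, G x -> ~ C x -> f x = 0.
Hypothesis hxi : L2_fun mu xi.

Let mcabs2_xi : measurable_fun (G : set B) (fun x => cabs2 (xi x)).
Proof. by case: hxi => h1 h2 _; apply: measurable_funD; exact: measurable_funX. Qed.

Let mcabs2_f : measurable_fun (G : set B) (fun x => cabs2 (f x)).
Proof.
by apply: measurable_funD; apply: measurable_funX; exact: (continuous_measurable).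
Qed.

Let b x := cabs1 (xi x).

Let mb : measurable_fun (G : set B) b.
Proof.
by case: hxi => h1 h2 _; apply: measurable_funD; exact: measurableT_comp.
Qed.

Let b_norm : (\int[mu]_(x in G) ((b x) ^+ 2)%:E <= 2%:E * L2norm2 mu xi)%E.
Proof.
rewrite /L2norm2 -ge0_integralZl_EFin//.
- apply: le_integral_ge0 => x Gx; rewrite -EFinM !lee_fin; split; first exact: sqr_ge0.
  exact: cabs1_sq.
- exact: measurable_Gbar.
- by move=> x _; rewrite lee_fin cabs2_ge0.
- exact/measurable_EFinP.
Qed.

Let b_fin : (\int[mu]_(x in G) ((b x) ^+ 2)%:E < +oo)%E.
Proof.
by apply: (le_lt_trans b_norm); apply: lte_mul_pinfty => //; case: hxi.
Qed.

Let indS x : R := if `[< Ksat C x >] then 1 else 0.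

Let indS_left k x : K k -> G x -> indS (gm k x) = indS x.
Proof. by move=> Kk Gx; rewrite /indS (asbool_equiv_eq (Ksat_left gp hp C Kk Gx)). Qed.

Let indS_ge0 x : 0 <= indS x. Proof. by rewrite /indS; case: asboolP. Qed.

Let mindS : measurable_fun (G : set B) indS.
Proof.
by apply: (left_inv_measurable gp (F := [:: H])) => k z Nk Gz; rewrite indS_left// KE.
Qed.

(** [K C K] consists of finitely many right cosets of [K], and the weight is constant on each. This
    number multiplies the error [eps ^+ 2] below. *)
Let weight_Ksat : exists2 v : R, 0 <= v & (\int[mu]_(x in G) (indS x * w x)%:E = v%:E)%E.
Proof.
have I0 : (0 <= \int[mu]_(x in G) (indS x * w x)%:E)%E.
  by apply: integral_ge0 => x _; rewrite lee_fin mulr_ge0.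
suff [v vE] : exists v : R, (\int[mu]_(x in G) (indS x * w x)%:E = v%:E)%E.
  by exists v => //; rewrite -lee_fin -vE.
have /finite_seqP[s0 s0E] := Ksat_finite gp hp cC CG.
have [m _ mE] := haar_stabE gp hp hm (mem_head H [::]).
rewrite (integral_Hbar_inv gp hp hm); last 2 first.
- by move=> k x Kk Gx; rewrite indS_left// w_left.
- by move=> x _; rewrite mulr_ge0.
rewrite KE mE -KE (esum_seq (undup_uniq s0)).
- by rewrite sumEFin -EFinM; eexists.
- move=> D /=; rewrite mem_undup => Ds; have : [set` s0] D by [].
  by rewrite -s0E => -[x [Gx _] <-]; exact: rcoset_in.
- by move=> D _; rewrite lee_fin mulr_ge0.
- move=> D hD; rewrite mem_undup /indS => /negP Ds; case: asboolP => Sr; last by rewrite mul0r.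
  exfalso; apply: Ds; suff : [set` s0] D by []; rewrite -s0E; exists (rep g1 D) => //.
  exact: (rcoset_rep gG sK hD).
Qed.

(** The outer 2 comes from the real and imaginary parts of the convolution; 4 and [2 * eps ^+ 2]
    from [a <= cabs1 f + eps] and [cabs1_sq]; the last 2 from [cabs1_sq] for [xi]. *)
Let eps_bound (eps : R) : 0 < eps ->
  (L2norm2 mu (conv_haar mu f xi) <= 2%:E * ((c ^+ 2)%:E * mu K *
    (4%:E * weighted_L2 mu l s f +
     (2 * eps ^+ 2)%:E * \int[mu]_(x in G) (indS x * w x)%:E) *
    (2%:E * L2norm2 mu xi)))%E.
Proof.
move=> e0; pose a0 x := cabs1 (f x).
have ca0 : continuous (a0 : X -> R^o).
  by move=> x; apply: cvgD; apply: cvg_norm; [exact: cre_f|exact: cim_f].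
have a0C x : G x -> ~ C x -> a0 x = 0.
  by move=> Gx nC; rewrite /a0 fC// /cabs1 /cre /cim /= normr0 addr0.
have [F [a [HF aL aR a_ge0 ha]]] := biinv_approx gp hp ca0 cC CG
  (fun x => cabs1_ge0 (f x)) a0C e0.
have aS x : G x -> ~ Ksat C x -> a x = 0 by move=> /ha[_ _]; exact.
have [T [TE TN Tb]] := biinv_conv_bound gp hp hm ll Hl HF aL aR a_ge0
  (fun k x Kk Gx => Ksat_left gp hp C Kk Gx)
  (fun k x Kk Gx => Ksat_right gp hp C Kk Gx)
  (Ksat_finite gp hp cC CG) aS mb (fun x => cabs1_ge0 (xi x)) b_fin.
have mT : measurable_fun (G : set B) (fun x => T x ^+ 2).
  by apply: measurable_funX; exact: (left_inv_measurable gp TN).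
apply: (@le_trans _ _ (2%:E * \int[mu]_(x in G) ((T x) ^+ 2)%:E)%E).
  rewrite -ge0_integralZl_EFin//; last 3 first.
  - exact: measurable_Gbar.
  - by move=> x _; rewrite lee_fin sqr_ge0.
  - exact/measurable_EFinP.
  apply: le_integral_ge0 => x Gx; rewrite -EFinM !lee_fin; split; first exact: cabs2_ge0.
  have le_ab y : G y -> cabs1 (f (gm x (gi y))) * cabs1 (xi y) <= a (gm x (gi y)) * b y.
    move=> Gy; have Gxy := g_mul gG Gx (g_inv gG Gy).
    by apply: ler_wpM2r; [exact: cabs1_ge0|case: (ha _ Gxy)].
  apply: cabs2_le_sq.
    apply: (normr_Rintegral_le _ (TE x Gx)) => y Gy.
    exact: le_trans (cabs1_cre _ _) (le_ab y Gy).
  apply: (normr_Rintegral_le _ (TE x Gx)) => y Gy.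
  exact: le_trans (cabs1_cim _ _) (le_ab y Gy).
apply: lee_wpmul2l; first by rewrite lee_fin.
apply: (le_trans Tb).
have J0 : (0 <= \int[mu]_(x in G) ((b x) ^+ 2)%:E)%E.
  by apply: integral_ge0 => x _; rewrite lee_fin sqr_ge0.
have cm0 : (0 <= (c ^+ 2)%:E * mu K)%E by rewrite mule_ge0// lee_fin sqr_ge0.
have I0 : (0 <= \int[mu]_(x in G) (a x ^+ 2 * (1 + l x) `^ (2 * s))%:E)%E.
  by apply: integral_ge0 => x _; rewrite lee_fin mulr_ge0 ?sqr_ge0 ?powR_ge0.
apply: lee_pmul => //; first exact: mule_ge0.
apply: lee_wpmul2l => //.
have mfw : measurable_fun (G : set B) (fun x => cabs2 (f x) * w x).
  exact: measurable_funM.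
have miw : measurable_fun (G : set B) (fun x => indS x * w x).
  exact: measurable_funM.
have mG : measurable (G : set B) by exact: measurable_Gbar.
have h1 x : G x -> (0 <= (cabs2 (f x) * w x)%:E)%E.
  by move=> _; rewrite lee_fin mulr_ge0 ?cabs2_ge0 ?powR_ge0.
have h2 x : G x -> (0 <= (indS x * w x)%:E)%E by move=> _; rewrite lee_fin mulr_ge0.
have h3 : measurable_fun (G : set B) (fun x => (cabs2 (f x) * w x)%:E).
  exact/measurable_EFinP.
have h4 : measurable_fun (G : set B) (fun x => (indS x * w x)%:E).
  exact/measurable_EFinP.
have e20 : 0 <= 2 * eps ^+ 2 by rewrite mulr_ge0 ?sqr_ge0 ?powR_ge0.
rewrite /weighted_L2 -(ge0_integralZl_EFin _ mG h1 h3)// -(ge0_integralZl_EFin _ mG h2 h4)//.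
rewrite -ge0_integralD//; last 4 first.
- by move=> x Gx; rewrite mule_ge0// ?lee_fin//; exact: h1.
- by apply: measurable_funeM.
- by move=> x Gx; rewrite mule_ge0// ?lee_fin//; exact: h2.
- by apply: measurable_funeM.
apply: le_integral_ge0 => x Gx; rewrite -!EFinM -EFinD !lee_fin; split.
  by rewrite mulr_ge0 ?sqr_ge0 ?powR_ge0.
rewrite -/(w x) !mulrA -mulrDl ler_wpM2r//.
have [_ haS haN] := ha x Gx; rewrite /indS; case: asboolP => Sx; last first.
  by rewrite haN// expr0n /= mulr0 addr0 mulr_ge0 ?cabs2_ge0 ?powR_ge0.
rewrite mulr1; have h := haS Sx; have a0ge := cabs1_ge0 (f x).
have hsq : a x ^+ 2 <= (a0 x + eps) ^+ 2 by rewrite ler_sqr ?nnegrE// addr_ge0// ltW.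
apply: (le_trans hsq); have hc : a0 x ^+ 2 <= 2 * cabs2 (f x) := cabs1_sq (f x).
have hd : 0 <= (a0 x - eps) ^+ 2 by exact: sqr_ge0.
rewrite !expr2 in hc hd *; lra.
Qed.

Lemma conv_haar_bound (m : R) : mu K = m%:E -> 0 < m ->
  (L2norm2 mu (conv_haar mu f xi) <=
    (16 * c ^+ 2 * m)%:E * weighted_L2 mu l s f * L2norm2 mu xi)%E.
Proof.
move=> mE m0; have [v v0 vE] := weight_Ksat.
have W0 : (0 <= weighted_L2 mu l s f)%E.
  by apply: integral_ge0 => x _; rewrite lee_fin mulr_ge0 ?cabs2_ge0 ?powR_ge0.
have Z0 : (0 <= L2norm2 mu xi)%E.
  by apply: integral_ge0 => x _; rewrite lee_fin cabs2_ge0.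
have Zfin : (L2norm2 mu xi < +oo)%E by case: hxi.
have := eps_bound; rewrite mE vE; move: Z0 Zfin W0.
case: (L2norm2 mu xi) => // z z0 _.
case: (weighted_L2 mu l s f) => [w1 w10 hb|_ hb|//]; last first.
  (* With an infinite weighted norm the right side is infinite unless [z] or [c] vanishes; in these
     cases the bound for [eps = 1] is already 0. *)
  have [zE|z1] := eqVneq z 0.
    by have := hb 1 ltr01; rewrite zE !mule0.
  have [cE|c1] := eqVneq c 0.
    by have := hb 1 ltr01; rewrite cE expr0n /= !mulr0 !mul0r !mul0e !mule0.
  have c2 : 0 < c ^+ 2 by rewrite exprn_even_gt0.
  rewrite gt0_muley; last by rewrite lte_fin mulr_gt0// mulr_gt0.
  by rewrite gt0_mulye ?leey// lte_fin lt_def z1.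
apply/lee_addgt0Pr => d d0.
(* [Q] is the coefficient of [eps ^+ 2] in the bound; dividing by [Q + 1] below also covers
   [Q = 0]. *)
pose Q := 8 * c ^+ 2 * m * v * z.
have Q0 : 0 <= Q.
  apply: mulr_ge0 => //; apply: mulr_ge0 => //; apply: mulr_ge0; last exact: ltW.
  by apply: mulr_ge0 => //; exact: sqr_ge0.
pose eps := Num.sqrt (d / (Q + 1)).
have q1 : 0 < d / (Q + 1) by rewrite divr_gt0// ltr_wpDl.
have eps0 : 0 < eps by rewrite sqrtr_gt0.
have epsE : eps ^+ 2 = d / (Q + 1) by rewrite sqr_sqrtr// ltW.
apply: (le_trans (hb eps eps0)); rewrite -!EFinM -EFinD lee_fin.
rewrite (_ : _ * (_ * _) = 16 * c ^+ 2 * m * w1 * z + Q * (eps ^+ 2)); last first.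
  by rewrite /Q; ring.
rewrite lerD2l epsE mulrA ler_pdivrMr; last by rewrite ltr_wpDl.
by rewrite mulrC ler_pM2l// lerDl.
Qed.

End Bound.

Lemma RD_disc_haar : RD_disc (R := R) gm gi g1 G K -> RD_haar mu.
Proof.
move=> [l [ll [lb [s [c [s0 [c0 Hl]]]]]]]; exists l; split.
  case: ll => bl [l1 [l2 [l3 [l4 l5]]]]; do 5?[split=> //].
  by move=> _ ->.
split.
  move=> C cC CG; have := compact_rcosets gp [:: H] cC CG; rewrite -KE => fin.
  have [|M hM] := lb [set rcoset gm K x | x in C] _ fin.
    by move=> _ [x Cx <-]; exact/rcoset_in/CG.
  exists M => x Cx; apply: (hM (rcoset gm K x)); first by exists x.
  exact: (rcoset_refl gG sK).
have [m m0 mE] := haar_stabE gp hp hm (mem_head H [::]); rewrite -KE in mE.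
exists s, (4 * c * Num.sqrt m); split=> //; split.
  by rewrite !mulr_gt0// sqrtr_gt0.
move=> f [cf1 cf2 [C [cC CG] fC]] xi hxi.
rewrite (_ : (4 * c * Num.sqrt m) ^+ 2 = 16 * c ^+ 2 * m).
  exact: (conv_haar_bound ll Hl cf1 cf2 cC CG fC hxi mE m0).
by rewrite !exprMn sqr_sqrtr ?ltW//; ring.
Qed.

End HaarFromDisc.

Theorem theorem3p10 (R : realType) (gT : pointedType)
  (mul : gT -> gT -> gT) (inv : gT -> gT) (e : gT) (H : set gT) :
  is_group mul inv e ->
  hecke_pair mul inv e setT H ->
  reduced_pair mul inv e setT H ->
  (* (i) the discrete Hecke pair (G,H) has (RD) *)
  (RD_disc (R := R) (X := discrete_topology gT) mul inv e setT H <->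
  (* (ii) the Hecke pair (bar G, bar H) has (RD) *)
   RD_disc (R := R) (@smul gT mul H) (@sinv gT mul H) (@sone gT mul H)
     (Gbar mul H) (Hbar mul H)) /\
  (RD_disc (R := R) (@smul gT mul H) (@sinv gT mul H) (@sone gT mul H)
     (Gbar mul H) (Hbar mul H) <->
  (* (iii) the tdlc group bar G has (RD) *)
   RD_group (R := R) mul H).
Proof.
move=> gp hp _; split; first exact: (schlichting_RD_disc gp hp).
split=> [rd|[mu [hm rd]]]; last exact: (RD_haar_disc gp hp hm rd).
exists (haar_measure (R := R) gp hp); have hm := haar_measure_right_haar (R := R) gp hp.
by split=> //; exact: (RD_disc_haar gp hp hm rd).
Qed.
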